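(* Let $\alpha\in(0,2)$, $x_0\in\mathbb{R}$, $r>0$ and $D=(x_0-r,x_0+r)$. Then there is a constant $\mu_{\alpha,D}>0$ such that the interior Bernoulli problem with one free boundary point on $D$ with parameter $\lambda>0$ has (1) exactly two solutions for $\lambda>\mu_{\alpha,D}$, (2) exactly one solution for $\lambda=\mu_{\alpha,D}$, (3) no solution for $\lambda<\mu_{\alpha,D}$. We also have $\mu_{\alpha,D}=\mu_{\alpha,(x_0-r,x_0+r)}=r^{-\alpha/2}\mu_{\alpha,(-1,1)}$.
   Context: For $\alpha\in(0,2)$ the fractional Laplacian on $\mathbb{R}$ is $$(-\Delta)^{\alpha/2}f(x) = \lim_{\varepsilon \to 0^+} \frac{\alpha 2^{\alpha-1}\Gamma\left(\frac{1+\alpha}{2}\right)}{\pi^{1/2}\Gamma(1-\alpha/2)}\int_{\{z\in\mathbb{R}:\,|z|>\varepsilon\}}\frac{f(x+z)-f(x)}{|z|^{1+\alpha}}\,dz .$$ Interior Bernoulli problem with one free boundary point: given $\alpha\in(0,2)$, $x_0\in\mathbb{R}$, $r>0$, $D=(x_0-r,x_0+r)$ and a constant $\lambda>0$, a solution is a pair $(u,K)$ where $u:\mathbb{R}\to[0,1]$ is Borel measurable and continuous in $D$, and $K=(a,x_0+r)\subset D$ is an interval, such that $(-\Delta)^{\alpha/2}u(x)=0$ for $x\in D\setminus\overline{K}$; $u(x)=1$ for $x\in\overline{K}\setminus\{x_0+r\}$; $u(x)=0$ for $x\in D^c=\mathbb{R}\setminus D$; $D_n^{\alpha/2}u(a)=-\lambda$.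 Here $D_n^{\alpha/2}u(a)=\lim_{t\to0^+}\frac{u(a+t\,n(a))-u(a)}{t^{\alpha/2}}$ with $n(a)=-1$ the outward unit normal to $K$ at $a$, i.e. $D_n^{\alpha/2}u(a)=\lim_{t\to0^+}\frac{u(a-t)-u(a)}{t^{\alpha/2}}$. *)

(* Defs.v *)
From mathcomp Require Import all_boot all_order all_algebra.
From mathcomp Require Import all_classical all_reals all_analysis.
Import Order.TTheory GRing.Theory Num.Theory.
Import numFieldNormedType.Exports.

Set Implicit Arguments.
Unset Strict Implicit.
Unset Printing Implicit Defensive.

Local Open Scope classical_set_scope.
Local Open Scope ring_scope.

Section bernoulli.
Context {R : realType}.
Implicit Types (alpha lambda r a n x l s : R) (f u : R -> R) (K : set R).

(* Euler's integral: meaningful only for [0 < s]. *)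
Definition Gamma s : R :=
  \int[@lebesgue_measure R]_(t in `]0, +oo[%classic) (t `^ (s - 1) * expR (- t)).

Definition frac_lap_const alpha : R :=
  alpha * 2 `^ (alpha - 1) * Gamma ((1 + alpha) / 2)
  / (pi `^ (1 / 2) * Gamma (1 - alpha / 2)).

Definition frac_lap_trunc alpha f x (eps : R) : R :=
  frac_lap_const alpha *
  \int[@lebesgue_measure R]_(z in [set z | eps < `|z|])
    ((f (x + z) - f x) / `|z| `^ (1 + alpha)).

(* A relation, because [lim] returns 0 on divergent filters. The difference is
   f (x + z) - f x, i.e. the sign of the generator: the operator is negative at
   a maximum of f. *)
Definition is_frac_lap alpha f x l : Prop :=
  frac_lap_trunc alpha f x eps @[eps --> 0^'+] --> l.

Definition is_frac_normal_derive alpha u a n l : Prop :=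
  (u (a + t * n) - u a) / t `^ (alpha / 2) @[t --> 0^'+] --> l.

Definition sym_itv x0 r : set R := `]x0 - r, x0 + r[%classic.

(* The outward unit normal to `]a, x0 + r[ at a is -1. *)
Definition bernoulli_solution alpha x0 r lambda (uK : (R -> R) * set R) : Prop :=
  let: (u, K) := uK in
  let D := sym_itv x0 r in
  [/\ (forall x, 0 <= u x <= 1),
      measurable_fun [set: R] u,
      {in D, continuous u} &
      exists a,
        [/\ a < x0 + r, K = `]a, x0 + r[%classic & K `<=` D] /\
        [/\ (forall x, (D `\` closure K) x -> is_frac_lap alpha u x 0),
            (forall x, (closure K `\ (x0 + r)) x -> u x = 1),
            (forall x, (~` D) x -> u x = 0) &
            is_frac_normal_derive alpha u a (-1) (- lambda)]].

Definition bernoulli_solutions alpha x0 r lambda : set ((R -> R) * set R) :=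
  [set uK | bernoulli_solution alpha x0 r lambda uK].

End bernoulli.

(* Main.v *)
Require Import Defs.
From mathcomp Require Import all_boot all_order all_algebra.
From mathcomp Require Import all_classical all_reals all_analysis.
From mathcomp Require Import measurable_realfun real_interval.
From mathcomp Require Import ring lra.
Import Order.TTheory GRing.Theory Num.Theory.
Import numFieldNormedType.Exports.
Set Implicit Arguments.
Unset Strict Implicit.
Unset Printing Implicit Defensive.
Local Open Scope classical_set_scope.
Local Open Scope ring_scope.

(** Write alpha = 2 b, D = (p, e) and K = (q, e). Everything in the problem except
the slope condition determines u: by a comparison principle
([frac_lap_comparison]) there is at most one function with values in [0, 1]
that is continuous and harmonic on (p, q), equal to 1 on [q, e) and to 0 off D.
M. Riesz's Poisson integral ([usol])

  u(x) = B^-1 * int_q^e (((x-p)(q-x)) / ((y-p)(y-q)))^b dy / (y-x),  p < x < q,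

where B = int_0^oo w^-b / (1+w) dw, is such a function. So, for given lambda,
the problem is one equation in the unknown q. With v = (e-q) / (q-p), dominated
convergence computes the slope of u at q ([usol_normal_derive],
[normal_slope]): lambda = (e-p)^-b * profile v / B. The function [profile]
tends to +oo at 0 and at +oo, and its derivative has the sign of an increasing
function, so it decreases strictly and then increases strictly
([profile_unimodal]): every value above its minimum is taken exactly twice, the
minimum once and no value below it. The correspondence between q and v in
(0, +oo) is bijective and e - p = 2 r, hence the threshold is
mu = (2 r)^-b * (min profile) / B, which scales like r^-b.

Harmonicity of u is proved by a direct computation. Fix x in (p, q), put
A = q - x and C = x - p. The fractional Laplacian at x is a limit of two
one-sided integrals. Cut the right one at k s / (1 + th s) and the left one at
k s / (1 - th s), where k = 2 A C / (A + C) and th = (C - A) / (A + C). The two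
Moebius maps carry (0, 1) onto (0, A) and onto (0, C) and give the weight
((A - z) (C + z))^b the same form on both sides, so the two integrals merge
into one integral of w^(-1-b) over w > s^2 / (1 - s^2) ([two_branches]). For
the Poisson kernel with pole at y the merged integrand is
w^(-1-b) / (1 + kappa w), whose integral over w > w0 is
w0^-b / b - kappa^b B + O(w0^(1-b)). Multiplied by the common factor, the first
term is the singular part that the subtraction of u(x) cancels, and the second
one is exactly compensated by the mass that u carries at y ([kernel_tails]).
Integration over y by Tonelli's theorem shows that u is [balanced]
([usol_balanced]), and a balanced function that is Lipschitz near x has
vanishing fractional Laplacian there ([balanced_frac_lap]): replacing the two
skew cuts by one symmetric cut costs O(s^(2-2b)).

The same change of variables shows that ((x-p)(q-x))^(b-1), extended by 0, is
harmonic on (p, q) ([barrier_balanced]). It blows up at p and q, so if f - g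
were positive somewhere, then f - g minus a small multiple of this barrier would
have an interior positive maximum, where the operator is strictly negative
([interior_max_contra]). This gives the comparison principle for functions
that may be discontinuous at p and q. *)

(** * Derivatives and nonnegative changes of variable *)

Section calculus.
Context {R : realType}.
Implicit Types (f g : R -> R) (x c d : R).

(** A plain conjunction, so that the value of the derivative can stay an existential
variable until the tactic [deriv] has computed it, without the instance
resolution attached to [is_derive]. *)
Definition has_deriv f x d := derivable f x 1 /\ 'D_1 f x = d.

Lemma has_derivP f x d : has_deriv f x d <-> is_derive x 1 f d.
Proof. by split=> [[? ?]|[? ?]]; split. Qed.

Lemma has_deriv_eq f x d d' : has_deriv f x d -> d = d' -> has_deriv f x d'.
Proof. by move=> ? <-. Qed.

Lemma has_deriv_cst c x : has_deriv (fun=> c) x 0.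
Proof. by apply/has_derivP; exact: is_derive_cst. Qed.

Lemma has_deriv_id x : has_deriv (fun y => y) x 1.
Proof. by apply/has_derivP; exact: is_derive_id. Qed.

Lemma has_deriv_add f g x df dg : has_deriv f x df -> has_deriv g x dg ->
  has_deriv (fun y => f y + g y) x (df + dg).
Proof. by move=> /has_derivP hf /has_derivP hg; apply/has_derivP; exact: is_deriveD hf hg. Qed.

Lemma has_deriv_opp f x df : has_deriv f x df -> has_deriv (fun y => - f y) x (- df).
Proof. by move=> /has_derivP hf; apply/has_derivP; exact: is_deriveN hf. Qed.

Lemma has_deriv_mul f g x df dg : has_deriv f x df -> has_deriv g x dg ->
  has_deriv (fun y => f y * g y) x (df * g x + f x * dg).
Proof.
move=> /has_derivP hf /has_derivP hg; apply/has_derivP.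
by rewrite addrC (mulrC df); exact: is_deriveM hf hg.
Qed.

Lemma has_deriv_inv f x df : has_deriv f x df -> f x != 0 ->
  has_deriv (fun y => (f y)^-1) x (- df / f x ^+ 2).
Proof.
move=> /has_derivP hf f0; apply/has_derivP.
by rewrite mulNr mulrC -mulNr; exact: is_deriveV f0 hf.
Qed.

Lemma has_deriv_powR f x df (g : R) : has_deriv f x df -> 0 < f x ->
  has_deriv (fun y => f y `^ g) x (g * f x `^ (g - 1) * df).
Proof.
move=> /has_derivP hf f0; apply/has_derivP.
exact: is_derive1_comp (is_derive1_powR g f0) hf.
Qed.

Lemma has_deriv_exp f x df n : has_deriv f x df ->
  has_deriv (fun y => f y ^+ n) x (n%:R * f x ^+ n.-1 * df).
Proof.
move=> /has_derivP hf; apply/has_derivP.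
by have := is_deriveX n hf; rewrite exprfctE.
Qed.

Lemma has_deriv_continuous f x d : has_deriv f x d -> {for x, continuous f}.
Proof.
by move=> [df _]; apply: differentiable_continuous; apply/derivable1_diffP.
Qed.

End calculus.
(** Differentiates by recursion on the syntax of the function; leaves the
nonvanishing and positivity conditions of inverses and powers as goals. *)
Ltac deriv := lazymatch goal with
  | |- has_deriv (fun _ => ?c) _ _ => eapply has_deriv_cst
  | |- has_deriv (fun y => y) _ _ => eapply has_deriv_id
  | |- has_deriv (fun y => @?f y + @?g y) _ _ => eapply (@has_deriv_add _ f g); deriv
  | |- has_deriv (fun y => @?f y * @?g y) _ _ => eapply (@has_deriv_mul _ f g); deriv
  | |- has_deriv (fun y => @?f y ^+ ?n) _ _ => eapply (@has_deriv_exp _ f _ _ n); deriv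
  | |- has_deriv (fun y => - @?f y) _ _ => eapply (@has_deriv_opp _ f); deriv
  | |- has_deriv (fun y => (@?f y)^-1) _ _ => eapply (@has_deriv_inv _ f); [deriv|]
  | |- has_deriv (fun y => @?f y `^ ?g) _ _ => eapply (@has_deriv_powR _ f _ _ g); [deriv|]
  | _ => idtac end.
(** Continuity at a point of an expression that [deriv] can differentiate. *)
Ltac cont := eapply has_deriv_continuous; deriv.

Section substitution.
Context {R : realType}.
Notation mu := (@lebesgue_measure R).
Implicit Types (F G H : R -> R).

(** Closed subintervals increasing to I: what reduces an improper change of
variable on I to the compact case. *)
Definition exhausts (I : interval R) (u v : nat -> R) :=
  [/\ (forall n, u n \in I /\ v n \in I), (forall n, u n <= v n),
      nonincreasing_seq u, nondecreasing_seq v &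
      forall x, x \in I -> exists n, u n <= x <= v n].

Let small_quotient (c e : R) : 0 < e -> 0 <= c -> exists n : nat, c / n.+1%:R < e.
Proof.
move=> e0 c0; exists (Num.truncn (c / e)).
rewrite ltr_pdivrMr// mulrC -ltr_pdivrMr//.
by rewrite -[ltRHS]natr1 natr1; apply: truncnS_gt.
Qed.

Lemma exhausts_oo (a b : R) : a < b -> exists u v, exhausts `]a, b[ u v.
Proof.
move=> ab; pose c := (b - a) / 2.
have c0 : 0 < c by rewrite divr_gt0// subr_gt0.
have cb : b - a = 2 * c by rewrite /c; field.
clearbody c.
have cn n : 0 < c / n.+1%:R <= c.
  by rewrite divr_gt0//= ler_pdivrMr// ler_peMr ?(ltW c0)// ler1n.
exists (fun n => a + c / n.+1%:R), (fun n => b - c / n.+1%:R); split.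
- move=> n; rewrite !in_itv/=; have := cn n; set t := c / _ => /andP[t0 tc]; split; apply/andP; split; lra.
- by move=> n; have := cn n; set t := c / _; lra.
- by move=> m n mn; rewrite lerD2l ler_pM2l// lef_pV2 ?posrE// ler_nat.
- by move=> m n mn; rewrite lerD2l lerN2 ler_pM2l// lef_pV2 ?posrE// ler_nat.
- move=> x; rewrite in_itv/= => /andP[ax xb].
  have m0 : 0 < Num.min (x - a) (b - x) by rewrite lt_min !subr_gt0 ax.
  have [n] := small_quotient m0 (ltW c0).
  rewrite lt_min => /andP[]; set t := c / _ => h1 h2.
  by exists n; rewrite -/t; apply/andP; split; lra.
Qed.

Lemma exhausts_oy (a : R) : exists u v, exhausts `]a, +oo[ u v.
Proof.
have cn n : 0 < (1 : R) / n.+1%:R <= 1.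
  by rewrite divr_gt0//= ler_pdivrMr// mul1r ler1n.
exists (fun n => a + 1 / n.+1%:R), (fun n => a + 1 + n%:R); split.
- move=> n; rewrite !in_itv/= !andbT; have := cn n; have := ler0n R n.
  by set t := 1 / _ => n0 /andP[t0 tc]; split; lra.
- by move=> n; have := cn n; have := ler0n R n; set t := 1 / _; lra.
- by move=> m n mn; rewrite lerD2l ler_pM2l// lef_pV2 ?posrE// ler_nat.
- by move=> m n mn; rewrite lerD2l ler_nat.
- move=> x; rewrite in_itv/= andbT => ax.
  have xa : 0 < x - a by rewrite subr_gt0.
  have [n h1] := small_quotient xa ler01.
  pose m := Num.truncn (x - a).
  have h2 : x - a < m.+1%:R by apply: truncnS_gt.
  exists (maxn n m).
  have h3 : (1 : R) / (maxn n m).+1%:R <= 1 / n.+1%:R.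
    by rewrite ler_pM2l// lef_pV2 ?posrE// ler_nat ltnS leq_maxl.
  have h4 : (m%:R : R) <= (maxn n m)%:R by rewrite ler_nat leq_maxr.
  rewrite -natr1 in h2; move: h1 h2 h3 h4.
  set t := 1 / _; set t' := 1 / _; set j := _%:R; set j' := _%:R => *.
  by apply/andP; split; lra.
Qed.

(** On each segment of an exhaustion this is the change of variable for
increasing maps; for nonnegative integrands both sides pass to the limit by
monotone convergence, whether finite or not. *)
Lemma ge0_substitution (I J : interval R) F (dF : R -> R) H G :
  (exists u v, exhausts I u v) -> open [set` I] -> open [set` J] ->
  {in I &, {homo F : x y / x < y}} ->
  (forall x, x \in I -> F x \in J) ->
  (forall y, y \in J -> H y \in I /\ F (H y) = y) ->
  (forall x, x \in I -> has_deriv F x (dF x)) ->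
  {in I, continuous dF} -> (forall x, x \in I -> 0 <= dF x) ->
  {in J, continuous G} -> (forall x, x \in J -> 0 <= G x) ->
  (\int[mu]_(x in [set` J]) (G x)%:E =
   \int[mu]_(x in [set` I]) (G (F x) * dF x)%:E)%E.
Proof.
move=> [u [v [uvI uv du iv exh]]] Io Jo incF FJ HI dFP cdF dF0 cG G0.
have leF : {in I &, {mono F : x y / x <= y}} by apply: le_mono_in.
have segI n x : u n <= x <= v n -> x \in I.
  have [u1 v1] := uvI n.
  exact: (@interval_is_interval _ I _ _ u1 v1).
have segJ n y : F (u n) <= y <= F (v n) -> y \in J.
  have [u1 v1] := uvI n.
  exact: (@interval_is_interval _ J _ _ (FJ _ u1) (FJ _ v1)).
have EI : [set` I] = \bigcup_n `[u n, v n]%classic.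
  apply/seteqP; split => x /=.
    by move=> /exh[n xn]; exists n => //=; rewrite in_itv.
  by move=> [n _] /=; rewrite in_itv/= => /segI.
have EJ : [set` J] = \bigcup_n `[F (u n), F (v n)]%classic.
  apply/seteqP; split => y /=.
    move=> /HI[HyI Hy]; have [n xn] := exh _ HyI; exists n => //=.
    by have [u1 v1] := uvI n; rewrite in_itv/= -Hy !leF.
  by move=> [n _] /=; rewrite in_itv/= => /segJ.
have cF : {in I, continuous F}.
  move=> x xI; apply: differentiable_continuous; apply/derivable1_diffP.
  by have [] := dFP x xI.
have dFE x : x \in I -> derive1 F x = dF x.
  by move=> xI; have [_ <-] := dFP x xI; rewrite derive1E.
have cdF1 : {in I, continuous (derive1 F)}.
  move=> x xI; rewrite /continuous_at dFE//.
  apply: cvg_trans (cdF _ xI); apply: near_eq_cvg.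
  near=> y; rewrite dFE//; near: y.
  exact: (open_nbhs_nbhs (conj Io xI)).
have cGn n : {within `[F (u n), F (v n)], continuous G}.
  apply: continuous_in_subspaceT => y; rewrite inE/= in_itv/= => /segJ yJ.
  exact: cG.
have mGJ : measurable_fun [set` J] (fun x => (G x)%:E).
  apply/measurable_EFinP; apply: open_continuous_measurable_fun => //.
  by move=> y; rewrite inE/= => /cG.
have mGI : measurable_fun [set` I] (fun x => (G (F x) * dF x)%:E).
  apply/measurable_EFinP; apply: open_continuous_measurable_fun => //.
  move=> x; rewrite inE/= => xI; apply: cvgM; last exact: cdF.
  by apply: continuous_comp; [exact: cF|exact/cG/FJ].
have step n : (\int[mu]_(x in `[F (u n), F (v n)]) (G x)%:E =
   \int[mu]_(x in `[u n, v n]) (G (F x) * dF x)%:E)%E.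
  have [u1 v1] := uvI n.
  rewrite integration_by_substitution_increasing.
  - apply: eq_integral => x; rewrite inE/= in_itv/= => /segI xI.
    by rewrite fctE dFE.
  - exact: uv.
  - move=> x y; rewrite !in_itv/= => /segI xI /segI yI; exact: incF.
  - by move=> x; rewrite in_itv/= => /andP[h1 h2]; apply: cdF1;
      apply: (segI n); rewrite !ltW.
  - by apply: cvgP; apply: cvg_at_right_filter; exact: cdF1.
  - by apply: cvgP; apply: cvg_at_left_filter; exact: cdF1.
  - split.
    + move=> x; rewrite in_itv/= => /andP[h1 h2].
      have xI : x \in I by apply: (segI n); rewrite !ltW.
      by have [] := dFP x xI.
    + by apply: cvg_at_right_filter; exact: cF.
    + by apply: cvg_at_left_filter; exact: cF.
  - exact: cGn.
have mono_cvg (f : R -> \bar R) (a b : nat -> R) : nonincreasing_seq a ->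
    nondecreasing_seq b -> measurable_fun (\bigcup_n `[a n, b n]%classic) f ->
    (forall x, (\bigcup_n `[a n, b n]%classic) x -> 0 <= f x)%E ->
    (\int[mu]_(x in `[a n, b n]) f x @[n --> \oo] -->
     \int[mu]_(x in \bigcup_n `[a n, b n]%classic) f x)%E.
  move=> da ib mf f0; apply: ge0_nondecreasing_set_cvg_integral => //.
  - move=> m n mn; apply/subsetPset; apply: subset_itv; rewrite bnd_simp.
      exact: da.
    exact: ib.
  - move=> n; apply: measurable_funS mf => //.
      exact: bigcup_measurable.
    by move=> x xn; exists n.
  - by move=> n x xn; apply: f0; exists n.
have leFu : nonincreasing_seq (F \o u).
  by move=> m n mn /=; rewrite leF ?du//; have [] := uvI n; have [] := uvI m.
have leFv : nondecreasing_seq (F \o v).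
  by move=> m n mn /=; rewrite leF ?iv//; have [] := uvI n; have [] := uvI m.
have cJ := mono_cvg _ _ _ leFu leFv.
have := mono_cvg _ _ _ du iv.
rewrite /= in cJ; rewrite -EI => /(_ _ mGI) cI.
rewrite -EJ in cJ; have {}cJ := cJ _ mGJ.
have {}cJ : (\int[mu]_(x in `[F (u n), F (v n)]) (G x)%:E @[n --> \oo] -->
    \int[mu]_(x in [set` J]) (G x)%:E)%E.
  by apply: cJ => x xJ; rewrite lee_fin G0.
have {}cI : (\int[mu]_(x in `[F (u n), F (v n)]) (G x)%:E @[n --> \oo] -->
    \int[mu]_(x in [set` I]) (G (F x) * dF x)%:E)%E.
  under eq_fun do rewrite step.
  by apply: cI => x xI; rewrite lee_fin mulr_ge0 ?dF0// G0// FJ.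
by rewrite -(cvg_lim (@ereal_hausdorff R) cJ) -(cvg_lim (@ereal_hausdorff R) cI).
Unshelve. all: by end_near. Qed.

Lemma powR_cont (g x : R) : 0 < x -> {for x, continuous (fun z => z `^ g)}.
Proof.
move=> x0; apply: differentiable_continuous; apply/derivable1_diffP.
by apply: derivable_powR; rewrite in_itv/= x0.
Qed.

Lemma powRVK (g y : R) : g != 0 -> 0 < y -> (y `^ g^-1) `^ g = y.
Proof. by move=> g0 y0; rewrite -powRrM mulVf// powRr1// ltW. Qed.

Lemma ltr_powRN (g x y : R) : 0 < g -> 0 < x -> x < y -> y `^ (- g) < x `^ (- g).
Proof.
move=> g0 x0 xy; have y0 : 0 < y by exact: lt_trans xy.
rewrite !powRN ltf_pV2 ?posrE ?powR_gt0//.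
by apply: gt0_ltr_powR; rewrite ?inE ?nnegrE ?ltW.
Qed.

Lemma ler_powRN (g x y : R) : 0 <= g -> 0 < x -> x <= y -> y `^ (- g) <= x `^ (- g).
Proof.
move=> g0 x0 xy; have y0 : 0 < y by exact: lt_le_trans xy.
rewrite !powRN lef_pV2 ?posrE ?powR_gt0//.
by apply: ge0_ler_powR; rewrite ?nnegrE ?(ltW x0) ?(ltW y0).
Qed.

Lemma integral_powR_tail (a g : R) : 0 < a -> 0 < g ->
  (\int[mu]_(z in `]a, +oo[) (z `^ (- 1 - g))%:E = (a `^ (- g) / g)%:E)%E.
Proof.
move=> a0 g0.
have gn0 : g != 0 by rewrite gt_eqF.
pose F z : R := - z `^ (- g).
have gt0 z : z \in `]a, +oo[ -> 0 < z.
  by rewrite in_itv/= andbT; exact: lt_trans.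
transitivity (\int[mu]_(z in `]a, +oo[) (g^-1 * (g * z `^ (- 1 - g)))%:E)%E.
  by apply: eq_integral => z _; rewrite mulrA mulVf// mul1r.
rewrite -(@ge0_substitution `]a, +oo[ `](F a), 0[ F (fun z => g * z `^ (- 1 - g))
   (fun y => (- y) `^ ((- g)^-1)) (fun=> g^-1)).
- rewrite (integral_cst _ _ g^-1%:E)//= lebesgue_measure_itv/= lte_fin /F oppr_lt0 powR_gt0//.
  by rewrite -EFinB sub0r opprK -EFinM mulrC.
- exact: exhausts_oy.
- exact: interval_open.
- exact: interval_open.
- move=> x y /gt0 x0 _ xy; rewrite /F ltrN2; exact: ltr_powRN.
- move=> x xa; have x0 := gt0 _ xa; rewrite in_itv/= /F ltrN2 oppr_lt0 powR_gt0//.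
  by rewrite andbT; apply: ltr_powRN => //; rewrite (itvP xa).
- move=> y; rewrite in_itv/= /F => /andP[h1 h2].
  have y0 : 0 < - y by rewrite oppr_gt0.
  rewrite powRVK ?oppr_eq0// opprK; split=> //.
  rewrite in_itv/= andbT.
  have -> : a = (a `^ (- g)) `^ (- g)^-1 by rewrite -powRrM divff ?oppr_eq0// powRr1// ltW.
  by rewrite invrN ltr_powRN// ?invr_gt0// ltrNl.
- move=> x xa; have x0 := gt0 _ xa.
  apply: has_deriv_eq; first by rewrite /F; deriv.
  by rewrite mulr1 mulNr opprK; congr (_ * _ `^ _); ring.
- move=> x /gt0 x0; apply: cvgM; [exact: cvg_cst|exact: powR_cont].
- by move=> x _; rewrite mulr_ge0 ?powR_ge0// ltW.
- by move=> x _; exact: cvg_cst.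
- by move=> x _; rewrite invr_ge0 ltW.
Qed.

Lemma integral_powR_head (a g : R) : 0 < a -> 0 < g ->
  (\int[mu]_(z in `]0%R, a[) (z `^ (g - 1))%:E = (a `^ g / g)%:E)%E.
Proof.
move=> a0 g0.
have gn0 : g != 0 by rewrite gt_eqF.
have gt0 z : z \in `]0, a[ -> 0 < z by rewrite in_itv/= => /andP[].
transitivity (\int[mu]_(z in `]0%R, a[) (g^-1 * (g * z `^ (g - 1)))%:E)%E.
  by apply: eq_integral => z _; rewrite mulrA mulVf// mul1r.
rewrite -(@ge0_substitution `]0, a[ `]0, (a `^ g)[ (fun z => z `^ g) (fun z => g * z `^ (g - 1))
   (fun y => y `^ g^-1) (fun=> g^-1)).
- rewrite (integral_cst _ _ g^-1%:E)//= lebesgue_measure_itv/= lte_fin powR_gt0//.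
  by rewrite sube0 -EFinM mulrC.
- exact: exhausts_oo.
- exact: interval_open.
- exact: interval_open.
- by move=> x y /gt0 x0 /gt0 y0 xy; apply: gt0_ltr_powR; rewrite ?nnegrE ?ltW.
- move=> x xa; have x0 := gt0 _ xa; rewrite in_itv/= powR_gt0//=.
  by apply: gt0_ltr_powR; rewrite ?nnegrE ?ltW// (itvP xa).
- move=> y; rewrite in_itv/= => /andP[y0 h2].
  rewrite powRVK//; split=> //; rewrite in_itv/= powR_gt0//=.
  have -> : a = (a `^ g) `^ g^-1 by rewrite -powRrM divff// powRr1// ltW.
  by apply: gt0_ltr_powR; rewrite ?invr_gt0// ?nnegrE ?ltW// powR_gt0.
- by move=> x /gt0 x0; apply/has_derivP; exact: is_derive1_powR.
- move=> x /gt0 x0; apply: cvgM; [exact: cvg_cst|exact: powR_cont].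
- by move=> x _; rewrite mulr_ge0 ?powR_ge0// ltW.
- by move=> x _; exact: cvg_cst.
- by move=> x _; rewrite invr_ge0 ltW.
Qed.

End substitution.

(** * Measurability by syntax, and the Beta integral *)

Section measurability.
Context {R : realType} {d : measure_display} {T : measurableType d}.
Implicit Types (D : set T) (f g : T -> R).

Lemma mfun_mul D f g : measurable_fun D f -> measurable_fun D g ->
  measurable_fun D (fun x => f x * g x).
Proof. exact: measurable_funM. Qed.

Lemma mfun_add D f g : measurable_fun D f -> measurable_fun D g ->
  measurable_fun D (fun x => f x + g x).
Proof. exact: measurable_funD. Qed.

Lemma mfun_opp D f : measurable_fun D f -> measurable_fun D (fun x => - f x).
Proof. exact: measurable_funN. Qed.

Lemma mfun_powR D f (g : R) : measurable_fun D f ->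
  measurable_fun D (fun x => f x `^ g).
Proof. by move=> mf; apply: (measurableT_comp (measurable_powR g)). Qed.

(** The inverse is discontinuous at 0, but f^-1 = f * (f^2)^-1 and real powers are
measurable. *)
Lemma mfun_inv D f : measurable_fun D f -> measurable_fun D (fun x => (f x)^-1).
Proof.
move=> mf.
have -> : (fun x => (f x)^-1) = (fun x => f x * (f x * f x) `^ (-1)).
  apply/funext => x; rewrite powR_inv1; last by rewrite -expr2 sqr_ge0.
  have [->|fx0] := eqVneq (f x) 0; first by rewrite invr0 mul0r.
  by rewrite invfM mulrA divff// mul1r.
by apply: mfun_mul => //; apply: mfun_powR; exact: mfun_mul.
Qed.

End measurability.

Lemma mfun_EFin {R : realType} {d} {T : measurableType d} (D : set T) (f : T -> R) :
  measurable_fun D f -> measurable_fun D (fun x => (f x)%:E).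
Proof. by move=> mf; apply/measurable_EFinP. Qed.

Ltac mfun_rec := lazymatch goal with
  | |- measurable_fun _ (fun _ => ?c) => exact: measurable_cst
  | |- measurable_fun _ (fun y => y) => exact: measurable_id
  | |- measurable_fun _ (fun y => fst y) => exact: measurable_fst
  | |- measurable_fun _ (fun y => snd y) => exact: measurable_snd
  | |- measurable_fun ?D (fun y => @?f y + @?g y) => apply (@mfun_add _ _ _ D f g); mfun_rec
  | |- measurable_fun ?D (fun y => @?f y * @?g y) => apply (@mfun_mul _ _ _ D f g); mfun_rec
  | |- measurable_fun ?D (fun y => - @?f y) => apply (@mfun_opp _ _ _ D f); mfun_rec
  | |- measurable_fun ?D (fun y => (@?f y)^-1) => apply (@mfun_inv _ _ _ D f); mfun_rec
  | |- measurable_fun ?D (fun y => @?f y `^ ?g) => apply (@mfun_powR _ _ _ D f g); mfun_rec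
  | _ => idtac end.
(** Measurability by recursion on the syntax of sums, products, inverses and
real powers. *)
Ltac mfun := try apply: mfun_EFin; mfun_rec.

Section beta_integral.
Context {R : realType}.
Notation mu := (@lebesgue_measure R).
Local Open Scope ereal_scope.

Lemma ge0_integral_split (f : R -> \bar R) (a m : R) (c : itv_bound R) :
  (a < m)%R -> (BRight m <= c)%O ->
  measurable_fun [set` Interval (BRight a) c] f ->
  (forall x, x \in Interval (BRight a) c -> 0 <= f x) ->
  \int[mu]_(x in [set` Interval (BRight a) c]) f x =
  \int[mu]_(x in `]a, m[) f x + \int[mu]_(x in [set` Interval (BRight m) c]) f x.
Proof.
move=> am mc mf f0.
rewrite (@itv_bndbnd_setU _ _ _ (BRight m))//; last by rewrite bnd_simp ltW.
have sub1 : `]a, m]%classic `<=` [set` Interval (BRight a) c].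
  exact: subset_itvl.
have sub2 : [set` Interval (BRight m) c] `<=` [set` Interval (BRight a) c].
  by apply: subset_itvr; rewrite bnd_simp ltW.
rewrite ge0_integral_setU//=.
- rewrite -integral_itv_bndo_bndc//; apply: measurable_funS mf => //.
  by apply: subset_trans sub1; exact: subset_itv_oo_oc.
- apply: measurable_funS mf => //; by move=> x [/sub1|/sub2].
- by move=> x [/sub1|/sub2]; exact: f0.
- apply/disj_setPS => x [] /=; rewrite in_itv/= => /andP[_ xm].
  by rewrite itv_boundlr => /andP[]; rewrite bnd_simp ltNge xm.
Qed.

(** Euler's Beta function at (1 - b, b). *)
Definition betaI (b : R) : \bar R :=
  \int[mu]_(w in `]0%R, +oo[) (w `^ (- b) / (1 + w))%:E.

Variable b : R.
Hypotheses (b0 : (0 < b)%R) (b1 : (b < 1)%R).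

Let pos (a x : R) c : (0 <= a)%R -> [set` Interval (BRight a) c] x -> (0 < x)%R.
Proof.
by move=> a0 /=; rewrite itv_boundlr bnd_simp => /andP[] /(le_lt_trans a0).
Qed.

Let posy (a x : R) : (0 <= a)%R -> x \in `]a, +oo[ -> (0 < x)%R.
Proof. by move=> a0; rewrite in_itv/= andbT => /(le_lt_trans a0). Qed.

Lemma ge0_integrand (t w : R) : (0 < t)%R -> (0 <= w)%R -> (0 <= w `^ (- b) / (t + w))%R.
Proof. by move=> t0 w0; rewrite divr_ge0 ?powR_ge0// addr_ge0// ltW. Qed.

Lemma integral_kernel_scale (t : R) : (0 < t)%R ->
  \int[mu]_(w in `]0%R, +oo[) (w `^ (- b) / (t + w))%:E = (t `^ (- b))%:E * betaI b.
Proof.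
move=> t0; rewrite /betaI -ge0_integralZl//; first last.
- by rewrite lee_fin powR_ge0.
- by move=> w /= /(posy (lexx _)) w0; rewrite lee_fin ge0_integrand// ltW.
- by mfun.
rewrite (@ge0_substitution _ `]0%R, +oo[ `]0%R, +oo[ (fun w => t * w)%R (fun=> t) (fun w => t^-1 * w)%R).
- apply: eq_integral => w; rewrite inE => /(posy (lexx _)) w0.
  rewrite -EFinM powRM ?(ltW t0) ?(ltW w0)//; congr EFin.
  have t1 : (t != 0)%R by rewrite gt_eqF.
  have t2 : (1 + w != 0)%R by rewrite gt_eqF// addr_gt0.
  have t3 : (t + t * w != 0)%R by rewrite gt_eqF// addr_gt0// mulr_gt0.
  by field; rewrite t2 t3.
- exact: exhausts_oy.
- exact: interval_open.
- exact: interval_open.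
- by move=> x y _ _ xy; rewrite ltr_pM2l.
- by move=> x /(posy (lexx _)) x0; rewrite in_itv/= mulr_gt0.
- move=> y /(posy (lexx _)) y0; rewrite in_itv/= mulr_gt0 ?invr_gt0//; split=> //.
  by rewrite mulrA divff ?mul1r// gt_eqF.
- move=> x _; apply: has_deriv_eq; first by deriv.
  by rewrite mul0r add0r mulr1.
- by move=> x _; exact: cvg_cst.
- by move=> x _; exact: ltW.
- move=> x /(posy (lexx _)) x0; apply: cvgM; first exact: powR_cont.
  apply: cvgV; first by rewrite gt_eqF// addr_gt0.
  by apply: cvgD; [exact: cvg_cst|exact: cvg_id].
- by move=> x /(posy (lexx _)) x0; rewrite ge0_integrand// ltW.
Qed.

Lemma betaI_lty : betaI b < +oo.
Proof.
rewrite /betaI (@ge0_integral_split _ 0 1)//; last 2 first.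
- by mfun.
- by move=> w /(posy (lexx _)) w0; rewrite lee_fin ge0_integrand// ltW.
apply: (@le_lt_trans _ _ (\int[mu]_(w in `]0%R, 1%R[) (w `^ ((1 - b) - 1))%:E +
   \int[mu]_(w in `]1%R, +oo[) (w `^ (- 1 - b))%:E)).
  apply: leeD; apply: ge0_le_integral => //=; try by mfun.
  - by move=> w /(pos (lexx _)) w0; rewrite lee_fin ge0_integrand// ltW.
  - move=> w /(pos (lexx _)) w0; rewrite lee_fin.
    rewrite (_ : 1 - b - 1 = - b)%R; last by ring.
    rewrite ler_pdivrMr ?addr_gt0// ler_peMr ?powR_ge0//.
    by rewrite lerDl ltW.
  - by move=> w /(pos ler01) w0; rewrite lee_fin ge0_integrand// ltW.
  - move=> w /(pos ler01) w0; rewrite lee_fin.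
    rewrite powRD ?(gt_eqF w0) ?implybT// [leRHS]mulrC powR_inv1 ?(ltW w0)//.
    rewrite ler_pM2l ?powR_gt0// lef_pV2 ?posrE ?addr_gt0//.
    by rewrite lerDr.
by rewrite integral_powR_head ?subr_gt0// integral_powR_tail// -EFinD ltry.
Qed.

Lemma betaI_gt0 : 0 < betaI b.
Proof.
apply: (@lt_le_trans _ _ (\int[mu]_(w in `]0%R, 1%R[) (1 / 2)%:E)).
  rewrite (integral_cst _ _ (1/2)%:E)//= lebesgue_measure_itv/= lte_fin ltr01.
  by rewrite sube0 mule1 lte_fin.
apply: (@le_trans _ _ (\int[mu]_(w in `]0%R, 1%R[) (w `^ (- b) / (1 + w))%:E)).
  apply: ge0_le_integral => //=; try by mfun.
  move=> w; rewrite in_itv/= => /andP[w0 w1]; rewrite lee_fin.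
  apply: ler_pM => //.
    by have := ler_powRN (ltW b0) w0 (ltW w1); rewrite powR1.
  by rewrite lef_pV2 ?posrE ?addr_gt0// (_ : 2 = 1 + 1)%R// lerD2l ltW.
apply: ge0_subset_integral => //=.
- by mfun.
- by move=> w /(posy (lexx _)) w0; rewrite lee_fin ge0_integrand// ltW.
- by apply: subset_itvl.
Qed.

Definition betaR : R := fine (betaI b).

Lemma betaRE : betaI b = betaR%:E.
Proof. by rewrite /betaR fineK// ge0_fin_numE ?betaI_lty// ltW// betaI_gt0. Qed.

Lemma betaR_gt0 : (0 < betaR)%R.
Proof. by rewrite -lte_fin -betaRE betaI_gt0. Qed.

(** w^(-1-b) / (1 + k w) = w^(-1-b) - w^-b / (1/k + w), and the second term
integrates to k^b B over (0, oo); the error is its integral over (0, w0). *)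
Lemma kernel_tail_bounds (k w0 : R) : (0 < k)%R -> (0 < w0)%R ->
  (w0 `^ (- b) / b)%:E <=
  \int[mu]_(w in `]w0, +oo[) (w `^ (- 1 - b) / (1 + k * w))%:E + (k `^ b * betaR)%:E
    <= (w0 `^ (- b) / b + k * (w0 `^ (1 - b) / (1 - b)))%:E.
Proof.
move=> k0 w00; set J := \int[mu]_(w in _) _.
have kV : (0 < k^-1)%R by rewrite invr_gt0.
have posk w : (0 < w)%R -> (0 < 1 + k * w)%R by move=> ?; rewrite addr_gt0// mulr_gt0.
have E1 : (k `^ b * betaR)%:E =
   \int[mu]_(w in `]0%R, w0[) (w `^ (- b) / (k^-1 + w))%:E +
   \int[mu]_(w in `]w0, +oo[) (w `^ (- b) / (k^-1 + w))%:E.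
  rewrite -ge0_integral_split//; last 2 first.
  - by mfun.
  - by move=> w /(posy (lexx _)) w0'; rewrite lee_fin ge0_integrand// ltW.
  rewrite integral_kernel_scale// betaRE -EFinM; congr (_ * _)%:E%R.
  by rewrite -powR_inv1 ?(ltW k0)// -powRrM mulrN mulN1r opprK.
have E2 : J + \int[mu]_(w in `]w0, +oo[) (w `^ (- b) / (k^-1 + w))%:E =
   (w0 `^ (- b) / b)%:E.
  rewrite -integral_powR_tail// -ge0_integralD//=.
  - apply: eq_integral => w; rewrite inE/= => /(posy (ltW w00)) w1.
    rewrite -EFinD; congr EFin.
    rewrite powRD ?(gt_eqF w1) ?implybT// powR_inv1 ?(ltW w1)//.
    have n1 : (1 + k * w != 0)%R by rewrite gt_eqF// posk.
    have n2 : (k != 0)%R by rewrite gt_eqF.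
    have n3 : (w != 0)%R by rewrite gt_eqF.
    by field; rewrite n2 n3/= (mulrC w) n1.
  - by move=> w /(pos (ltW w00)) w1; rewrite lee_fin divr_ge0 ?powR_ge0// ltW// posk.
  - by mfun.
  - by move=> w /(pos (ltW w00)) w1; rewrite lee_fin ge0_integrand// ltW.
  - by mfun.
rewrite E1 addeCA E2; apply/andP; split.
  rewrite leeDr//; apply: integral_ge0 => w /(pos (lexx _)) w1.
  by rewrite lee_fin ge0_integrand// ltW.
rewrite addeC EFinD leeD2l//.
rewrite EFinM -integral_powR_head ?subr_gt0// -ge0_integralZl//=; first last.
- by rewrite lee_fin ltW.
- by move=> w _; rewrite lee_fin powR_ge0.
- by mfun.
apply: ge0_le_integral => //=; try by mfun.
- by move=> w /(pos (lexx _)) w1; rewrite lee_fin ge0_integrand// ltW.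
- move=> w /(pos (lexx _)) w1; rewrite -EFinM lee_fin.
  rewrite (_ : 1 - b - 1 = - b)%R; last by ring.
  rewrite mulrC ler_pM2r ?powR_gt0// -[leRHS]invrK lef_pV2 ?posrE ?addr_gt0//.
  by rewrite lerDl ltW.
Qed.

End beta_integral.

(** * Matched cuts around a point and the Poisson kernel *)

Section powR_algebra.
Context {R : realType}.
Implicit Types x b : R.

Lemma powR_inv x b : 0 <= x -> (x^-1) `^ b = (x `^ b)^-1.
Proof. by move=> x0; rewrite -powR_inv1// -powRrM mulN1r powRN. Qed.

Lemma powR_div x y b : 0 <= x -> 0 <= y -> (x / y) `^ b = x `^ b / y `^ b.
Proof. by move=> x0 y0; rewrite powRM ?invr_ge0// powR_inv. Qed.

Lemma powR_sqr x b : 0 <= x -> (x ^+ 2) `^ b = (x `^ b) ^+ 2.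
Proof. by move=> x0; rewrite !expr2 powRM. Qed.

Lemma powR_dbl x b : 0 < x -> x `^ (2 * b) = (x `^ b) ^+ 2.
Proof. by move=> x0; rewrite mulrC powRrM powR_mulrn// powR_ge0. Qed.

Lemma powR_kernel x b : 0 < x -> x `^ (- 1 - 2 * b) = (x * (x `^ b) ^+ 2)^-1.
Proof.
move=> x0; rewrite powRD ?(gt_eqF x0) ?implybT// powR_inv1 ?(ltW x0)//.
by rewrite powRN powR_dbl// -invfM.
Qed.

Lemma powR_tail x b : 0 < x -> x `^ (- 1 - b) = (x * x `^ b)^-1.
Proof.
move=> x0; rewrite powRD ?(gt_eqF x0) ?implybT// powR_inv1 ?(ltW x0)//.
by rewrite powRN -invfM.
Qed.

End powR_algebra.

Section branches.
Context {R : realType}.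
Notation mu := (@lebesgue_measure R).

(** With k = A (1 + th) the map s |-> k s / (1 + th s) carries (0, 1) onto (0, A). *)
Lemma moebius_subst (A th : R) (G : R -> R) (s0 : R) :
  0 < A -> -1 < th -> th < 1 -> 0 < s0 -> s0 < 1 ->
  let k := A * (1 + th) in
  {in `]0, A[, continuous G} -> (forall z : R, z \in `]0, A[ -> 0 <= G z) ->
  (\int[mu]_(z in `](k * s0 / (1 + th * s0))%R, A[) (G z)%:E =
  \int[mu]_(s in `]s0, 1%R[)
    (G (k * s / (1 + th * s)) * (k / (1 + th * s) ^+ 2))%:E)%E.
Proof.
move=> A0 th1 th2 s00 s01 k cG G0.
have k0 : 0 < k by rewrite mulr_gt0//; lra.
have ths (s : R) : 0 < s -> s <= 1 -> 0 < 1 + th * s.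
  by move=> ss0 ss1; nra.
have Hs0 := ths _ s00 (ltW s01).
set e := k * s0 / _.
have e0 : 0 < e by rewrite divr_gt0// mulr_gt0.
have sub z : z \in `]e, A[ -> z \in `]0, A[.
  by rewrite !in_itv/= => /andP[ez ->]; rewrite (lt_trans e0 ez).
have mono (x y : R) : s0 <= x -> x <= 1 -> s0 <= y -> y <= 1 -> x < y ->
    k * x / (1 + th * x) < k * y / (1 + th * y).
  move=> x0 x1 y0 y1 xy.
  rewrite ltr_pdivrMr ?ths// ?(lt_le_trans s00)//.
  rewrite [ltRHS]mulrAC ltr_pdivlMr ?ths// ?(lt_le_trans s00)//.
  by rewrite -!mulrA ltr_pM2l//; nra.
have FA : k * 1 / (1 + th * 1) = A.
  by rewrite /k; field; rewrite gt_eqF//; lra.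
rewrite (@ge0_substitution _ `]s0, 1%R[ `]e, A[ (fun s => k * s / (1 + th * s))
  (fun s => k / (1 + th * s) ^+ 2) (fun z => z / (k - th * z)) G)//.
- exact: exhausts_oo.
- move=> x y; rewrite !in_itv/= => /andP[x0 x1] /andP[y0 y1]; apply: mono; exact: ltW.
- move=> x; rewrite !in_itv/= => /andP[x0 x1]; apply/andP; split.
    by apply: mono => //; exact: ltW.
  by rewrite -[X in _ < X]FA; apply: mono => //; exact: ltW.
- move=> z; rewrite !in_itv/= => /andP[ez zA].
  have z0 : 0 < z by exact: lt_trans ez.
  have kz : 0 < k - th * z by rewrite /k; nra.
  split.
    apply/andP; split.
      rewrite ltr_pdivlMr//; move: ez; rewrite /e ltr_pdivrMr//; nra.
    by rewrite ltr_pdivrMr// mul1r /k; nra.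
  have -> : 1 + th * (z / (k - th * z)) = k / (k - th * z).
    by field; rewrite gt_eqF.
  by field; rewrite !gt_eqF.
- move=> x; rewrite in_itv/= => /andP[x0 x1].
  have tx := ths x (lt_trans s00 x0) (ltW x1).
  have n0 : 1 + th * x != 0 by rewrite gt_eqF.
  by apply: has_deriv_eq; [by deriv|field].
- move=> x; rewrite in_itv/= => /andP[x0 x1].
  have tx := ths x (lt_trans s00 x0) (ltW x1).
  apply: cvgM; first exact: cvg_cst.
  apply: cvgV; first by rewrite expf_neq0// gt_eqF.
  apply: cvgM; apply: cvgD; try exact: cvg_cst; (apply: cvgM; [exact: cvg_cst|exact: cvg_id]).
- move=> x; rewrite in_itv/= => /andP[x0 x1].
  by rewrite divr_ge0 ?(ltW k0)// sqr_ge0.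
- by move=> x /sub; exact: cG.
- by move=> x /sub; exact: G0.
Qed.

Lemma ratio_subst (G : R -> R) (s0 : R) : 0 < s0 -> s0 < 1 ->
  {in `]0, +oo[, continuous G} -> (forall w : R, 0 < w -> 0 <= G w) ->
  (\int[mu]_(w in `](s0 ^+ 2 / (1 - s0 ^+ 2))%R, +oo[) (G w)%:E =
  \int[mu]_(s in `]s0, 1%R[)
    (G (s ^+ 2 / (1 - s ^+ 2)) * (2 * s / (1 - s ^+ 2) ^+ 2))%:E)%E.
Proof.
move=> s00 s01 cG G0.
have ss (s : R) : 0 <= s -> s < 1 -> 0 < 1 - s ^+ 2 by move=> *; nra.
set e := s0 ^+ 2 / _.
have e0 : 0 < e by rewrite divr_gt0// ?exprn_gt0// ss// ltW.
have mono (x y : R) : 0 <= x -> x < 1 -> 0 <= y -> y < 1 -> x < y ->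
    x ^+ 2 / (1 - x ^+ 2) < y ^+ 2 / (1 - y ^+ 2).
  move=> x0 x1 y0 y1 xy.
  rewrite ltr_pdivrMr ?ss// [ltRHS]mulrAC ltr_pdivlMr ?ss//.
  have : x ^+ 2 < y ^+ 2 by rewrite ltr_pXn2r// nnegrE.
  by nra.
have sub z : z \in `]e, +oo[ -> 0 < z.
  by rewrite in_itv/= andbT; exact: lt_trans.
rewrite (@ge0_substitution _ `]s0, 1%R[ `]e, +oo[ (fun s => s ^+ 2 / (1 - s ^+ 2))
  (fun s => 2 * s / (1 - s ^+ 2) ^+ 2) (fun w => Num.sqrt (w / (1 + w))) G)//.
- exact: exhausts_oo.
- move=> x y; rewrite !in_itv/= => /andP[x0 x1] /andP[y0 y1]; apply: mono => //.
    by rewrite ltW// (lt_trans s00).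
  by rewrite ltW// (lt_trans s00).
- move=> x; rewrite !in_itv/= => /andP[x0 x1]; rewrite andbT.
  by apply: mono => //; rewrite ltW// (lt_trans s00).
- move=> w we; have w0 := sub _ we.
  have w1 : 0 < 1 + w by rewrite addr_gt0.
  have q0 : 0 <= w / (1 + w) by rewrite divr_ge0// ltW.
  rewrite in_itv/=; split; last first.
    by rewrite sqr_sqrtr//; field; rewrite gt_eqF//= gt_eqF//; lra.
  apply/andP; split.
    rewrite -[ltLHS]ger0_norm ?ltW// -sqrtr_sqr ltr_sqrt; last by rewrite divr_gt0.
    rewrite ltr_pdivlMr//; move: we; rewrite in_itv/= andbT /e ltr_pdivrMr ?ss ?ltW//.
    by nra.
  by rewrite -[ltRHS]sqrtr1 ltr_sqrt// ltr_pdivrMr// mul1r ltrDr.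
- move=> x; rewrite in_itv/= => /andP[x0 x1].
  have tx := ss x (ltW (lt_trans s00 x0)) x1.
  have n0 : 1 - x ^+ 2 != 0 by rewrite gt_eqF.
  by apply: has_deriv_eq; [by deriv|field].
- move=> x; rewrite in_itv/= => /andP[x0 x1].
  have tx := ss x (ltW (lt_trans s00 x0)) x1.
  apply: cvgM; first by apply: cvgM; [exact: cvg_cst|exact: cvg_id].
  apply: cvgV; first by rewrite expf_neq0// gt_eqF.
  apply: cvgM; apply: cvgB; try exact: cvg_cst; exact: exprn_continuous.
- move=> x; rewrite in_itv/= => /andP[x0 x1].
  by rewrite divr_ge0 ?sqr_ge0// mulr_ge0// ltW// (lt_trans s00).
- by move=> x /sub x0; apply: cG; rewrite in_itv/= x0.
- by move=> x /sub; exact: G0.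
Qed.

End branches.

Section two_branches.
Context {R : realType}.
Notation mu := (@lebesgue_measure R).
Variables (b A C : R).
Hypotheses (b0 : 0 < b) (b1 : b < 1) (A0 : 0 < A) (C0 : 0 < C).

(** The harmonic mean of the distances A and C to the two endpoints. Together with
[cut_tilt] it is determined by A (1 + th) = k = C (1 - th), so that the two
Moebius maps reach the two endpoints at s = 1. *)
Definition cut_scale : R := 2 * A * C / (A + C).
Definition cut_tilt : R := (C - A) / (A + C).
Notation k := cut_scale.
Notation th := cut_tilt.

Lemma cut_tilt_lt1 : -1 < th < 1.
Proof.
have [A1 C1] := conj A0 C0; have AC : 0 < A + C by rewrite addr_gt0.
rewrite /cut_tilt ltr_pdivrMr// ltr_pdivlMr//.
by apply/andP; split; lra.
Qed.

Lemma cut_scale_right : A * (1 + th) = k.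
Proof. by rewrite /cut_scale /cut_tilt; field; rewrite gt_eqF// addr_gt0. Qed.

Lemma cut_scale_left : C * (1 + - th) = k.
Proof. by rewrite /cut_scale /cut_tilt; field; rewrite gt_eqF// addr_gt0. Qed.

Lemma cut_scale_gt0 : 0 < k.
Proof. by rewrite /cut_scale divr_gt0 ?mulr_gt0// addr_gt0. Qed.

Lemma cut_denom_gt0 (s : R) : 0 <= s -> s <= 1 -> 0 < 1 + th * s /\ 0 < 1 - th * s.
Proof. by have /andP[h1 h2] := cut_tilt_lt1; move=> s0 s1; split; nra. Qed.

Lemma cut_lt (s : R) : 0 < s -> s < 1 ->
  0 < k * s / (1 + th * s) < A /\ 0 < k * s / (1 - th * s) < C.
Proof.
have [A1 C1] := conj A0 C0; move=> s0 s1; have [p1 p2] := cut_denom_gt0 (ltW s0) (ltW s1).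
have k0 := cut_scale_gt0; have /andP[t1 t2] := cut_tilt_lt1.
have ks0 : 0 < k * s by rewrite mulr_gt0.
split; rewrite divr_gt0//=.
  by rewrite ltr_pdivrMr// -cut_scale_right; nra.
by rewrite ltr_pdivrMr// -cut_scale_left; nra.
Qed.

(** The point of the construction: on either side the product of the distances to
the endpoints is A C (1 - s^2) up to the square of the Moebius denominator. *)
Lemma branch_prod (s : R) : 0 < s -> s < 1 ->
  (A - k * s / (1 + th * s)) * (C + k * s / (1 + th * s)) =
     A * C * (1 - s ^+ 2) / (1 + th * s) ^+ 2 /\
  (A + k * s / (1 - th * s)) * (C - k * s / (1 - th * s)) =
     A * C * (1 - s ^+ 2) / (1 - th * s) ^+ 2.
Proof.
have [A1 C1] := conj A0 C0; move=> s0 s1; have [p1 p2] := cut_denom_gt0 (ltW s0) (ltW s1).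
have AC : 0 < A + C by rewrite addr_gt0.
have n1 : A + C + (C - A) * s != 0.
  have -> : A + C + (C - A) * s = (A + C) * (1 + th * s).
    by rewrite /cut_tilt; field; rewrite gt_eqF.
  by rewrite gt_eqF// mulr_gt0.
have n2 : A + C - (C - A) * s != 0.
  have -> : A + C - (C - A) * s = (A + C) * (1 - th * s).
    by rewrite /cut_tilt; field; rewrite gt_eqF.
  by rewrite gt_eqF// mulr_gt0.
by split; rewrite /cut_scale /cut_tilt; field; rewrite (gt_eqF AC) /= ?n1 ?n2.
Qed.

(** The powers of the denominator t cancel except one, because
(t^-2)^b (t^-1)^(-1-2b) t^-2 = t^-1. *)
Lemma branch_weight (s t : R) : 0 < s -> s < 1 -> 0 < t ->
  (A * C * (1 - s ^+ 2) / t ^+ 2) `^ b * (k * s / t) `^ (- 1 - 2 * b) * (k / t ^+ 2) =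
  ((A * C) `^ b * (k `^ b) ^- 2) * ((1 - s ^+ 2) `^ b * (s * (s `^ b) ^+ 2)^-1 / t).
Proof.
move: cut_scale cut_scale_gt0 => kk k0 s0 s1 t0.
have q0 : 0 < 1 - s ^+ 2 by nra.
rewrite powR_kernel ?divr_gt0 ?mulr_gt0//.
rewrite !powR_div ?mulr_ge0 ?sqr_ge0 ?(ltW A0) ?(ltW C0) ?(ltW q0) ?(ltW k0) ?(ltW s0) ?(ltW t0)//.
rewrite powR_sqr ?(ltW t0)// (powRM _ (mulr_ge0 (ltW A0) (ltW C0)) (ltW q0)).
rewrite (powRM _ (ltW k0) (ltW s0)).
have := powR_gt0 b s0; have := powR_gt0 b t0; have := powR_gt0 b k0.
set X := kk `^ b; set Y := t `^ b; set Z := s `^ b => X0 Y0 Z0.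
by field; rewrite !gt_eqF.
Qed.

Lemma ratio_weight (s : R) : 0 < s -> s < 1 ->
  (s ^+ 2 / (1 - s ^+ 2)) `^ (- 1 - b) * (2 * s / (1 - s ^+ 2) ^+ 2) =
  (1 - s ^+ 2) `^ b * (s * (s `^ b) ^+ 2)^-1 * (2 / (1 - s ^+ 2)).
Proof.
move=> s0 s1; have q0 : 0 < 1 - s ^+ 2 by nra.
rewrite powR_tail ?divr_gt0 ?exprn_gt0// powR_div ?sqr_ge0 ?(ltW q0)// powR_sqr ?(ltW s0)//.
have := powR_gt0 b s0; have := powR_gt0 b q0.
set X := s `^ b; set Y := _ `^ b => X0 Y0.
by field; rewrite !gt_eqF//; lra.
Qed.

Lemma measurable_subst (I J : interval R) (F dF G : R -> R) : open [set` I] ->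
  (forall x, x \in I -> F x \in J) ->
  (forall x, x \in I -> has_deriv F x (dF x)) ->
  {in I, continuous dF} -> {in J, continuous G} ->
  measurable_fun [set` I] (fun x => (G (F x) * dF x)%:E).
Proof.
move=> Io FJ FD cdF cG.
apply/measurable_EFinP; apply: open_continuous_measurable_fun => //.
move=> x; rewrite inE/= => xI; apply: cvgM; last exact: cdF.
by apply: continuous_comp; [exact: has_deriv_continuous (FD _ xI)|exact/cG/FJ].
Qed.

(** After the two Moebius substitutions both integrals run over s in (s0, 1) with the
same weight, so they can be added pointwise; the hypothesis on phi and Psi is
what the sum of the two integrands has to satisfy to be a function of
w = s^2 / (1 - s^2). *)
Lemma two_branches (f phi Psi : R -> R) (s0 : R) : 0 < s0 -> s0 < 1 ->
  (forall z, z \in `]-C, A[ -> f z = ((A - z) * (C + z)) `^ b * phi z) ->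
  {in `]-C, A[, continuous f} -> (forall z, z \in `]-C, A[ -> 0 <= f z) ->
  {in `]0, +oo[, continuous Psi} -> (forall w : R, 0 < w -> 0 <= Psi w) ->
  (forall s, 0 < s -> s < 1 ->
    phi (k * s / (1 + th * s)) / (1 + th * s) +
    phi (- (k * s / (1 - th * s))) / (1 - th * s) =
    2 / (1 - s ^+ 2) * Psi (s ^+ 2 / (1 - s ^+ 2))) ->
  (\int[mu]_(z in `](k * s0 / (1 + th * s0))%R, A[) (f z * z `^ (- 1 - 2 * b))%:E +
   \int[mu]_(z in `](k * s0 / (1 - th * s0))%R, C[) (f (- z)%R * z `^ (- 1 - 2 * b))%:E =
  ((A * C) `^ b * (k `^ b) ^- 2)%:E *
  \int[mu]_(w in `](s0 ^+ 2 / (1 - s0 ^+ 2))%R, +oo[) (w `^ (- 1 - b) * Psi w)%:E)%E.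
Proof.
have [A1 C1] := conj A0 C0; move=> s00 s01 fE cf f0 cPsi Psi0 H.
have k0 := cut_scale_gt0; have /andP[t1 t2] := cut_tilt_lt1.
have inl z : z \in `]0, A[ -> z \in `]-C, A[.
  by rewrite !in_itv/= => /andP[z0 ->]; rewrite andbT; lra.
have inr z : z \in `]0, C[ -> - z \in `]-C, A[.
  by rewrite !in_itv/= => /andP[z0 zC]; apply/andP; split; lra.
pose G1 z := f z * z `^ (- 1 - 2 * b).
pose G2 z := f (- z) * z `^ (- 1 - 2 * b).
have cG1 : {in `]0, A[, continuous G1}.
  move=> z zA; apply: cvgM; first exact/cf/inl.
  by apply: powR_cont; move: zA; rewrite in_itv/= => /andP[].
have cG2 : {in `]0, C[, continuous G2}.
  move=> z zA; apply: cvgM.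
    apply: (@continuous_comp _ _ _ (fun z => - z) f); first exact: opp_continuous.
    exact/cf/inr.
  by apply: powR_cont; move: zA; rewrite in_itv/= => /andP[].
have G10 z : z \in `]0, A[ -> 0 <= G1 z.
  by move=> zA; rewrite mulr_ge0 ?powR_ge0// f0// inl.
have G20 z : z \in `]0, C[ -> 0 <= G2 z.
  by move=> zA; rewrite mulr_ge0 ?powR_ge0// f0// inr.
have s1 s : s \in `]s0, 1[ -> 0 < s /\ s < 1.
  by rewrite in_itv/= => /andP[h1 h2]; split=> //; exact: lt_trans h1.
have E1 := moebius_subst A0 t1 t2 s00 s01 cG1 G10.
have nt1 : -1 < - th by lra.
have nt2 : - th < 1 by lra.
have E2 := moebius_subst C0 nt1 nt2 s00 s01 cG2 G20.
rewrite cut_scale_right in E1; rewrite cut_scale_left mulNr in E2.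
rewrite /G1 /G2 in E1 E2; rewrite E1 E2 (ratio_subst s00 s01); first last.
- by move=> w w0; rewrite mulr_ge0 ?powR_ge0// Psi0.
- move=> w; rewrite in_itv/= andbT => w0; apply: cvgM; first exact: powR_cont.
  by apply: cPsi; rewrite in_itv/= w0.
rewrite -ge0_integralZl//; first last.
- by rewrite lee_fin mulr_ge0 ?powR_ge0// invr_ge0 sqr_ge0.
- move=> s /= /s1[a1 a2]; have q0 : 0 < 1 - s ^+ 2 by nra.
  rewrite lee_fin mulr_ge0//; last by rewrite divr_ge0 ?sqr_ge0// mulr_ge0// ltW.
  by rewrite mulr_ge0 ?powR_ge0// Psi0// divr_gt0// exprn_gt0.
- apply: (@measurable_subst _ `]0, +oo[ (fun s => s ^+ 2 / (1 - s ^+ 2))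
    (fun s => 2 * s / (1 - s ^+ 2) ^+ 2) (fun w => w `^ (- 1 - b) * Psi w)) => //.
  + move=> s /s1[a1 a2]; have q0 : 0 < 1 - s ^+ 2 by nra.
    by rewrite in_itv/= divr_gt0// exprn_gt0.
  + move=> s /s1[a1 a2]; have q0 : 0 < 1 - s ^+ 2 by nra.
    by apply: has_deriv_eq; [deriv; rewrite gt_eqF|field; rewrite gt_eqF].
  + move=> s /s1[a1 a2]; have q0 : 0 < 1 - s ^+ 2 by nra.
    by cont; rewrite expf_neq0// gt_eqF.
  + move=> w; rewrite in_itv/= andbT => w0; apply: cvgM; first exact: powR_cont.
    by apply: cPsi; rewrite in_itv/= w0.
have Fm (c K t : R) (G : R -> R) : 0 < K ->
    (forall s, 0 < s -> s < 1 -> 0 < 1 + t * s) ->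
    (forall s, 0 < s -> s < 1 -> 0 < K * s / (1 + t * s) < c) ->
    {in `]0, c[, continuous G} ->
    measurable_fun `]s0, 1%R[
      (fun s => (G (K * s / (1 + t * s)) * (K / (1 + t * s) ^+ 2))%:E).
  move=> K0 tp Fc cG; apply: (@measurable_subst _ `]0, c[ (fun s => K * s / (1 + t * s))
      (fun s => K / (1 + t * s) ^+ 2) G) => //.
  - by move=> s /s1[a1 a2]; rewrite in_itv/= Fc.
  - move=> s /s1[a1 a2]; have n0 : 1 + t * s != 0 by rewrite gt_eqF// tp.
    by apply: has_deriv_eq; [by deriv|field].
  - move=> s /s1[a1 a2]; have n0 : 1 + t * s != 0 by rewrite gt_eqF// tp.
    by cont; rewrite expf_neq0.
rewrite -ge0_integralD//; first last.
- apply: (Fm C _ _ G2) => //.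
    by move=> s a1 a2; rewrite mulNr; have [] := cut_denom_gt0 (ltW a1) (ltW a2).
  by move=> s a1 a2; rewrite mulNr; have [] := cut_lt a1 a2.
- move=> s /= /s1[a1 a2]; have [_ /andP[l1 l2]] := cut_lt a1 a2.
  rewrite lee_fin mulr_ge0//; last by rewrite divr_ge0 ?sqr_ge0// ltW.
  by apply: G20; rewrite in_itv/= mulNr l1.
- apply: (Fm A _ _ G1) => //.
    by move=> s a1 a2; have [] := cut_denom_gt0 (ltW a1) (ltW a2).
  by move=> s a1 a2; have [] := cut_lt a1 a2.
- move=> s /= /s1[a1 a2]; have [/andP[l1 l2] _] := cut_lt a1 a2.
  rewrite lee_fin mulr_ge0//; last by rewrite divr_ge0 ?sqr_ge0// ltW.
  by apply: G10; rewrite in_itv/= l1.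
apply: eq_integral => s; rewrite inE/= => /s1[a1 a2].
have [p1 p2] := cut_denom_gt0 (ltW a1) (ltW a2).
have [/andP[l1 l2] /andP[l3 l4]] := cut_lt a1 a2.
have [r1 r2] := branch_prod a1 a2.
rewrite -EFinD -EFinM mulNr; congr EFin.
rewrite !fE; last 2 first.
- by apply: inr; rewrite in_itv/= l3.
- by apply: inl; rewrite in_itv/= l1.
rewrite opprK r1 r2.
rewrite [X in X + _](_ : _ = ((A * C) `^ b * (k `^ b) ^- 2) * ((1 - s ^+ 2) `^ b * (s * (s `^ b) ^+ 2)^-1 / (1 + th * s)) * phi (k * s / (1 + th * s))); last first.
  by rewrite -branch_weight//; ring.
rewrite [X in _ + X](_ : _ = ((A * C) `^ b * (k `^ b) ^- 2) * ((1 - s ^+ 2) `^ b * (s * (s `^ b) ^+ 2)^-1 / (1 - th * s)) * phi (- (k * s / (1 - th * s)))); last first.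
  by rewrite -branch_weight//; ring.
rewrite [in RHS](mulrAC _ (Psi _)) ratio_weight//.
transitivity (((A * C) `^ b * k `^ b ^- 2) *
    ((1 - s ^+ 2) `^ b * (s * s `^ b ^+ 2)^-1 *
    (2 / (1 - s ^+ 2) * Psi (s ^+ 2 / (1 - s ^+ 2))))); last by ring.
by rewrite -H//; ring.
Qed.

End two_branches.

Section kernels.
Context {R : realType}.
Notation mu := (@lebesgue_measure R).
Variables (b A C : R).
Hypotheses (b0 : 0 < b) (b1 : b < 1) (A0 : 0 < A) (C0 : 0 < C).
Notation k := (cut_scale A C).
Notation th := (cut_tilt A C).

(** The two one-sided integrals of f z / |z|^(1 + 2 b), cut at matching places. *)
Definition branch_tails (f : R -> R) (s : R) : \bar R :=
  (\int[mu]_(z in `](k * s / (1 + th * s))%R, A[) (f z * z `^ (- 1 - 2 * b))%:E +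
   \int[mu]_(z in `](k * s / (1 - th * s))%R, C[) (f (- z)%R * z `^ (- 1 - 2 * b))%:E)%E.

(** Here phi is the inverse of the product of distances, which makes Psi constant:
the merged integral is a pure power and the identity is exact. *)
Lemma barrier_tails (s : R) : 0 < s -> s < 1 ->
  branch_tails (fun z => ((A - z) * (C + z)) `^ (b - 1)) s =
  ((A * C) `^ (b - 1) * (k `^ b) ^- 2 * ((s ^+ 2 / (1 - s ^+ 2)) `^ (- b) / b))%:E.
Proof.
move=> s0 s1; have [A1 C1] := conj A0 C0.
have q0 : 0 < 1 - s ^+ 2 by nra.
have w0 : 0 < s ^+ 2 / (1 - s ^+ 2) by rewrite divr_gt0// exprn_gt0.
have pos z : z \in `]-C, A[ -> 0 < (A - z) * (C + z).
  by rewrite in_itv/= => /andP[h1 h2]; rewrite mulr_gt0//; lra.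
have AC0 : 0 < A * C by rewrite mulr_gt0.
rewrite /branch_tails (@two_branches _ b A C A0 C0 _
  (fun z => ((A - z) * (C + z))^-1) (fun=> (A * C)^-1))//.
- under eq_integral do rewrite mulrC EFinM.
  rewrite ge0_integralZl//; first last.
  + by rewrite lee_fin invr_ge0 ltW.
  + by move=> w _; rewrite lee_fin powR_ge0.
  + by mfun.
  rewrite integral_powR_tail// -!EFinM; congr EFin.
  rewrite powRD ?(gt_eqF AC0) ?implybT// powR_inv1 ?(ltW AC0)//; ring.
- move=> z /pos z0; rewrite powRD ?(gt_eqF z0) ?implybT//.
  by rewrite powR_inv1// ltW.
- by move=> z /pos z0; cont.
- by move=> z /pos z0; rewrite powR_ge0.
- by move=> w _; exact: cvg_cst.
- by move=> w _; rewrite invr_ge0 ltW.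
- move=> t t0 t1; have [p1 p2] := cut_denom_gt0 A0 C0 (ltW t0) (ltW t1).
  have t2 : 0 < 1 - t ^+ 2 by nra.
  have [r1 r2] := branch_prod A0 C0 t0 t1.
  rewrite opprK r1 r2; field.
  by rewrite !gt_eqF//; lra.
Qed.

Section poisson.
Variable Y : R.
Hypothesis AY : A < Y.

(** The kappa of the merged Poisson kernel; Y is the distance from x to the pole. *)
Definition kernel_rate : R := k ^+ 2 * ((Y - A) * (Y + C)) / (A * C * Y ^+ 2).

Lemma kernel_rateE : kernel_rate = 1 - (th - k / Y) ^+ 2.
Proof.
have [A1 C1] := conj A0 C0; have Y0 : 0 < Y by rewrite (lt_trans A0).
have AC : 0 < A + C by rewrite addr_gt0.
by rewrite /kernel_rate /cut_scale /cut_tilt; field; rewrite !gt_eqF.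
Qed.

Lemma kernel_rate_gt0 : 0 < kernel_rate.
Proof.
have Y0 : 0 < Y by rewrite (lt_trans A0).
have h1 : 0 < Y - A by rewrite subr_gt0.
have h2 : 0 < Y + C by rewrite addr_gt0.
have h3 := cut_scale_gt0 A0 C0.
by move: h3; rewrite /kernel_rate; move: (cut_scale A C) => kk h3; rewrite divr_gt0 ?mulr_gt0 ?exprn_gt0.
Qed.

(** kappa = 1 - (th - k / Y)^2: the error terms are uniform in the pole. *)
Lemma kernel_rate_le1 : kernel_rate <= 1.
Proof. by rewrite kernel_rateE gerBl sqr_ge0. Qed.

(** For phi z = (Y - z)^-1 the two branches add up to Psi w = (Y (1 + kappa w))^-1.
The constant kappa^b B of [kernel_tail_bounds] becomes the term
B ((Y - A)(Y + C))^b Y^(-1-2b), which accounts for the mass that the boundary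
datum has at the pole. *)
Lemma kernel_tails (s : R) : 0 < s -> s < 1 ->
  let P := ((A * C) `^ b / Y) * (k `^ b) ^- 2 in
  let w0 := s ^+ 2 / (1 - s ^+ 2) in
  let M := (branch_tails (fun z => ((A - z) * (C + z)) `^ b / (Y - z))%R s +
      (betaR b * ((Y - A) * (Y + C)) `^ b * Y `^ (- 1 - 2 * b))%:E)%E in
  ((P * (w0 `^ (- b) / b))%:E <= M)%E /\
  (M <= (P * (w0 `^ (- b) / b + w0 `^ (1 - b) / (1 - b)))%:E)%E.
Proof.
move=> s0 s1; cbv zeta; have [A1 C1] := conj A0 C0.
have q0 : 0 < 1 - s ^+ 2 by nra.
set w0 := s ^+ 2 / _; have w00 : 0 < w0 by rewrite divr_gt0// exprn_gt0.
have pos z : z \in `]-C, A[ -> 0 < (A - z) * (C + z).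
  by rewrite in_itv/= => /andP[h1 h2]; rewrite mulr_gt0//; lra.
have AC0 : 0 < A * C by rewrite mulr_gt0.
have Y0 : 0 < Y by rewrite (lt_trans A0).
have kp := kernel_rate_gt0; have kl := kernel_rate_le1.
have kw w : 0 < w -> 0 < 1 + kernel_rate * w by move=> ?; rewrite addr_gt0// mulr_gt0.
have YA z : z \in `]-C, A[ -> 0 < Y - z.
  by rewrite in_itv/= => /andP[h1 h2]; rewrite subr_gt0 (lt_trans h2 AY).
have := kernel_tail_bounds b0 b1 kp w00.
set J := (\int[mu]_(w in _) _)%E => /andP[J1 J2].
pose c := (A * C) `^ b * (k `^ b) ^- 2.
have c0 : 0 <= c by rewrite mulr_ge0 ?powR_ge0// invr_ge0 sqr_ge0.
have -> : branch_tails (fun z => ((A - z) * (C + z)) `^ b / (Y - z))%R s =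
    ((c / Y)%:E * J)%E.
  rewrite /branch_tails (@two_branches _ b A C A0 C0 _
    (fun z => (Y - z)^-1) (fun w => (Y * (1 + kernel_rate * w))^-1))//.
  - rewrite -/c [(c / Y)%:E]EFinM -muleA; congr (_ * _)%E.
    rewrite /J -ge0_integralZl//; first last.
    + by rewrite lee_fin invr_ge0 ltW.
    + move=> w /=; rewrite in_itv/= andbT => /(lt_trans w00) w1.
      by rewrite lee_fin divr_ge0 ?powR_ge0// ltW// kw.
    + by mfun.
    apply: eq_integral => w _; rewrite -EFinM; congr EFin.
    by rewrite invfM mulrCA.
  - by move=> z /[dup] /pos z0 /YA z1; cont; rewrite ?gt_eqF.
  - by move=> z /[dup] /pos z0 /YA z1; rewrite divr_ge0 ?powR_ge0// ltW.
  - move=> w; rewrite in_itv/= andbT => w1; cont.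
    by rewrite gt_eqF// mulr_gt0// kw.
  - by move=> w w1; rewrite invr_ge0 ltW// mulr_gt0// kw.
  - move=> t t0 t1; have [p1 p2] := cut_denom_gt0 A0 C0 (ltW t0) (ltW t1).
    have t2 : 0 < 1 - t ^+ 2 by nra.
    have [/andP[l1 l2] /andP[l3 l4]] := cut_lt A0 C0 t0 t1.
    have k0 := cut_scale_gt0 A0 C0.
    have [A2 C2] := (cut_scale_right A0 C0, cut_scale_left A0 C0).
    have KE : kernel_rate * Y ^+ 2 = Y ^+ 2 - (Y * th - k) ^+ 2.
      by rewrite kernel_rateE; field; rewrite gt_eqF.
    (* Y - z times the Moebius denominator, for each of the two branches *)
    have z1 : 0 < Y * (1 + th * t) - k * t.
      have : 0 < Y - k * t / (1 + th * t) by rewrite subr_gt0 (lt_trans l2).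
      by rewrite -(pmulr_lgt0 _ p1) mulrBl mulfVK ?gt_eqF.
    have z2 : 0 < Y * (1 - th * t) + k * t.
      by rewrite addr_gt0// mulr_gt0.
    have z4 : 0 < 1 - t ^+ 2 + kernel_rate * t ^+ 2.
      by rewrite addr_gt0// mulr_gt0// exprn_gt0.
    have z3 : 0 < Y * (1 - t ^+ 2 + kernel_rate * t ^+ 2) by rewrite mulr_gt0.
    transitivity ((Y * (1 + th * t) - k * t)^-1 + (Y * (1 - th * t) + k * t)^-1).
      by field; rewrite !gt_eqF.
    transitivity (2 / (Y * (1 - t ^+ 2 + kernel_rate * t ^+ 2))); last first.
      by field; rewrite (gt_eqF t2) (gt_eqF z4) (gt_eqF Y0).
    have Z : (Y * (1 + th * t) - k * t) * (Y * (1 - th * t) + k * t) =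
       Y * (Y * (1 - t ^+ 2 + kernel_rate * t ^+ 2)).
      by transitivity (Y ^+ 2 * (1 - t ^+ 2) + kernel_rate * Y ^+ 2 * t ^+ 2); [rewrite KE|]; ring.
    have n1 : Y * (1 + th * t) - k * t != 0 by rewrite gt_eqF.
    have n2 : Y * (1 - th * t) + k * t != 0 by rewrite gt_eqF.
    have n3 : Y * (1 - t ^+ 2 + kernel_rate * t ^+ 2) != 0 by rewrite gt_eqF.
    have n4 : Y != 0 by rewrite gt_eqF.
    transitivity ((Y * (1 + th * t) - k * t + (Y * (1 - th * t) + k * t)) /
      ((Y * (1 + th * t) - k * t) * (Y * (1 - th * t) + k * t))).
      by field; rewrite n1 n2.
    by rewrite Z; field; rewrite (gt_eqF z4) (gt_eqF Y0).
have E : betaR b * ((Y - A) * (Y + C)) `^ b * Y `^ (- 1 - 2 * b) =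
    (c / Y) * (kernel_rate `^ b * betaR b).
  have h1 : 0 < Y - A by rewrite subr_gt0.
  have h2 : 0 < Y + C by rewrite addr_gt0.
  rewrite powR_kernel// /kernel_rate /c; move: (cut_scale A C) (cut_scale_gt0 A0 C0) => kk kk0.
  rewrite powR_div ?mulr_ge0 ?sqr_ge0 ?(ltW kk0) ?(ltW A0) ?(ltW C0) ?(ltW h1) ?(ltW h2) ?(ltW Y0)//.
  rewrite (powRM _ (sqr_ge0 kk) (mulr_ge0 (ltW h1) (ltW h2))).
  rewrite (powRM _ (mulr_ge0 (ltW A0) (ltW C0)) (sqr_ge0 Y)).
  rewrite !powR_sqr ?(ltW kk0) ?(ltW Y0)//.
  have := powR_gt0 b kk0; have := powR_gt0 b Y0; have := powR_gt0 b AC0.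
  set X := (A * C) `^ b; set Z := Y `^ b; set T := kk `^ b => X0 Z0 T0.
  by field; rewrite !gt_eqF.
rewrite E [((c / Y) * (kernel_rate `^ b * betaR b))%:E]EFinM -muleDr//; last first.
  by rewrite ge0_adde_def// inE ?lee_fin ?mulr_ge0 ?powR_ge0 ?(ltW (betaR_gt0 b0 b1))//
     integral_ge0// => w /=; rewrite in_itv/= andbT => /(lt_trans w00) w1;
     rewrite lee_fin divr_ge0 ?powR_ge0// ltW// kw.
have cY : 0 <= c / Y by rewrite divr_ge0// ltW.
rewrite (_ : (A * C) `^ b / Y / _ = c / Y); last by rewrite /c mulrAC.
rewrite !EFinM; split; first by apply: lee_wpmul2l.
apply: lee_wpmul2l => //; apply: (le_trans J2).
rewrite lee_fin lerD2l ler_piMl// divr_ge0 ?powR_ge0// subr_ge0; exact: ltW.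
Qed.
End poisson.
End kernels.

(** * From balanced tails to the fractional Laplacian *)

Section symmetric_tails.
Context {R : realType}.
Notation mu := (@lebesgue_measure R).

(** Young's inequality with exponents 1/b and 1/(1 - b). *)
Lemma powR_bernoulli (b t : R) : 0 < b -> b < 1 -> 0 <= t ->
  t `^ b <= 1 + b * (t - 1).
Proof.
move=> b0 b1 t0; have c0 : 0 < 1 - b by rewrite subr_gt0.
have := @conjugate_powR _ (t `^ b) 1 b^-1 (1 - b)^-1 (powR_ge0 _ _) ler01.
rewrite !invr_gt0 !invrK b0 c0 => /(_ erefl erefl).
rewrite addrC subrK => /(_ erefl).
rewrite mulr1 powR1 mul1r -powRrM divff ?gt_eqF// powRr1// => h.
by apply: (le_trans h); lra.
Qed.

(** The first order terms cancel between 1 + h and 1 - h. This is why two skew cuts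
are as good as one symmetric cut up to O(s^2). *)
Lemma powR_sym_bounds (b h : R) : 0 < b -> b < 1 -> -1 < h < 1 ->
  2 * (1 - h ^+ 2) <= ((1 + h) `^ b) ^+ 2 + ((1 - h) `^ b) ^+ 2 <= 2 * (1 + h ^+ 2).
Proof.
move=> b0 b1 /andP[h1 h2].
have p1 : 0 <= 1 + h by lra.
have p2 : 0 <= 1 - h by lra.
apply/andP; split.
  have e : (1 - h ^+ 2) <= (1 + h) `^ b * (1 - h) `^ b.
    rewrite -powRM// (_ : (1 + h) * (1 - h) = 1 - h ^+ 2); last by ring.
    apply: ger1_powR; last exact: ltW.
    by apply/andP; split; nra.
  have := sqr_ge0 ((1 + h) `^ b - (1 - h) `^ b); nra.
rewrite -!powR_sqr//.
have := @powR_bernoulli b ((1 + h) ^+ 2) b0 b1 (sqr_ge0 _).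
have := @powR_bernoulli b ((1 - h) ^+ 2) b0 b1 (sqr_ge0 _).
by nra.
Qed.

Lemma integral_opp (h : R -> \bar R) (e : R) :
  measurable_fun [set: R] h -> (forall r, (0 <= h r)%E) ->
  (\int[mu]_(r in `]-oo, (- e)%R[) h r = \int[mu]_(r in `]e, +oo[) h (- r)%R)%E.
Proof.
move=> mh h0.
rewrite (_ : `]e, +oo[%classic =
    (-%R : _ -> measurableTypeR R) @^-1` `]-oo, (- e)%R[); last first.
  by apply/seteqP; split => r /=; rewrite !in_itv/= ?andbT ltrN2.
rewrite -ge0_integral_pushforward//=; last exact: measurable_funS mh.
by apply: eq_measure_integral => //= B mB _; exact/esym/lebesgue_measureN.
Qed.

Lemma integral_abs_gt (h : R -> \bar R) (e : R) : 0 < e ->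
  measurable_fun [set: R] h -> (forall r, (0 <= h r)%E) ->
  (\int[mu]_(r in [set z | (e < `|z|)%R]) h r =
   \int[mu]_(r in `]e, +oo[) h r + \int[mu]_(r in `]e, +oo[) h (- r)%R)%E.
Proof.
move=> e0 mh h0.
rewrite (_ : [set z | e < `|z|] = `]e, +oo[%classic `|` `]-oo, (- e)%R[%classic).
  rewrite ge0_integral_setU//; first by rewrite integral_opp.
    exact: measurable_funS mh.
  apply/disj_setPS => z [] /=; rewrite !in_itv/= andbT => h1 h2; lra.
apply/seteqP; split => z /=; rewrite !in_itv/= andbT.
  by rewrite lter_normr => /orP[|]; [left|right; rewrite ltrNr].
by rewrite lter_normr => -[->//|]; rewrite ltrNr => ->; rewrite orbT.
Qed.

Lemma measurable_abs_gt (e : R) : measurable [set z : R | e < `|z|].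
Proof.
rewrite (_ : [set z | e < `|z|] = `]e, +oo[%classic `|` `]-oo, (- e)%R[%classic).
  exact: measurableU.
apply/seteqP; split => z /=; rewrite !in_itv/= andbT.
  by rewrite lter_normr => /orP[|]; [left|right; rewrite ltrNr].
by rewrite lter_normr => -[->//|]; rewrite ltrNr => ->; rewrite orbT.
Qed.

End symmetric_tails.

Section one_sided_tails.
Context {R : realType}.
Notation mu := (@lebesgue_measure R).
Variable b : R.
Hypotheses (b0 : 0 < b) (b1 : b < 1).

Definition tail (g : R -> R) (e : R) : \bar R :=
  (\int[mu]_(z in `]e, +oo[) (g z * z `^ (- 1 - 2 * b))%:E)%E.

Lemma measurable_tail (D : set R) (g : R -> R) : measurable_fun [set: R] g ->
  measurable_fun D (fun z => (g z * z `^ (- 1 - 2 * b))%:E).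
Proof.
move=> mg; apply: mfun_EFin; apply: mfun_mul; first exact: measurable_funS mg.
by mfun.
Qed.

Lemma tail_split (g : R -> R) (e e' : R) : 0 < e -> e < e' ->
  measurable_fun [set: R] g -> (forall z, 0 <= g z) ->
  (tail g e = \int[mu]_(z in `]e, e'[) (g z * z `^ (- 1 - 2 * b))%:E + tail g e')%E.
Proof.
move=> e0 ee' mg g0; rewrite /tail (@ge0_integral_split _ _ e e')//.
- exact: measurable_tail.
- by move=> z _; rewrite lee_fin mulr_ge0// powR_ge0.
Qed.

Lemma tail_cst (c e : R) : 0 <= c -> 0 < e ->
  tail (fun=> c) e = (c * (e `^ (- (2 * b)) / (2 * b)))%:E.
Proof.
move=> c0 e0; rewrite /tail; under eq_integral do rewrite EFinM.
rewrite ge0_integralZl//; last 2 first.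
- by mfun.
- by move=> z _; rewrite lee_fin powR_ge0.
by rewrite integral_powR_tail// mulr_gt0.
Qed.

Lemma tail_ge0 (g : R -> R) e : (forall z, 0 <= g z) -> (0 <= tail g e)%E.
Proof. by move=> g0; apply: integral_ge0 => z _; rewrite lee_fin mulr_ge0// powR_ge0. Qed.

(** Between the two cut-offs g differs from g0 by at most L e', and the integral of
the weight there is at most e^(-2b) (e' - e) / (b e'). *)
Lemma tail_cut (g : R -> R) (g0 L d e e' : R) : 0 < e -> e <= e' -> e' < d ->
  measurable_fun [set: R] g -> (forall z, 0 <= g z) -> 0 <= g0 -> 0 <= L ->
  (forall z, 0 < z -> z < d -> `|g z - g0| <= L * z) ->
  (tail g e' < +oo)%E ->
  (tail g e < +oo)%E /\
  `|(fine (tail g e) - g0 * (e `^ (- (2 * b)) / (2 * b))) -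
    (fine (tail g e') - g0 * (e' `^ (- (2 * b)) / (2 * b)))| <=
    L / b * e `^ (- (2 * b)) * (e' - e).
Proof.
have [bb0 bb1] := conj b0 b1.
move=> e0; rewrite le_eqVlt => /predU1P[<-|ee'] e'd mg gp g00 L0 gL fe'.
  by split=> //; rewrite !subrr normr0 mulr0.
have e'0 : 0 < e' by exact: lt_trans ee'.
have gz z : z \in `]e, e'[ -> g z <= g0 + L * e' /\ g0 <= g z + L * e'.
  rewrite in_itv/= => /andP[ez ze'].
  have := gL z (lt_trans e0 ez) (lt_trans ze' e'd).
  rewrite ler_norml => /andP[h1 h2].
  have : L * z <= L * e' by rewrite ler_wpM2l// ltW.
  by split; lra.
have split1 := tail_split e0 ee' mg gp.
pose w z : R := z `^ (- 1 - 2 * b).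
pose I : R := e `^ (- (2 * b)) / (2 * b) - e' `^ (- (2 * b)) / (2 * b).
have IE c : 0 <= c -> (\int[mu]_(z in `]e, e'[) (c * w z)%:E = (c * I)%:E)%E.
  move=> c0.
  have := @tail_split (fun=> c) e e' e0 ee' (measurable_cst _) (fun=> c0).
  rewrite !tail_cst// -/w => /eqP; rewrite -sube_eq//; last first.
    by rewrite fin_num_adde_defl.
  by move=> /eqP <-; rewrite -EFinB /I mulrBr.
set S := (\int[mu]_(z in `]e, e'[) (g z * z `^ (- 1 - 2 * b))%:E)%E in split1.
have S0 : (0 <= S)%E.
  by apply: integral_ge0 => z _; rewrite lee_fin mulr_ge0// powR_ge0.
have S1 : (S <= ((g0 + L * e') * I)%:E)%E.
  rewrite -IE ?addr_ge0 ?mulr_ge0 ?(ltW e'0)//; apply: ge0_le_integral => //.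
  - by move=> z _; rewrite lee_fin mulr_ge0// powR_ge0.
  - exact: measurable_tail.
  - by rewrite /w; mfun.
  - by move=> z /gz[h1 _]; rewrite lee_fin ler_wpM2r// powR_ge0.
have S2 : ((g0 * I)%:E <= S + (L * e' * I)%:E)%E.
  rewrite -!IE ?mulr_ge0 ?(ltW e'0)// -ge0_integralD//.
  - apply: ge0_le_integral => //.
    + by move=> z _; rewrite lee_fin mulr_ge0// powR_ge0.
    + by rewrite /w; mfun.
    + apply: emeasurable_funD; first exact: measurable_tail.
      by rewrite /w; mfun.
    + by move=> z /gz[_ h1]; rewrite -EFinD -mulrDl lee_fin ler_wpM2r// powR_ge0.
  - by move=> z _; rewrite lee_fin mulr_ge0// powR_ge0.
  - exact: measurable_tail.
  - by move=> z _; rewrite lee_fin !mulr_ge0// ?powR_ge0// ltW.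
  - by rewrite /w; mfun.
have Sf : S \is a fin_num by rewrite ge0_fin_numE// (le_lt_trans S1)// ltry.
have Tf : tail g e' \is a fin_num by rewrite ge0_fin_numE// tail_ge0.
split; first by rewrite split1 lte_add_pinfty// ltey_eq ?Sf.
have [s Es] : exists s, S = s%:E by exists (fine S); rewrite fineK.
have [t Et] : exists t, tail g e' = t%:E by exists (fine (tail g e')); rewrite fineK.
rewrite split1 Et Es -EFinD /=.
move: S1 S2; rewrite Es lee_fin -EFinD lee_fin => S1 S2.
have II : I <= e `^ (- (2 * b)) * (e' - e) / (b * e').
  have q0 : 0 < e / e' by rewrite divr_gt0.
  have q1 : e / e' <= 1 by rewrite ler_pdivrMr// mul1r ltW.
  have h1 : e' `^ (- (2 * b)) = e `^ (- (2 * b)) * ((e / e') `^ b) ^+ 2.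
    rewrite powR_div ?(ltW e0) ?(ltW e'0)// !powRN !powR_dbl//.
    have := powR_gt0 b e0; have := powR_gt0 b e'0.
    set X := e `^ b; set Y := e' `^ b => X0 Y0.
    by field; rewrite !gt_eqF.
  have h2 : e / e' <= (e / e') `^ b.
    by apply: ger1_powR; [rewrite q0|exact: ltW].
  have h3 : (e / e') ^+ 2 <= ((e / e') `^ b) ^+ 2.
    by rewrite ler_sqr// ?nnegrE ?powR_ge0// ltW.
  have h4 : 1 - ((e / e') `^ b) ^+ 2 <= 2 * (1 - e / e') by nra.
  have E0 := powR_gt0 (- (2 * b)) e0.
  rewrite /I h1 (_ : _ - _ = e `^ (- (2 * b)) * (1 - ((e / e') `^ b) ^+ 2) / (2 * b)); last by ring.
  rewrite ler_pdivrMr ?mulr_gt0//.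
  rewrite (_ : _ * (2 * b) = e `^ (- (2 * b)) * (2 * (1 - e / e'))); last first.
    by field; rewrite !gt_eqF.
  by rewrite ler_pM2l.
have LI : L * e' * I <= L / b * e `^ (- (2 * b)) * (e' - e).
  have : L * e' * I <= L * e' * (e `^ (- (2 * b)) * (e' - e) / (b * e')).
    by rewrite ler_wpM2l// mulr_ge0// ltW.
  suff -> : L * e' * (e `^ (- (2 * b)) * (e' - e) / (b * e')) =
    L / b * e `^ (- (2 * b)) * (e' - e) by [].
  by field; rewrite !gt_eqF.
apply: le_trans LI; rewrite ler_norml; move: S1 S2; rewrite /I.
set u := e `^ _ / _; set v := e' `^ _ / _.
set m := L * e'; clearbody u v m => S1 S2.
by apply/andP; split; lra.
Qed.

End one_sided_tails.

Section truncation.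
Context {R : realType}.
Notation mu := (@lebesgue_measure R).
Variable b : R.
Hypotheses (b0 : 0 < b) (b1 : b < 1).

Definition rtail (f : R -> R) x := tail b (fun z => f (x + z)).
Definition ltail (f : R -> R) x := tail b (fun z => f (x - z)).
(** The tail of the constant function 1. *)
Definition one_tail (e : R) : R := e `^ (- (2 * b)) / (2 * b).

Definition weight (z : R) : R := `|z| `^ (- 1 - 2 * b).

Definition far (e : R) : set R := [set z | e < `|z|].

Lemma measurable_far e : measurable (far e : set (measurableTypeR R)).
Proof. exact: measurable_abs_gt. Qed.

Lemma measurable_weight (D : set R) : measurable_fun D weight.
Proof.
by apply: (@measurable_funS _ _ _ _ setT) => //; apply: mfun_powR; exact: normr_measurable.
Qed.

Lemma measurable_shift (f : R -> R) (x : R) : measurable_fun [set: R] f ->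
  measurable_fun [set: R] (fun z => f (x + z)).
Proof.
move=> mf; rewrite (_ : (fun z => _) = f \o (fun z => x + z))//.
by apply: measurableT_comp => //; mfun.
Qed.

Lemma measurable_shiftN (f : R -> R) (x : R) : measurable_fun [set: R] f ->
  measurable_fun [set: R] (fun z => f (x - z)).
Proof.
move=> mf; rewrite (_ : (fun z => _) = f \o (fun z => x - z))//.
by apply: measurableT_comp => //; mfun.
Qed.

Lemma integral_two_tails (f : R -> R) (x e : R) : 0 < e ->
  measurable_fun [set: R] f -> (forall z, 0 <= f z) ->
  (\int[mu]_(z in far e) (f (x + z) * weight z)%:E =
   rtail f x e + ltail f x e)%E.
Proof.
move=> e0 mf f0; rewrite integral_abs_gt => [|//||r].
- have -> : rtail f x e = (\int[mu]_(z in `]e, +oo[) (f (x + z)%R * weight z)%:E)%E.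
    apply: eq_integral => z; rewrite inE/= in_itv/= andbT => ez.
    by rewrite /weight gtr0_norm// (lt_trans e0).
  suff -> : ltail f x e = (\int[mu]_(z in `]e, +oo[) (f (x - z)%R * weight (- z)%R)%:E)%E by [].
  apply: eq_integral => z; rewrite inE/= in_itv/= andbT => ez.
  by rewrite /weight normrN gtr0_norm// (lt_trans e0).
- apply: mfun_EFin; apply: mfun_mul; first exact: measurable_shift.
  exact: measurable_weight.
- by rewrite lee_fin mulr_ge0// powR_ge0.
Qed.

Lemma integrable_tails (f : R -> R) (x e : R) : 0 < e ->
  measurable_fun [set: R] f -> (forall z, 0 <= f z) ->
  (rtail f x e < +oo)%E -> (ltail f x e < +oo)%E ->
  mu.-integrable (far e) (fun z => (f (x + z) * weight z)%:E).
Proof.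
move=> e0 mf f0 fr fl; apply/integrableP; split.
  apply: mfun_EFin; apply: mfun_mul; last exact: measurable_weight.
  by apply: measurable_funS (measurable_shift x mf).
under eq_integral do rewrite gee0_abs ?lee_fin ?mulr_ge0 ?powR_ge0//.
by rewrite integral_two_tails// lte_add_pinfty.
Qed.

Lemma integrable_one_tails (c e : R) : 0 < e -> 0 <= c ->
  mu.-integrable (far e) (fun z => (c * weight z)%:E).
Proof.
move=> e0 c0; apply: (@integrable_tails (fun=> c) 0) => //.
  by rewrite /rtail tail_cst// ltry.
by rewrite /ltail tail_cst// ltry.
Qed.

Lemma integrable_diff_quotient (f : R -> R) (x e : R) : 0 < e ->
  measurable_fun [set: R] f -> (forall z, 0 <= f z) ->
  (rtail f x e < +oo)%E -> (ltail f x e < +oo)%E ->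
  mu.-integrable (far e)
    (fun z => ((f (x + z) - f x) / `|z| `^ (1 + 2 * b))%:E).
Proof.
move=> e0 mf f0 fr fl.
have := integrableB (measurable_far e) (integrable_tails e0 mf f0 fr fl)
   (integrable_one_tails e0 (f0 x)).
apply: eq_integrable => //; first exact: measurable_far.
move=> z _ /=; rewrite -EFinB -mulrBl /weight; congr (_ * _)%:E.
by rewrite (_ : - 1 - 2 * b = - (1 + 2 * b)) ?powRN//; ring.
Qed.

(** The truncated integral may be split at 0 because each half converges. *)
Lemma trunc_tails (f : R -> R) (x e : R) : 0 < e ->
  measurable_fun [set: R] f -> (forall z, 0 <= f z) ->
  (rtail f x e < +oo)%E -> (ltail f x e < +oo)%E ->
  \int[mu]_(z in far e) ((f (x + z) - f x) / `|z| `^ (1 + 2 * b)) =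
  (fine (rtail f x e) - f x * one_tail e) + (fine (ltail f x e) - f x * one_tail e).
Proof.
move=> e0 mf f0 fr fl.
transitivity (\int[mu]_(z in far e) (f (x + z) * weight z - f x * weight z)).
  apply: eq_Rintegral => z _; rewrite -mulrBl; congr (_ * _).
  by rewrite /weight (_ : - 1 - 2 * b = - (1 + 2 * b)) ?powRN//; ring.
rewrite RintegralB//; first last.
- exact: integrable_one_tails.
- exact: integrable_tails.
- exact: measurable_far.
rewrite /Rintegral integral_two_tails// (@integral_two_tails (fun=> f x) x)//.
rewrite /rtail /ltail !tail_cst// fineD/=; first by rewrite /one_tail; ring.
  by rewrite ge0_fin_numE// tail_ge0.
by rewrite ge0_fin_numE// tail_ge0.
Qed.

End truncation.

Section balance.
Context {R : realType}.
Notation mu := (@lebesgue_measure R).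
Variable b : R.
Hypotheses (b0 : 0 < b) (b1 : b < 1).

(** The asymptotics of the matched tails of a harmonic function: the singular part
f x * k^(-2b) * w^-b / b without a constant term. A constant term would be the
fractional Laplacian up to a factor. *)
Definition balanced (f : R -> R) (x A C : R) :=
  forall s : R, 0 < s -> s < 1 ->
  let c := (cut_scale A C `^ b) ^- 2 in
  let w := s ^+ 2 / (1 - s ^+ 2) in
  let M := (rtail b f x (cut_scale A C * s / (1 + cut_tilt A C * s)) +
            ltail b f x (cut_scale A C * s / (1 - cut_tilt A C * s)))%E in
  ((f x * c * (w `^ (- b) / b))%:E <= M)%E /\
  (M <= (f x * c * (w `^ (- b) / b + w `^ (1 - b) / (1 - b)))%:E)%E.

Definition locally_lipschitz (f : R -> R) (x : R) :=
  exists d L : R, [/\ 0 < d, 0 <= L &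
    forall z : R, `|z| < d -> `|f (x + z) - f x| <= L * `|z|].

Variables (f : R -> R) (x A C : R).
Hypotheses (A0 : 0 < A) (C0 : 0 < C) (mf : measurable_fun [set: R] f)
  (f0 : forall z, 0 <= f z).

(** The bound at a pair of cuts smaller than e dominates the tails cut at e. *)
Lemma balanced_tails_lty (e : R) : balanced f x A C -> 0 < e ->
  (rtail b f x e < +oo)%E /\ (ltail b f x e < +oo)%E.
Proof.
have [[A1 C1] fz] := (conj A0 C0, f0).
move=> bal e0; have k0 := cut_scale_gt0 A0 C0.
have [s [s0 s1 s2]] : exists s : R, [/\ 0 < s, s <= 1 / 2 & 2 * (cut_scale A C * s) <= e].
  exists (Num.min (1 / 2) (e / (2 * cut_scale A C))); split.
  - by rewrite lt_min !divr_gt0// (mulr_gt0 _ k0).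
  - by rewrite ge_min lexx.
  - set m := Num.min _ _; have : m <= e / (2 * cut_scale A C) by rewrite ge_min lexx orbT.
    by rewrite ler_pdivlMr ?(mulr_gt0 _ k0)// (_ : m * _ = 2 * (cut_scale A C * m))//; ring.
have s3 : s < 1 by lra.
have [_ M] := bal s s0 s3.
have /andP[t1 t2] := cut_tilt_lt1 A0 C0.
have p1 : 1 / 2 < 1 + cut_tilt A C * s by nra.
have p2 : 1 / 2 < 1 - cut_tilt A C * s by nra.
have sub (g : R -> R) e' : measurable_fun [set: R] g -> (forall z, 0 <= g z) -> 0 < e' -> e' <= e ->
    (tail b g e <= tail b g e')%E.
  move=> mg g0 e'0; rewrite le_eqVlt => /predU1P[->//|e'e].
  rewrite (@tail_split _ b g e' e)// leeDr//; apply: integral_ge0 => z _.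
  by rewrite lee_fin mulr_ge0 ?powR_ge0.
have cut t : 1 / 2 < t -> 0 < cut_scale A C * s / t <= e.
  move=> t0; have t00 : 0 < t by lra.
  have ks : 0 < cut_scale A C * s by rewrite mulr_gt0.
  by rewrite divr_gt0//= ler_pdivrMr//; nra.
have /andP[c1 c2] := cut _ p1; have /andP[c3 c4] := cut _ p2.
have h1 := sub _ _ (measurable_shift x mf) (fun z => f0 (x + z)) c1 c2.
have h2 := sub _ _ (measurable_shiftN x mf) (fun z => f0 (x - z)) c3 c4.
have Mlt := le_lt_trans M (ltry _).
split; [apply: (le_lt_trans h1)|apply: (le_lt_trans h2)]; apply: le_lt_trans Mlt.
  by rewrite leeDl// tail_ge0.
by rewrite leeDr// tail_ge0.
Qed.

Definition trunc_diff (e : R) : R :=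
  \int[mu]_(z in far e) ((f (x + z) - f x) / `|z| `^ (1 + 2 * b)).

(** The two cuts k s / (1 +- th s) are moved to the common cut k s by [tail_cut],
which for a Lipschitz function costs s^(-2b) times s^2. What remains is the
[balanced] estimate minus the tails of the constant f x at the two cuts, and
these agree up to the same order by [powR_sym_bounds]. *)
Lemma trunc_diff_bound : balanced f x A C -> locally_lipschitz f x ->
  exists K d : R, 0 < d /\ forall s : R, 0 < s -> s < d ->
    `|trunc_diff (cut_scale A C * s)| <= K * (s `^ (1 - b)) ^+ 2.
Proof.
have [[A1 C1] [fx [bb0 bb1]]] := (conj A0 C0, conj (f0 x) (conj b0 b1)).
move=> bal [d [L [d0 L0 lip]]].
have tl (e : R) (e0 : 0 < e) := balanced_tails_lty bal e0.
have k0 := cut_scale_gt0 A0 C0; have /andP[t1 t2] := cut_tilt_lt1 A0 C0.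
move: bal k0 t1 t2; rewrite /balanced; move: (cut_scale A C) (cut_tilt A C) => k th bal k0 t1 t2.
pose c := (k `^ b) ^- 2.
have c0 : 0 < c by rewrite invr_gt0 exprn_gt0// powR_gt0.
pose E := (k / 2) `^ (- (2 * b)).
have E0 : 0 < E by rewrite powR_gt0// divr_gt0.
(* [K1] bounds the cost of moving one cut, [K2] the error of the balance together
   with that of the tails of the constant f x *)
pose K1 := L / b * E * (2 * k).
pose K2 := f x * c / b * (2 + 2 * b / (1 - b)).
exists (K1 + K1 + K2), (Num.min (1 / 2) (d / (2 * k))).
split; first by rewrite lt_min !divr_gt0// (mulr_gt0 _ k0).
move=> s s0; rewrite lt_min => /andP[s1]; rewrite ltr_pdivlMr ?(mulr_gt0 _ k0)// => s2.
have p1 : 1 / 2 < 1 + th * s by nra.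
have p2 : 1 / 2 < 1 - th * s by nra.
have ks0 : 0 < k * s by rewrite mulr_gt0.
(* [S] is s^(-2 b), [Q] is s^(2 - 2 b) *)
pose S := (s `^ b) ^- 2.
have S0 : 0 < S by rewrite invr_gt0 exprn_gt0// powR_gt0.
pose Q := S * s ^+ 2.
have QE : (s `^ (1 - b)) ^+ 2 = Q.
  rewrite powRD ?(gt_eqF s0) ?implybT// powRr1 ?(ltW s0)// powRN exprMn /Q /S.
  by rewrite exprVn mulrC.
rewrite QE.
have step (g : R -> R) (t : R) : measurable_fun [set: R] g -> (forall z, 0 <= g z) ->
    (forall z : R, 0 < z -> z < d -> `|g z - f x| <= L * z) ->
    (forall e, 0 < e -> (tail b g e < +oo)%E) ->
    -1 < t -> t < 1 -> 1 / 2 < 1 + t * s ->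
    `|(fine (tail b g (k * s)) - f x * one_tail b (k * s)) -
      (fine (tail b g (k * s / (1 + t * s))) - f x * one_tail b (k * s / (1 + t * s)))|
    <= K1 * Q.
  move=> mg g0 gL gt h1 h2 p0; set p := 1 + t * s in p0 *.
  have p3 : p < 2 by rewrite /p; nra.
  have pp : 0 < p by lra.
  have e'0 : 0 < k * s / p by rewrite divr_gt0.
  have e'p : k * s / p * p = k * s by rewrite divfK// gt_eqF.
  have ksd : k * s < d by lra.
  have e'd : k * s / p < d by rewrite ltr_pdivrMr//; nra.
  have pow (e : R) : 0 < e -> k * s <= 2 * e -> e `^ (- (2 * b)) <= E * S.
    move=> e0 h; have b20 : 0 <= 2 * b by rewrite mulr_ge0// ltW.
    have h0 : 0 < k * s / 2 by rewrite divr_gt0.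
    apply: (@le_trans _ _ ((k * s / 2) `^ (- (2 * b)))).
      by apply: ler_powRN => //; lra.
    rewrite (_ : k * s / 2 = k / 2 * s); last by ring.
    rewrite powRM ?(ltW s0) ?divr_ge0 ?(ltW k0)// -/E ler_pM2l//.
    by rewrite powRN powR_dbl.
  have fin (e d' : R) : 0 < e -> k * s <= 2 * e -> 0 <= d' -> d' * p <= k * s ^+ 2 ->
      L / b * e `^ (- (2 * b)) * d' <= K1 * Q.
    move=> e0 h d'0 d'p.
    have d'2 : d' <= 2 * k * s ^+ 2 by nra.
    apply: (@le_trans _ _ (L / b * (E * S) * (2 * k * s ^+ 2))).
      apply: ler_pM => //.
        by rewrite mulr_ge0 ?powR_ge0// divr_ge0// ltW.
      by rewrite ler_wpM2l ?pow// divr_ge0// ltW.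
    by rewrite le_eqVlt; apply/orP; left; apply/eqP; rewrite /K1 /Q; ring.
  have [t0|t0] := leP 0 t.
    have le1 : k * s / p <= k * s by rewrite ler_pdivrMr// ler_peMr ?(ltW ks0)// /p; nra.
    have [_ cut] := tail_cut b0 b1 e'0 le1 ksd mg g0 fx L0 gL (gt _ ks0).
    rewrite distrC; apply: (le_trans cut); apply: fin => //.
    - by rewrite -{1}e'p; nra.
    - by rewrite subr_ge0.
    - rewrite mulrBl e'p (_ : k * s * p - k * s = t * (k * s ^+ 2)); last first.
        by rewrite /p; ring.
      by rewrite ler_piMl ?(ltW h2)// mulr_ge0 ?sqr_ge0// ltW.
  have le1 : k * s <= k * s / p by rewrite ler_pdivlMr// ler_piMr ?(ltW ks0)// /p; nra.
  have [_ cut] := tail_cut b0 b1 ks0 le1 e'd mg g0 fx L0 gL (gt _ e'0).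
  apply: (le_trans cut); apply: fin => //.
  - by nra.
  - by rewrite subr_ge0.
  - rewrite mulrBl e'p (_ : k * s - k * s * p = - t * (k * s ^+ 2)); last first.
      by rewrite /p; ring.
    have t3 : - t <= 1 by lra.
    by rewrite ler_piMl// mulr_ge0 ?sqr_ge0// ltW.
have s3 : s < 1 by lra.
have [M1 M2] := bal s s0 s3.
rewrite /trunc_diff trunc_tails//; last 2 first.
  by have [] := tl _ ks0.
  by have [] := tl _ ks0.
have st1 := step _ th (measurable_shift x mf) (fun z => f0 (x + z)).
have st2 := step _ (- th) (measurable_shiftN x mf) (fun z => f0 (x - z)).
have {}st1 : `|(fine (rtail b f x (k * s)) - f x * one_tail b (k * s)) -
      (fine (rtail b f x (k * s / (1 + th * s))) - f x * one_tail b (k * s / (1 + th * s)))|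
    <= K1 * Q.
  apply: st1 => //; last by move=> e /tl[].
  by move=> z z0 zd; have := lip z; rewrite gtr0_norm//; apply.
have {}st2 : `|(fine (ltail b f x (k * s)) - f x * one_tail b (k * s)) -
      (fine (ltail b f x (k * s / (1 - th * s))) - f x * one_tail b (k * s / (1 - th * s)))|
    <= K1 * Q.
  have n1 : -1 < - th by lra.
  have n2 : - th < 1 by lra.
  rewrite (_ : 1 - th * s = 1 + - th * s); last by rewrite mulNr.
  apply: st2 => //; last by rewrite mulNr.
    by move=> z z0 zd; have := lip (- z); rewrite normrN gtr0_norm//; apply.
  by move=> e /tl[].
have pp1 : 0 < 1 + th * s by lra.
have pp2 : 0 < 1 - th * s by lra.
have ot (p : R) : 0 < p -> one_tail b (k * s / p) = c * S * (p `^ b) ^+ 2 / (2 * b).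
  move=> p0; rewrite /one_tail powRN powR_dbl ?divr_gt0//.
  rewrite powR_div ?(ltW p0) ?(ltW ks0)// powRM ?(ltW k0) ?(ltW s0)// /c /S.
  have := powR_gt0 b k0; have := powR_gt0 b s0; have := powR_gt0 b p0.
  set X := k `^ b; set Y := s `^ b; set Z := p `^ b => X0 Y0 Z0.
  by field; rewrite !gt_eqF.
move: st1 st2; rewrite !ot//.
have /andP[hs1 hs2] : -1 < th * s < 1 by apply/andP; split; nra.
have := @powR_sym_bounds _ b (th * s) b0 b1.
rewrite hs1 hs2 => /(_ erefl).
have sq : (th * s) ^+ 2 <= s ^+ 2.
  have th1 : th ^+ 2 <= 1 by nra.
  by rewrite exprMn ler_piMl// sqr_ge0.
set P1 := (1 + th * s) `^ b; set P2 := (1 - th * s) `^ b => /andP[q1 q2].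
have e10 : 0 < k * s / (1 + th * s) by rewrite divr_gt0.
have e20 : 0 < k * s / (1 - th * s) by rewrite divr_gt0.
have [r1 Er1] : exists r, rtail b f x (k * s / (1 + th * s)) = r%:E.
  have [h _] := tl _ e10; exists (fine (rtail b f x (k * s / (1 + th * s)))).
  by rewrite fineK// ge0_fin_numE// tail_ge0.
have [r2 Er2] : exists r, ltail b f x (k * s / (1 - th * s)) = r%:E.
  have [_ h] := tl _ e20; exists (fine (ltail b f x (k * s / (1 - th * s)))).
  by rewrite fineK// ge0_fin_numE// tail_ge0.
move: M1 M2; rewrite Er1 Er2 -EFinD !lee_fin/= -/c.
have s20 : 0 < 1 - s ^+ 2 by nra.
have w1 : (s ^+ 2 / (1 - s ^+ 2)) `^ (- b) = (1 - s ^+ 2) `^ b * S.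
  rewrite powRN powR_div ?sqr_ge0 ?(ltW s20)// powR_sqr ?(ltW s0)// /S.
  have := powR_gt0 b s0; have := powR_gt0 b s20.
  set X := s `^ b; set Y := _ `^ b => X0 Y0.
  by field; rewrite !gt_eqF.
have w2 : (s ^+ 2 / (1 - s ^+ 2)) `^ (1 - b) <= 2 * Q.
  have b10 : 0 <= 1 - b by lra.
  apply: (@le_trans _ _ ((2 * s ^+ 2) `^ (1 - b))).
    have s2n := sqr_ge0 s.
    have wl : s ^+ 2 / (1 - s ^+ 2) <= 2 * s ^+ 2.
      have s4 : s ^+ 2 <= 1 / 2 by nra.
      by rewrite ler_pdivrMr//; nra.
    have wn : 0 <= s ^+ 2 / (1 - s ^+ 2) by rewrite divr_ge0// ltW.
    by apply: ge0_ler_powR => //; rewrite nnegrE// mulr_ge0.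
  rewrite powRM ?sqr_ge0// powR_sqr ?(ltW s0)// QE ler_wpM2r//.
    by rewrite /Q mulr_ge0 ?sqr_ge0// ltW.
  rewrite -[leRHS]powRr1//; apply: ler_powR; lra.
rewrite w1.
have v1 : 1 - s ^+ 2 <= (1 - s ^+ 2) `^ b.
  apply: ger1_powR; last exact: ltW.
  by rewrite s20/=; nra.
have v2 : (1 - s ^+ 2) `^ b <= 1.
  have := @ge0_ler_powR _ b (ltW b0) (1 - s ^+ 2) 1.
  rewrite !nnegrE powR1; apply; [exact: ltW|exact: ler01|].
  by rewrite gerBl sqr_ge0.
set V := (1 - s ^+ 2) `^ b in v1 v2 *; set W := _ `^ (1 - b) in w2 *.
set a1 := fine (rtail b f x (k * s)) - _; set a2 := fine (ltail b f x (k * s)) - _.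
move=> M1 M2; rewrite !ler_norml => /andP[st11 st12] /andP[st21 st22].
pose X := f x * c; have X0 : 0 <= X by rewrite mulr_ge0// ltW.
have SE : S - S * s ^+ 2 = S - Q by [].
have Xb : 0 <= X * S / b by rewrite divr_ge0 ?mulr_ge0// ltW.
have U1 : X * S / b * V <= X * S / b by rewrite ler_piMr.
have L1 : X * S / b * (1 - s ^+ 2) <= X * S / b * V by rewrite ler_wpM2l.
have U2 : X / (1 - b) * W <= X / (1 - b) * (2 * Q).
  by rewrite ler_wpM2l// divr_ge0//; lra.
have U3 : X * S / b * (1 - s ^+ 2) <= X * S / b * ((P1 ^+ 2 + P2 ^+ 2) / 2).
  by rewrite ler_wpM2l//; lra.
have L3 : X * S / b * ((P1 ^+ 2 + P2 ^+ 2) / 2) <= X * S / b * (1 + s ^+ 2).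
  by rewrite ler_wpM2l//; lra.
pose Z := X * S / b * ((P1 ^+ 2 + P2 ^+ 2) / 2).
have ZE : f x * (c * S * P1 ^+ 2 / (2 * b)) + f x * (c * S * P2 ^+ 2 / (2 * b)) = Z.
  by rewrite /Z /X; field; rewrite gt_eqF.
have M1' : X * S / b * V <= r1 + r2.
  by apply: le_trans M1; rewrite le_eqVlt; apply/orP; left; apply/eqP; rewrite /X; ring.
have M2' : r1 + r2 <= X * S / b * V + X / (1 - b) * W.
  by apply: (le_trans M2); rewrite le_eqVlt; apply/orP; left; apply/eqP; rewrite /X; ring.
have K2E : K2 * Q = 2 * (X * S / b * s ^+ 2) + X / (1 - b) * (2 * Q).
  by rewrite /K2 /Q /X; field; rewrite !gt_eqF//; lra.
rewrite 2!mulrDl K2E; rewrite -/Z in U3 L3.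
move: ZE st11 st12 st21 st22.
set y1 := f x * (_ * P1 ^+ 2 / _); set y2 := f x * (_ * P2 ^+ 2 / _) => ZE.
move: U1 L1 U2 U3 L3 M1' M2'.
rewrite [_ * (1 - _)]mulrBr [_ * (1 + _)]mulrDr mulr1.
set x1 := X * S / b * V; set x2 := X * S / b; set x3 := x2 * s ^+ 2.
set x4 := X / (1 - b) * W; set x5 := X / (1 - b) * _; set x6 := K1 * Q.
clear -ZE; clearbody x6 x5 x4 x3 x2 x1 y1 y2 Z a1 a2 => *.
by apply/andP; split; lra.
Qed.

End balance.

Section harmonic.
Context {R : realType}.
Variable b : R.
Hypotheses (b0 : 0 < b) (b1 : b < 1).

(** Since b < 1, the bound s^(2 - 2 b) of the truncated integral tends to 0. *)
Lemma balanced_frac_lap (f : R -> R) (x A C : R) : 0 < A -> 0 < C ->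
  measurable_fun [set: R] f -> (forall z, 0 <= f z) ->
  balanced b f x A C -> locally_lipschitz f x -> is_frac_lap (2 * b) f x 0.
Proof.
move=> A0 C0 mf f0 bal lip.
have [K [d [d0 Kd]]] := trunc_diff_bound b0 b1 A0 C0 mf f0 bal lip.
have k0 := cut_scale_gt0 A0 C0.
pose K' := `|K| * ((cut_scale A C)^-1 `^ (1 - b)) ^+ 2.
have cK : K' * (e `^ (1 - b)) ^+ 2 @[e --> 0^'+] --> (0 : R).
  have h : e `^ (1 - b) @[e --> (0 : R)^'+] --> (0 : R) by apply: powR_cvg0; rewrite subr_gt0.
  have h2 : (e `^ (1 - b)) ^+ 2 @[e --> (0 : R)^'+] --> (0 : R).
    suff : (e `^ (1 - b)) ^+ 2 @[e --> (0 : R)^'+] --> (0 * 0 : R) by rewrite mulr0.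
    exact: (cvgM h h).
  suff : K' * (e `^ (1 - b)) ^+ 2 @[e --> 0^'+] --> K' * 0 by rewrite mulr0.
  by apply: cvgM => //; exact: cvg_cst.
have ct : trunc_diff b f x e @[e --> 0^'+] --> (0 : R).
  apply: (@squeeze_cvgr _ _ _ _ (fun e => - (K' * (e `^ (1 - b)) ^+ 2)) (fun e => K' * (e `^ (1 - b)) ^+ 2)) => //; last first.
    suff : - (K' * (e `^ (1 - b)) ^+ 2) @[e --> 0^'+] --> - (0 : R) by rewrite oppr0.
    exact: (cvgN cK).
  near=> e; rewrite -ler_norml.
  have e0 : 0 < e by near: e; exact: nbhs_right_gt.
  have ed : e < d * cut_scale A C by near: e; apply: nbhs_right_lt; rewrite mulr_gt0.
  have := Kd (e / cut_scale A C); rewrite divr_gt0// ltr_pdivrMr// => /(_ erefl ed).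
  rewrite mulrC divfK ?gt_eqF// => /le_trans; apply.
  rewrite powRM ?invr_ge0 ?(ltW e0) ?(ltW k0)// exprMn /K' [_ ^+ 2 * _ ^+ 2]mulrC mulrA.
  by rewrite ler_wpM2r ?sqr_ge0// ler_wpM2r ?sqr_ge0// ler_norm.
suff : frac_lap_trunc (2 * b) f x eps @[eps --> 0^'+] --> frac_lap_const (2 * b) * 0.
  by rewrite mulr0.
by apply: cvgM => //; exact: cvg_cst.
Unshelve. all: by end_near. Qed.

End harmonic.

(** * The barrier *)

Section lipschitz.
Context {R : realType}.
Implicit Types (f g : R -> R) (x : R).

Lemma has_deriv_lipschitz f x d : has_deriv f x d -> locally_lipschitz f x.
Proof.
move=> [/cvg_ex[l hl] _].
have [e /= e0 he] : \forall h \near (0 : R)^', `|h^-1 *: (f (h *: 1 + x) - f x)| < `|l| + 1.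
  near=> h; rewrite -[ltLHS](subrK `|l|) [`|l| + 1]addrC ltrD2r.
  apply: (le_lt_trans (lerB_dist _ _)).
  by near: h; move: hl => /cvgr_distC_lt; apply.
exists e, (`|l| + 1); split=> //.
move=> z ze; have [->|z0] := eqVneq z 0; first by rewrite addr0 subrr !normr0 mulr0.
have := he z; rewrite /= sub0r normrN => /(_ ze z0).
rewrite normrZ normfV mulrC -ltr_pdivlMr ?invr_gt0 ?normr_gt0// invrK.
by rewrite [_ *: 1]mulr1 (addrC z) => /ltW.
Unshelve. all: by end_near. Qed.

Lemma locally_lipschitz_continuous f x : locally_lipschitz f x -> {for x, continuous f}.
Proof.
move=> [d [L [d0 L0 h]]]; apply/cvgrPdist_lt => e e0.
have L1 : 0 < L + 1 by rewrite ltr_wpDl.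
have m0 : 0 < Num.min d (e / (L + 1)) by rewrite lt_min d0 divr_gt0.
near=> y.
have : `|y - x| < Num.min d (e / (L + 1)).
  near: y; apply/nbhs_ballP; exists (Num.min d (e / (L + 1))) => //= y.
  by rewrite /ball/= distrC.
rewrite lt_min => /andP[yd ye].
have := h _ yd; rewrite (addrC x) subrK distrC => /le_lt_trans; apply.
move: ye; rewrite ltr_pdivlMr// => ye; apply: le_lt_trans ye.
by rewrite mulrDr mulr1 mulrC lerDl.
Unshelve. all: by end_near. Qed.

Lemma locally_lipschitz_mul f g x :
  locally_lipschitz f x -> locally_lipschitz g x -> locally_lipschitz (fun y => f y * g y) x.
Proof.
move=> [d [L [d0 L0 hf]]] [d' [L' [d'0 L'0 hg]]].
exists (Num.min d d'), ((`|f x| + L * d) * L' + `|g x| * L); split.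
- by rewrite lt_min d0.
- by rewrite addr_ge0 ?mulr_ge0// addr_ge0// mulr_ge0// ltW.
move=> z; rewrite lt_min => /andP[zd zd'].
have := hf _ zd; have := hg _ zd'.
set F := f (x + z); set G := g (x + z) => h1 h2.
rewrite (_ : F * G - f x * g x = F * (G - g x) + g x * (F - f x)); last by ring.
apply: (le_trans (ler_normD _ _)); rewrite !normrM mulrDl -!mulrA; apply: lerD.
  apply: ler_pM => //; rewrite -[F](subrK (f x)) addrC.
  apply: (le_trans (ler_normD _ _)); rewrite lerD2l; apply: (le_trans h2).
  by rewrite ler_wpM2l// ltW.
by rewrite ler_wpM2l.
Qed.

Lemma locally_lipschitz_near f g x : (\forall y \near x, f y = g y) ->
  locally_lipschitz f x -> locally_lipschitz g x.
Proof.
move=> fg [d [L [d0 L0 hf]]]; have fgx := nbhs_singleton fg.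
have [e /= e0 he] := fg.
exists (Num.min d e), L; split=> //; first by rewrite lt_min d0.
move=> z; rewrite lt_min => /andP[zd ze].
by rewrite -fgx -he ?hf//= opprD addrA subrr sub0r normrN.
Qed.

Lemma locally_lipschitz_cst c x : locally_lipschitz (fun=> c) x.
Proof. exact: has_deriv_lipschitz (has_deriv_cst c x). Qed.

End lipschitz.

Section barrier.
Context {R : realType}.
Notation mu := (@lebesgue_measure R).
Variable b : R.
Hypotheses (b0 : 0 < b) (b1 : b < 1).

(** Beyond the endpoints the tails of f are kept as they are; inside they are
those of phi. *)
Lemma tails_branches (f phi : R -> R) (x A C s : R) : 0 < A -> 0 < C ->
  measurable_fun [set: R] f -> (forall z, 0 <= f z) ->
  (forall z, z \in `]-C, A[ -> f (x + z) = phi z) -> 0 < s -> s < 1 ->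
  (rtail b f x (cut_scale A C * s / (1 + cut_tilt A C * s)) +
   ltail b f x (cut_scale A C * s / (1 - cut_tilt A C * s)) =
   branch_tails b A C phi s + (rtail b f x A + ltail b f x C))%E.
Proof.
move=> A0 C0 mf f0 fphi s0 s1.
have [/andP[l1 l2] /andP[l3 l4]] := cut_lt A0 C0 s0 s1.
rewrite /rtail /ltail.
rewrite (tail_split b l1 l2 (measurable_shift x mf) (fun z => f0 (x + z))).
rewrite (tail_split b l3 l4 (measurable_shiftN x mf) (fun z => f0 (x - z))).
rewrite addeACA; congr (_ + _)%E; rewrite /branch_tails.
have -> : (\int[mu]_(z in `](cut_scale A C * s / (1 + cut_tilt A C * s))%R, A[)
   (f (x + z)%R * z `^ (-1 - 2 * b))%:E = \int[mu]_(z in `](cut_scale A C * s / (1 + cut_tilt A C * s))%R, A[)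
   (phi z * z `^ (-1 - 2 * b))%:E)%E.
  apply: eq_integral => z; rewrite inE/= in_itv/= => /andP[z1 z2].
  by rewrite fphi// in_itv/= z2 andbT; lra.
have -> : (\int[mu]_(z in `](cut_scale A C * s / (1 - cut_tilt A C * s))%R, C[)
   (f (x - z)%R * z `^ (-1 - 2 * b))%:E = \int[mu]_(z in `](cut_scale A C * s / (1 - cut_tilt A C * s))%R, C[)
   (phi (- z)%R * z `^ (-1 - 2 * b))%:E)%E; last by [].
apply: eq_integral => z; rewrite inE/= in_itv/= => /andP[z1 z2].
by rewrite fphi// in_itv/= ; apply/andP; split; lra.
Qed.

Lemma tail_eq0 (g : R -> R) (e : R) : (forall z, e < z -> g z = 0) -> tail b g e = 0%E.
Proof.
move=> g0; rewrite /tail; under eq_integral => z.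
  rewrite inE/= in_itv/= andbT => /g0 ->; rewrite mul0r; over.
by rewrite integral0.
Qed.

Variables p q : R.

(** The b - 1 power of the product of the distances is harmonic on (p, q) and
infinite at the endpoints, while being bounded in the interior. *)
Definition barrier (x : R) : R :=
  ((fun x => ((x - p) * (q - x)) `^ (b - 1)) \_ `]p, q[) x.

Lemma barrierE x : p < x -> x < q -> barrier x = ((x - p) * (q - x)) `^ (b - 1).
Proof. by move=> px xq; rewrite /barrier patchE mem_set//= in_itv/= px. Qed.

Lemma barrier_out x : ~~ (p < x < q) -> barrier x = 0.
Proof. by move=> h; rewrite /barrier patchE memNset//= in_itv/=; apply/negP. Qed.

Lemma barrier_ge0 x : 0 <= barrier x.
Proof. by rewrite /barrier patchE; case: ifP => // _; rewrite powR_ge0. Qed.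

Lemma measurable_barrier : measurable_fun [set: R] barrier.
Proof.
have mI : measurable (`]p, q[%classic : set R) by [].
apply: (measurable_restrictT (fun x : R => ((x - p) * (q - x)) `^ (b - 1)) mI).1.
by mfun.
Qed.

Lemma near_itv (x : R) : p < x -> x < q -> \forall y \near x, p < y < q.
Proof.
move=> px xq; have : x \in `]p, q[ by rewrite in_itv/= px.
by move=> /near_in_itvoo; apply: filterS => y; rewrite in_itv.
Qed.

Lemma barrier_lipschitz x : p < x -> x < q -> locally_lipschitz barrier x.
Proof.
move=> px xq; apply: (@locally_lipschitz_near _ (fun x => ((x - p) * (q - x)) `^ (b - 1))).
  near=> y; have /andP[y1 y2] : p < y < q by near: y; exact: near_itv.
  by rewrite barrierE.
apply: has_deriv_lipschitz; deriv.
by rewrite mulr_gt0// subr_gt0.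
Unshelve. all: by end_near. Qed.

Lemma barrier_balanced x : p < x -> x < q -> balanced b barrier x (q - x) (x - p).
Proof.
move=> px xq s s0 s1; cbv zeta.
have A0 : 0 < q - x by rewrite subr_gt0.
have C0 : 0 < x - p by rewrite subr_gt0.
rewrite (@tails_branches _ (fun z => ((q - x - z) * (x - p + z)) `^ (b - 1)))//; first last.
- move=> z; rewrite in_itv/= => /andP[z1 z2]; rewrite barrierE; [|lra|lra].
  by congr (_ `^ _); ring.
- exact: barrier_ge0.
- exact: measurable_barrier.
rewrite /rtail /ltail !tail_eq0; first last.
- by move=> z z0; rewrite barrier_out//; apply/negP => /andP[]; lra.
- by move=> z z0; rewrite barrier_out//; apply/negP => /andP[]; lra.
rewrite !adde0 barrier_tails// barrierE// [(q - x) * _]mulrC; split=> //.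
rewrite lee_fin ler_wpM2l ?mulr_ge0 ?powR_ge0 ?invr_ge0 ?sqr_ge0//.
by rewrite lerDl divr_ge0 ?powR_ge0// subr_ge0 ltW.
Qed.

End barrier.

(** * The Poisson integral *)

Section shift.
Context {R : realType}.
Notation mu := (@lebesgue_measure R).

Lemma has_deriv_shift (t x : R) : has_deriv (fun w => t + w) x 1.
Proof. by apply: has_deriv_eq; [deriv|rewrite add0r]. Qed.

Lemma integral_shift_oo (G : R -> R) (t a c : R) : a < c ->
  {in `]t + a, t + c[, continuous G} -> (forall x, x \in `]t + a, t + c[ -> 0 <= G x) ->
  (\int[mu]_(y in `](t + a)%R, (t + c)%R[) (G y)%:E = \int[mu]_(w in `]a, c[) (G (t + w)%R)%:E)%E.
Proof.
move=> ac cG G0.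
rewrite (@ge0_substitution _ `]a, c[ `](t + a), (t + c)[ (fun w => t + w) (fun=> 1) (fun y => y - t) G) => [||||||||||//|//].
- by apply: eq_integral => w _; rewrite mulr1.
- exact: exhausts_oo.
- exact: interval_open.
- exact: interval_open.
- by move=> x y _ _; rewrite ltrD2l.
- by move=> x; rewrite !in_itv/= !ltrD2l.
- by move=> y; rewrite !in_itv/= ltrBrDl ltrBlDl => h; rewrite h addrC subrK.
- by move=> x _; exact: has_deriv_shift.
- by move=> x _; exact: cvg_cst.
- by move=> x _; exact: ler01.
Qed.

Lemma integral_shift_oy (G : R -> R) (t a : R) :
  {in `]t + a, +oo[, continuous G} -> (forall x, x \in `]t + a, +oo[ -> 0 <= G x) ->
  (\int[mu]_(y in `](t + a)%R, +oo[) (G y)%:E = \int[mu]_(w in `]a, +oo[) (G (t + w)%R)%:E)%E.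
Proof.
move=> cG G0.
rewrite (@ge0_substitution _ `]a, +oo[ `](t + a), +oo[ (fun w => t + w) (fun=> 1) (fun y => y - t) G) => [||||||||||//|//].
- by apply: eq_integral => w _; rewrite mulr1.
- exact: exhausts_oy.
- exact: interval_open.
- exact: interval_open.
- by move=> x y _ _; rewrite ltrD2l.
- by move=> x; rewrite !in_itv/= !ltrD2l.
- by move=> y; rewrite !in_itv/= ltrBrDl => h; rewrite h addrC subrK.
- by move=> x _; exact: has_deriv_shift.
- by move=> x _; exact: cvg_cst.
- by move=> x _; exact: ler01.
Qed.

End shift.

Section poisson_integral.
Context {R : realType}.
Notation mu := (@lebesgue_measure R).
Variables (b p q e : R).
Hypotheses (b0 : 0 < b) (b1 : b < 1) (pq : p < q) (qe : q < e).

Definition poisson_density (y : R) : R := ((y - p) * (y - q)) `^ (- b).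

Definition poisson_int (x : R) : \bar R := (\int[mu]_(y in `]q, e[) (poisson_density y / (y - x))%:E)%E.

Definition poisson_mass (x : R) : R := fine (poisson_int x).

Let yq (y : R) : y \in `]q, e[ -> [/\ 0 < y - q, 0 < y - p & y < e].
Proof. by have := pq; rewrite in_itv/= => ? /andP[? ?]; split=> //; lra. Qed.

Lemma poisson_int_ge0 x : x <= q -> (0 <= poisson_int x)%E.
Proof.
move=> xq; apply: integral_ge0 => y /= /yq[y1 y2 y3].
by rewrite lee_fin divr_ge0 ?powR_ge0//; lra.
Qed.

Lemma measurable_poisson (x : R) (D : set R) : measurable_fun D (fun y => (poisson_density y / (y - x))%:E).
Proof. by rewrite /poisson_density; mfun. Qed.

(** As y - p >= x - p, the integral is at most (x - p)^-b times that of
(y - q)^-b / (y - x) over all y > q, which is (q - x)^-b B. This is what bounds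
u by 1. *)
Lemma poisson_int_le x : p < x -> x < q ->
  (poisson_int x <= (((x - p) `^ b * (q - x) `^ b)^-1 * betaR b)%:E)%E.
Proof.
move=> px xq.
have x1 : 0 < x - p by lra.
have x2 : 0 < q - x by lra.
apply: (@le_trans _ _ (\int[mu]_(y in `]q, +oo[) ((x - p) `^ (- b) * ((y - q) `^ (- b) / (y - x)))%:E)%E).
  apply: (@le_trans _ _ (\int[mu]_(y in `]q, e[) ((x - p) `^ (- b) * ((y - q) `^ (- b) / (y - x)))%:E)%E).
    apply: ge0_le_integral => //.
    - by move=> y /= /yq[y1 y2 y3]; rewrite lee_fin divr_ge0 ?powR_ge0//; lra.
    - exact: measurable_poisson.
    - by mfun.
    - move=> y /= /yq[y1 y2 y3]; rewrite lee_fin /poisson_density.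
      rewrite powRM ?(ltW y1) ?(ltW y2)// mulrA ler_wpM2r//.
        by rewrite invr_ge0; lra.
      rewrite ler_wpM2r ?powR_ge0//; apply: ler_powRN; rewrite ?ltW//; lra.
  apply: ge0_subset_integral => //.
  - by mfun.
  - move=> y /=; rewrite in_itv/= andbT => y1.
    by rewrite lee_fin mulr_ge0 ?powR_ge0// divr_ge0 ?powR_ge0//; lra.
  - exact: subset_itvl.
have := @integral_shift_oy _ (fun y => (x - p) `^ (- b) * ((y - q) `^ (- b) / (y - x))) q 0.
rewrite addr0 => ->; first last.
- move=> y; rewrite in_itv/= andbT => y1.
  by rewrite mulr_ge0 ?powR_ge0// divr_ge0 ?powR_ge0//; lra.
- move=> y; rewrite in_itv/= andbT => y1; cont; rewrite ?subr_gt0// ?gt_eqF//; lra.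
under eq_integral do rewrite EFinM.
rewrite ge0_integralZl//; first last.
- by rewrite lee_fin powR_ge0.
- move=> w /=; rewrite in_itv/= andbT => w0.
  by rewrite lee_fin divr_ge0 ?powR_ge0//; lra.
- by mfun.
have -> : (\int[mu]_(w in `]0%R, +oo[) ((q + w - q) `^ (- b) / (q + w - x))%:E =
   \int[mu]_(w in `]0%R, +oo[) (w `^ (- b) / (q - x + w))%:E)%E.
  apply: eq_integral => w _; congr (_ `^ _ / _)%:E; ring.
rewrite integral_kernel_scale// betaRE// -!EFinM lee_fin.
by rewrite invfM !powRN mulrA.
Qed.

Lemma poisson_int_fin x : p < x -> x < q -> poisson_int x = (poisson_mass x)%:E.
Proof.
move=> px xq; rewrite /poisson_mass fineK// ge0_fin_numE ?poisson_int_ge0 ?(ltW xq)//.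
by apply: le_lt_trans (poisson_int_le px xq) _; rewrite ltry.
Qed.

Lemma poisson_mass_ge0 x : x <= q -> 0 <= poisson_mass x.
Proof. by move=> xq; apply: fine_ge0; exact: poisson_int_ge0. Qed.

Definition usol_inside (x : R) : R := (betaR b)^-1 * (((x - p) * (q - x)) `^ b * poisson_mass x).

(** The solution of the Dirichlet problem on (p, q) with datum the indicator of
[q, e). *)
Definition usol (x : R) : R := (usol_inside \_ `]p, q[) x + \1_(`[q, e[%classic) x.

Lemma usol_in x : p < x -> x < q -> usol x = usol_inside x.
Proof.
move=> px xq; rewrite /usol patchE mem_set/= ?in_itv/= ?px//.
by rewrite indicE memNset ?addr0//= in_itv/= => /andP[]; rewrite leNgt xq.
Qed.

Lemma usol_one x : q <= x -> x < e -> usol x = 1.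
Proof.
move=> qx xe; rewrite /usol patchE memNset/=; last first.
  by rewrite in_itv/= => /andP[_]; rewrite ltNge qx.
by rewrite indicE mem_set ?add0r//= in_itv/= qx.
Qed.

Lemma usol_left x : x <= p -> usol x = 0.
Proof.
move=> xp; rewrite /usol patchE memNset/=; last first.
  by rewrite in_itv/= => /andP[]; rewrite ltNge xp.
rewrite indicE memNset ?add0r//= in_itv/= => /andP[].
by rewrite leNgt (le_lt_trans xp pq).
Qed.

Lemma usol_right x : e <= x -> usol x = 0.
Proof.
move=> ex; rewrite /usol patchE memNset/=; last first.
  by rewrite in_itv/= => /andP[_]; rewrite ltNge (le_trans (ltW qe) ex).
by rewrite indicE memNset ?add0r//= in_itv/= => /andP[_]; rewrite ltNge ex.
Qed.

Lemma usol_inside_bounds x : p < x -> x < q -> 0 <= usol_inside x <= 1.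
Proof.
move=> px xq; have B0 := betaR_gt0 b0 b1.
have x1 : 0 < x - p by lra.
have x2 : 0 < q - x by lra.
rewrite /usol_inside !mulr_ge0 ?powR_ge0 ?poisson_mass_ge0 ?invr_ge0 ?(ltW B0) ?(ltW xq)//=.
have := poisson_int_le px xq; rewrite poisson_int_fin// lee_fin => h.
rewrite mulrC ler_pdivrMr// mul1r (powRM _ (ltW x1) (ltW x2)).
have X0 : 0 < (x - p) `^ b * (q - x) `^ b by rewrite mulr_gt0 ?powR_gt0.
apply: (le_trans (ler_wpM2l (ltW X0) h)).
by rewrite mulrA mulfV ?mul1r// gt_eqF.
Qed.

Lemma usol_bounds x : 0 <= usol x <= 1.
Proof.
have [xp|px] := leP x p; first by rewrite usol_left// lexx ler01.
have [xe|ex] := ltP x e; last by rewrite usol_right// lexx ler01.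
have [qx|xq] := leP q x; first by rewrite usol_one// ler01 lexx.
by rewrite usol_in// usol_inside_bounds.
Qed.

End poisson_integral.

Section tonelli.
Context {R : realType}.
Notation mu := (@lebesgue_measure R).
Local Open Scope ereal_scope.

(** Extension by 0 outside the product reduces this to Tonelli's theorem on the
plane. *)
Lemma tonelli_on (D1 D2 : set (measurableTypeR R)) (F : R * R -> R) :
  measurable D1 -> measurable D2 ->
  measurable_fun [set: measurableTypeR R * measurableTypeR R] F ->
  (forall z y, D1 z -> D2 y -> (0 <= F (z, y))%R) ->
  \int[mu]_(z in D1) \int[mu]_(y in D2) (F (z, y))%:E =
  \int[mu]_(y in D2) \int[mu]_(z in D1) (F (z, y))%:E.
Proof.
move=> m1 m2 mF F0.
pose G := (EFin \o F) \_ (D1 `*` D2).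
have mG : measurable_fun [set: measurableTypeR R * measurableTypeR R] G.
  apply/(measurable_restrictT _ _).1; first exact: measurableX.
  by apply: measurable_funS (measurableT_comp _ mF).
have G0 zy : 0 <= G zy.
  by rewrite /G patchE; case: ifPn => // /set_mem; case: zy => z y [/= ? ?]; rewrite lee_fin F0.
have E1 : \int[mu]_(z in D1) \int[mu]_(y in D2) (F (z, y))%:E = \int[mu]_z \int[mu]_y G (z, y).
  rewrite integral_mkcond; apply: eq_integral => z _; rewrite patchE.
  case: ifPn => zD.
    rewrite integral_mkcond; apply: eq_integral => y _; rewrite patchE /G patchE.
    by rewrite in_setX/= zD.
  rewrite -[LHS](integral0 mu setT); apply: eq_integral => y _.
  by rewrite /G patchE in_setX/= (negbTE zD).
have E2 : \int[mu]_(y in D2) \int[mu]_(z in D1) (F (z, y))%:E = \int[mu]_y \int[mu]_z G (z, y).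
  rewrite integral_mkcond; apply: eq_integral => y _; rewrite patchE.
  case: ifPn => yD.
    rewrite integral_mkcond; apply: eq_integral => z _; rewrite patchE /G patchE.
    by rewrite in_setX/= yD andbT.
  rewrite -[LHS](integral0 mu setT); apply: eq_integral => z _.
  by rewrite /G patchE in_setX/= (negbTE yD) andbF.
by rewrite E1 E2; apply: fubini_tonelli.
Qed.

Lemma measurable_tonelli_on (D1 D2 : set (measurableTypeR R)) (F : R * R -> R) :
  measurable D1 -> measurable D2 ->
  measurable_fun [set: measurableTypeR R * measurableTypeR R] F ->
  (forall z y, D1 z -> D2 y -> (0 <= F (z, y))%R) ->
  measurable_fun D2 (fun y => \int[mu]_(z in D1) (F (z, y))%:E).
Proof.
move=> m1 m2 mF F0.
pose G := (EFin \o F) \_ (D1 `*` D2).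
have mG : measurable_fun [set: measurableTypeR R * measurableTypeR R] G.
  apply/(measurable_restrictT _ _).1; first exact: measurableX.
  by apply: measurable_funS (measurableT_comp _ mF).
have G0 zy : 0 <= G zy.
  by rewrite /G patchE; case: ifPn => // /set_mem; case: zy => z y [/= ? ?]; rewrite lee_fin F0.
have := @measurable_fun_fubini_tonelli_G _ _ _ _ _ mu G mG G0.
move=> /(measurable_funS measurableT (@subsetT _ D2)).
apply: eq_measurable_fun => y yD; rewrite /fubini_G [RHS]integral_mkcond.
apply: eq_integral => z _; rewrite patchE /G patchE in_setX/= yD andbT.
by case: ifPn.
Qed.

End tonelli.

Section poisson_regularity.
Context {R : realType}.
Variables (b p q e : R).
Hypotheses (b0 : 0 < b) (b1 : b < 1) (pq : p < q) (qe : q < e).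
Notation PInt := (poisson_int b p q e).
Notation poisson_mass := (poisson_mass b p q e).
Notation usol_inside := (usol_inside b p q e).
Notation usol := (usol b p q e).

(** A Harnack inequality read off from the integrand, whose only dependence on x is
1 / (y - x); with c = 1 + O(|x - x'|) it gives Lipschitz regularity. *)
Lemma poisson_int_ratio (x x' c : R) : x < q -> x' < q -> 0 <= c ->
  (forall y, q < y -> y - x <= c * (y - x')) -> (PInt x' <= c%:E * PInt x)%E.
Proof.
move=> xq x'q c0 h; rewrite /poisson_int -ge0_integralZl//; first last.
- by move=> y /=; rewrite in_itv/= => /andP[y1 y2]; rewrite lee_fin divr_ge0 ?powR_ge0//; lra.
- exact: measurable_poisson.
apply: ge0_le_integral => //.
- by move=> y /=; rewrite in_itv/= => /andP[y1 y2]; rewrite lee_fin divr_ge0 ?powR_ge0//; lra.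
- exact: measurable_poisson.
- by apply: measurable_funeM; exact: measurable_poisson.
move=> y /=; rewrite in_itv/= => /andP[y1 y2]; rewrite -EFinM lee_fin mulrCA.
have z1 : 0 < y - x by lra.
have z2 : 0 < y - x' by lra.
rewrite ler_wpM2l ?powR_ge0// ler_pdivlMr// mulrC ler_pdivrMr//.
exact: h.
Qed.

Lemma poisson_mass_lipschitz (x : R) : p < x -> x < q -> locally_lipschitz poisson_mass x.
Proof.
move=> px xq; have pq' := pq.
have [A AE A0] : exists2 A, A = q - x & 0 < A by exists (q - x); rewrite ?subr_gt0.
have m0 : 0 <= poisson_mass x by apply: poisson_mass_ge0 => //; exact: ltW.
(* |z| < A / 2 keeps every y - (x + z) above A / 2, so that the ratio c is at most 2 *)
exists (Num.min (A / 2) (x - p)), (4 * poisson_mass x / A); split.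
- by rewrite lt_min divr_gt0//= subr_gt0.
- by rewrite divr_ge0 ?mulr_ge0// ltW.
move=> z; rewrite lt_min => /andP[zA zp].
have /andP[zp1 zp2] : - (x - p) < z < x - p by rewrite -ltr_norml.
have /andP[zA1 zA2] : - (A / 2) < z < A / 2 by rewrite -ltr_norml.
have px' : p < x + z by lra.
have xq' : x + z < q by lra.
pose c := 1 + 2 * `|z| / A.
have zn : z <= `|z| by exact: ler_norm.
have zn' : - z <= `|z| by rewrite -normrN ler_norm.
have z0 : 0 <= `|z| by [].
have c1 : 1 <= c by rewrite /c lerDl divr_ge0 ?mulr_ge0// ltW.
have c2 : c <= 2.
  rewrite /c (_ : 2 = 1 + 1 :> R)// lerD2l ler_pdivrMr// mul1r; lra.
have cA : (c - 1) * A = 2 * `|z| by rewrite /c; field; rewrite gt_eqF.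
have h1 y : q < y -> y - x <= c * (y - (x + z)).
  move=> qy; have : 2 * `|z| / A * (A / 2) <= 2 * `|z| / A * (y - (x + z)).
    by rewrite ler_wpM2l ?divr_ge0 ?mulr_ge0 ?(ltW A0)//; lra.
  rewrite (_ : 2 * `|z| / A * (A / 2) = `|z|); last by field; rewrite gt_eqF.
  by rewrite /c mulrDl mul1r; lra.
have h2 y : q < y -> y - (x + z) <= c * (y - x).
  move=> qy; have : 2 * `|z| / A * A <= 2 * `|z| / A * (y - x).
    by rewrite ler_wpM2l ?divr_ge0 ?mulr_ge0 ?(ltW A0)//; lra.
  rewrite divfK ?gt_eqF//.
  by rewrite /c mulrDl mul1r; lra.
have c0 : 0 <= c by lra.
have r1 := poisson_int_ratio xq xq' c0 h1.
have r2 := poisson_int_ratio xq' xq c0 h2.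
move: r1 r2; rewrite !poisson_int_fin// -!EFinM !lee_fin => r1 r2.
have m1 : 0 <= poisson_mass (x + z) by apply: poisson_mass_ge0 => //; exact: ltW.
set m := poisson_mass x in m0 r1 r2 *; set m' := poisson_mass (x + z) in r1 r2 m1 *.
rewrite (_ : 4 * m / A * `|z| = (c - 1) * (2 * m)); last first.
  by rewrite /c; field; rewrite gt_eqF.
rewrite ler_norml; clearbody c m m'; apply/andP; split; nra.
Qed.

Lemma usol_lipschitz (x : R) : p < x -> x < q -> locally_lipschitz usol x.
Proof.
move=> px xq; have pq' := pq; apply: (@locally_lipschitz_near _ usol_inside).
  near=> y; have /andP[y1 y2] : p < y < q by near: y; exact: near_itv.
  by rewrite usol_in.
apply: (@locally_lipschitz_mul _ (fun=> _)); first exact: locally_lipschitz_cst.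
apply: locally_lipschitz_mul; last exact: poisson_mass_lipschitz.
apply: has_deriv_lipschitz; deriv.
by rewrite mulr_gt0// subr_gt0.
Unshelve. all: by end_near. Qed.

Lemma measurable_usol : measurable_fun [set: R] usol.
Proof.
have mI : measurable (`]p, q[%classic : set R) by [].
apply: mfun_add.
  apply: (measurable_restrictT usol_inside mI).1.
  apply: open_continuous_measurable_fun => // x; rewrite inE/= in_itv/= => /andP[px xq].
  apply: locally_lipschitz_continuous; apply: (@locally_lipschitz_near _ usol); last exact: usol_lipschitz.
  near=> y; have /andP[y1 y2] : p < y < q by near: y; exact: near_itv.
  by rewrite usol_in.
exact: measurable_indic.
Unshelve. all: by end_near. Qed.

End poisson_regularity.

Section poisson_harmonic.
Context {R : realType}.
Notation mu := (@lebesgue_measure R).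
Variables (b p q e : R).
Hypotheses (b0 : 0 < b) (b1 : b < 1) (pq : p < q) (qe : q < e).
Notation Dens := (poisson_density b p q).
Notation usol_inside := (usol_inside b p q e).
Notation usol := (usol b p q e).

Definition poisson_kernel (x y : R) : R :=
  (betaR b)^-1 * (((x - p) * (q - x)) `^ b * (Dens y / (y - x))).

Lemma poisson_kernel_ge0 x y : x < y -> 0 <= poisson_kernel x y.
Proof.
move=> xy; rewrite /poisson_kernel mulr_ge0 ?invr_ge0 ?(ltW (betaR_gt0 b0 b1))//.
by rewrite mulr_ge0 ?powR_ge0// divr_ge0 ?powR_ge0// subr_ge0 ltW.
Qed.

Lemma usol_inside_integral (x : R) : p < x -> x < q ->
  ((usol_inside x)%:E = \int[mu]_(y in `]q, e[) (poisson_kernel x y)%:E)%E.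
Proof.
move=> px xq; rewrite /usol_inside mulrA EFinM -poisson_int_fin// /poisson_int -ge0_integralZl//; first last.
- by rewrite lee_fin mulr_ge0 ?powR_ge0// invr_ge0 ltW// betaR_gt0.
- by move=> y /=; rewrite in_itv/= => /andP[y1 y2]; rewrite lee_fin divr_ge0 ?powR_ge0//; lra.
- exact: measurable_poisson.
by apply: eq_integral => y _; rewrite -EFinM /poisson_kernel -mulrA.
Qed.

(** The integrand of the double integral, as a function of the pair (z, y). *)
Definition weighted_kernel (g : R -> R) (zy : R * R) : R :=
  poisson_kernel (g zy.1) zy.2 * zy.1 `^ (- 1 - 2 * b).

Lemma measurable_weighted_kernel (g : R -> R) : measurable_fun [set: R] g ->
  measurable_fun [set: measurableTypeR R * measurableTypeR R] (weighted_kernel g).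
Proof.
move=> mg; rewrite /weighted_kernel /poisson_kernel /poisson_density.
have mg1 : measurable_fun [set: measurableTypeR R * measurableTypeR R] (fun zy => g zy.1).
  exact: (measurableT_comp mg measurable_fst).
by mfun.
Qed.

Lemma usol_inside_branch (g : R -> R) (c K : R) : 0 < c -> measurable_fun [set: R] g ->
  (forall z, c < z -> z < K -> p < g z < q) ->
  (\int[mu]_(z in `]c, K[) (usol_inside (g z) * z `^ (- 1 - 2 * b))%:E =
   \int[mu]_(y in `]q, e[) \int[mu]_(z in `]c, K[) (weighted_kernel g (z, y))%:E)%E.
Proof.
move=> c0 mg gpq; rewrite -tonelli_on//; last 2 first.
- exact: measurable_weighted_kernel.
- move=> z y /=; rewrite !in_itv/= => /andP[z1 z2] /andP[y1 y2].
  have /andP[g1 g2] := gpq _ z1 z2.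
  by rewrite mulr_ge0 ?powR_ge0// poisson_kernel_ge0// (lt_trans g2).
apply: eq_integral => z; rewrite inE/= in_itv/= => /andP[z1 z2].
have /andP[g1 g2] := gpq _ z1 z2.
rewrite mulrC EFinM usol_inside_integral// -ge0_integralZl//; first last.
- by rewrite lee_fin powR_ge0.
- by move=> y /=; rewrite in_itv/= => /andP[y1 y2]; rewrite lee_fin poisson_kernel_ge0// (lt_trans g2).
- by rewrite /poisson_kernel /poisson_density; mfun.
by apply: eq_integral => y _; rewrite -EFinM mulrC.
Qed.

(** The matched tails of u are integrals over the pole y of the left-hand side of
[kernel_tails]: inside (p, q) by Tonelli's theorem, and outside because u is 1
on [q, e), which supplies exactly the term (y - x)^(-1-2b). *)
Lemma usol_balanced (x : R) : p < x -> x < q -> balanced b usol x (q - x) (x - p).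
Proof.
move=> px xq s s0 s1; cbv zeta.
have [pq' qe'] := conj pq qe.
have A0 : 0 < q - x by rewrite subr_gt0.
have C0 : 0 < x - p by rewrite subr_gt0.
have B0 := betaR_gt0 b0 b1.
rewrite (@tails_branches _ _ _ (fun z => usol_inside (x + z)))//; first last.
- by move=> z; rewrite in_itv/= => /andP[z1 z2]; rewrite usol_in//; lra.
- by move=> z; have /andP[] := usol_bounds b0 b1 pq qe z.
- exact: measurable_usol.
have -> : ltail b usol x (x - p) = 0%E.
  by rewrite /ltail tail_eq0// => z z0; rewrite usol_left//; lra.
have [/andP[l1 l2] /andP[l3 l4]] := cut_lt A0 C0 s0 s1.
have -> : rtail b usol x (q - x) = (\int[mu]_(y in `]q, e[) ((y - x) `^ (- 1 - 2 * b))%:E)%E.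
  rewrite /rtail (@tail_split _ _ _ (q - x) (e - x))//; last 3 first.
  - by lra.
  - by apply: measurable_shift; exact: measurable_usol.
  - by move=> z; have /andP[] := usol_bounds b0 b1 pq qe (x + z).
  rewrite tail_eq0 ?adde0; last by move=> z z0; rewrite usol_right//; lra.
  have := @integral_shift_oo _ (fun y => (y - x) `^ (- 1 - 2 * b)) x (q - x) (e - x).
  rewrite !(addrC x) !subrK => ->; first last.
  - by move=> y _; rewrite powR_ge0.
  - by move=> y; rewrite in_itv/= => /andP[y1 y2]; cont; lra.
  - by lra.
  apply: eq_integral => z; rewrite inE/= in_itv/= => /andP[z1 z2].
  by rewrite (addrC x) addrK usol_one ?mul1r//; lra.
rewrite adde0 /branch_tails.
set e1 := cut_scale _ _ * s / (1 + _) in l1 l2 *; set e2 := cut_scale _ _ * s / (1 - _) in l3 l4 *.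
have m1 : measurable_fun [set: R] (fun z => x + z) by mfun.
have m2 : measurable_fun [set: R] (fun z => x - z) by mfun.
pose N1 (y : R) := (\int[mu]_(z in `]e1, (q - x)%R[) (weighted_kernel (fun z => x + z)%R (z, y))%:E)%E.
pose N2 (y : R) := (\int[mu]_(z in `]e2, (x - p)%R[) (weighted_kernel (fun z => x - z)%R (z, y))%:E)%E.
rewrite (_ : (\int[mu]_(z in `]e1, _[) _)%E = (\int[mu]_(y in `]q, e[) N1 y)%E); last first.
  by apply: usol_inside_branch => // z z1 z2; apply/andP; split; lra.
rewrite (_ : (\int[mu]_(z in `]e2, _[) _)%E = (\int[mu]_(y in `]q, e[) N2 y)%E); last first.
  by apply: (@usol_inside_branch (fun z => x - z)) => // z z1 z2; apply/andP; split; lra.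
have cell_ge0 (g : R -> R) (c K : R) : (forall z, c < z -> z < K -> p < g z < q) ->
    forall z y, `]c, K[%classic z -> `]q, e[%classic y -> (0 <= weighted_kernel g (z, y)).
  move=> gpq z y /=; rewrite !in_itv/= => /andP[z1 z2] /andP[y1 y2].
  have /andP[g1 g2] := gpq _ z1 z2.
  by rewrite mulr_ge0 ?powR_ge0// poisson_kernel_ge0// (lt_trans g2).
have c1 := @cell_ge0 (fun z => x + z) e1 (q - x).
have c2 := @cell_ge0 (fun z => x - z) e2 (x - p).
have {}c1 := c1 ltac:(by move=> z z1 z2; apply/andP; split; lra).
have {}c2 := c2 ltac:(by move=> z z1 z2; apply/andP; split; lra).
have n1 (y : R) : y \in `]q, e[ -> (0 <= N1 y)%E.
  by move=> yq; apply: integral_ge0 => z zI; rewrite lee_fin c1.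
have n2 (y : R) : y \in `]q, e[ -> (0 <= N2 y)%E.
  by move=> yq; apply: integral_ge0 => z zI; rewrite lee_fin c2.
have f1 : measurable_fun `]q, e[ N1.
  by apply: measurable_tonelli_on => //; exact: measurable_weighted_kernel.
have f2 : measurable_fun `]q, e[ N2.
  by apply: measurable_tonelli_on => //; exact: measurable_weighted_kernel.
have f3 : measurable_fun `]q, e[ (fun y => ((y - x) `^ (- 1 - 2 * b))%:E) by mfun.
rewrite -ge0_integralD => [|//|//|//|//|//].
rewrite -ge0_integralD => [|//| | | |//]; last 3 first.
- by move=> y /= yq; rewrite adde_ge0 ?n1 ?n2.
- exact: emeasurable_funD.
- by move=> y _; rewrite lee_fin powR_ge0.
pose k := cut_scale (q - x) (x - p); pose c := (k `^ b) ^- 2.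
set w := s ^+ 2 / (1 - s ^+ 2).
have key (y : R) : y \in `]q, e[ ->
  ((poisson_kernel x y * (c * (w `^ (- b) / b)))%:E <= N1 y + N2 y + ((y - x) `^ (- 1 - 2 * b))%:E)%E /\
  (N1 y + N2 y + ((y - x) `^ (- 1 - 2 * b))%:E <=
   (poisson_kernel x y * (c * (w `^ (- b) / b + w `^ (1 - b) / (1 - b))))%:E)%E.
  rewrite in_itv/= => /andP[y1 y2].
  have AY : q - x < y - x by lra.
  have Y0 : 0 < y - x by lra.
  pose D := Dens y / betaR b.
  have D0 : 0 <= D by rewrite divr_ge0 ?powR_ge0// ltW.
  have := kernel_tails b0 b1 A0 C0 AY s0 s1; cbv zeta.
  rewrite /branch_tails -/e1 -/e2 -/w -/k -/c.
  have cellE (g : R -> R) z : weighted_kernel g (z, y) =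
      D * (((q - g z) * (g z - p)) `^ b / (y - g z) * z `^ (- 1 - 2 * b)).
    by rewrite /weighted_kernel /poisson_kernel /D /= [(g z - p) * _]mulrC; ring.
  have E1 : N1 y = (D%:E * \int[mu]_(z in `]e1, (q - x)%R[)
      ((((q - x - z) * (x - p + z)) `^ b / (y - x - z))%R * z `^ (- 1 - 2 * b))%:E)%E.
    rewrite -ge0_integralZl//; last 2 first.
    - by mfun.
    - move=> z /=; rewrite in_itv/= => /andP[z1 z2].
      by rewrite lee_fin mulr_ge0 ?powR_ge0// divr_ge0 ?powR_ge0//; lra.
    apply: eq_integral => z _; rewrite cellE -EFinM.
    by congr (_ * (_ `^ _ / _ * _))%:E; ring.
  have E2 : N2 y = (D%:E * \int[mu]_(z in `]e2, (x - p)%R[)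
      ((((q - x - (- z)) * (x - p + (- z))) `^ b / (y - x - (- z)))%R * z `^ (- 1 - 2 * b))%:E)%E.
    rewrite -ge0_integralZl//; last 2 first.
    - by mfun.
    - move=> z /=; rewrite in_itv/= => /andP[z1 z2].
      by rewrite lee_fin mulr_ge0 ?powR_ge0// divr_ge0 ?powR_ge0//; lra.
    apply: eq_integral => z _; rewrite cellE -EFinM.
    by congr (_ * (_ `^ _ / _ * _))%:E; ring.
  set J1 := (\int[mu]_(z in `]e1, _[) _)%E in E1 *.
  set J2 := (\int[mu]_(z in `]e2, _[) _)%E in E2 *.
  have J10 : (0 <= J1)%E.
    apply: integral_ge0 => z /=; rewrite in_itv/= => /andP[z1 z2].
    by rewrite lee_fin mulr_ge0 ?powR_ge0// divr_ge0 ?powR_ge0//; lra.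
  have J20 : (0 <= J2)%E.
    apply: integral_ge0 => z /=; rewrite in_itv/= => /andP[z1 z2].
    by rewrite lee_fin mulr_ge0 ?powR_ge0// divr_ge0 ?powR_ge0//; lra.
  have E3 : (y - x) `^ (- 1 - 2 * b) =
      D * (betaR b * ((y - x - (q - x)) * (y - x + (x - p))) `^ b * (y - x) `^ (- 1 - 2 * b)).
    have -> : (y - x - (q - x)) * (y - x + (x - p)) = (y - p) * (y - q) by ring.
    have yy : 0 < (y - p) * (y - q) by rewrite mulr_gt0//; lra.
    rewrite /D /poisson_density powRN; have := powR_gt0 b yy; set X := _ `^ b => X0.
    by field; rewrite !gt_eqF.
  have PE t : poisson_kernel x y * (c * t) = D * (((q - x) * (x - p)) `^ b / (y - x) * c * t).
    by rewrite /poisson_kernel /D [(x - p) * _]mulrC; ring.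
  set X := betaR b * _ * _ in E3 *.
  have X0 : (0 <= X%:E)%E.
    by rewrite lee_fin !mulr_ge0 ?powR_ge0// ltW.
  have -> : ((y - x) `^ (- 1 - 2 * b))%:E = (D%:E * X%:E)%E by rewrite -EFinM -E3.
  have J12 : (0 <= J1 + J2)%E by exact: adde_ge0.
  clearbody J1 J2 D X; move=> [k1 k2]; rewrite E1 E2.
  rewrite -(ge0_muleDr _ J10 J20) -(ge0_muleDr _ J12 X0).
  by split; rewrite PE EFinM; apply: lee_wpmul2l; rewrite ?lee_fin.
have int_c (t : R) : 0 <= t -> (\int[mu]_(y in `]q, e[) (poisson_kernel x y * (c * t))%:E = (usol x * c * t)%:E)%E.
  move=> t0; under eq_integral do rewrite EFinM muleC.
  rewrite ge0_integralZl//; last 3 first.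
  - by rewrite /poisson_kernel /poisson_density; mfun.
  - move=> v /=; rewrite in_itv/= => /andP[v1 v2].
    by rewrite lee_fin poisson_kernel_ge0//; lra.
  - by rewrite lee_fin mulr_ge0// invr_ge0 sqr_ge0.
  by rewrite -usol_inside_integral// usol_in// -EFinM mulrC mulrA.
have w0 : 0 < w by rewrite divr_gt0 ?exprn_gt0//; nra.
have t1 : 0 <= w `^ (- b) / b by rewrite divr_ge0 ?powR_ge0// ltW.
have t2 : 0 <= w `^ (- b) / b + w `^ (1 - b) / (1 - b).
  by rewrite addr_ge0// divr_ge0 ?powR_ge0// subr_ge0 ltW.
have c0 : 0 <= c by rewrite invr_ge0 sqr_ge0.
have mS : measurable_fun `]q, e[ (fun y => N1 y + N2 y + ((y - x) `^ (- 1 - 2 * b))%:E)%E.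
  by apply: emeasurable_funD => //; exact: emeasurable_funD.
have S0 (v : R) : v \in `]q, e[ -> (0 <= N1 v + N2 v + ((v - x) `^ (- 1 - 2 * b))%:E)%E.
  move=> vq; apply: adde_ge0; last by rewrite lee_fin powR_ge0.
  by apply: adde_ge0; [exact: n1|exact: n2].
rewrite -(int_c _ t1) -(int_c _ t2); split; apply: ge0_le_integral => //.
- move=> v /=; rewrite in_itv/= => /andP[v1 v2].
  by rewrite lee_fin; apply: mulr_ge0; [apply: poisson_kernel_ge0; lra|exact: mulr_ge0].
- by rewrite /poisson_kernel /poisson_density; mfun.
- by move=> v yq; have [] := key v yq.
- by rewrite /poisson_kernel /poisson_density; mfun.
- by move=> v yq; have [] := key v yq.
Qed.

End poisson_harmonic.

(** * The comparison principle *)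

Section interior_maximum.
Context {R : realType}.
Notation mu := (@lebesgue_measure R).

(** Positivity needs finiteness of the integral, since [fine] sends +oo to 0; the
bound exp t >= t^2 / 2 is enough for s < 2. *)
Lemma Gamma_gt0 (s : R) : 0 < s -> s < 2 -> 0 < Gamma s.
Proof.
move=> s0 s2; rewrite /Gamma /Rintegral.
have s1 : s - 1 - 2 = - 1 - (2 - s) by ring.
have ge0 (t : R) : (0 <= (t `^ (s - 1) * expR (- t))%:E)%E.
  by rewrite lee_fin mulr_ge0 ?powR_ge0// expR_ge0.
have mf (D : set R) : measurable_fun D (fun t => (t `^ (s - 1) * expR (- t))%:E).
  apply: mfun_EFin; apply: mfun_mul; first by mfun.
  apply: (@measurable_funS _ _ _ _ setT) => //.
  by apply: (measurableT_comp (@measurable_expR R)); mfun.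
have fin : (\int[mu]_(t in `]0%R, +oo[) (t `^ (s - 1) * expR (- t))%:E < +oo)%E.
  rewrite (@ge0_integral_split _ _ 0 1)//.
  apply: (@le_lt_trans _ _ (\int[mu]_(t in `]0%R, 1%R[) (t `^ (s - 1))%:E +
     \int[mu]_(t in `]1%R, +oo[) (2 * t `^ (- 1 - (2 - s)))%:E)%E).
    apply: leeD; apply: ge0_le_integral => //; try (exact: mf); try by mfun.
    - move=> t /=; rewrite in_itv/= => /andP[t0 t1]; rewrite lee_fin.
      by rewrite ler_piMr ?powR_ge0// expR_le1 oppr_le0 ltW.
    - move=> t /=; rewrite in_itv/= andbT => t1; rewrite lee_fin.
      have t0 : 0 < t by lra.
      rewrite -s1 [X in _ <= _ * X]powRB ?(gt_eqF t0) ?implybT// powR_mulrn ?(ltW t0)// mulrCA.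
      rewrite ler_wpM2l ?powR_ge0// expRN -[leRHS]invrK lef_pV2 ?posrE ?expR_gt0//; last first.
        by rewrite invr_gt0 divr_gt0// exprn_gt0.
      rewrite invf_div; have := expR_ge1Dxn 1 (ltW t0).
      by rewrite (_ : (1.+1)`! = 2)%N//; apply: le_trans; rewrite lerDr.
  rewrite integral_powR_head//.
  under eq_integral do rewrite EFinM.
  rewrite ge0_integralZl//; last 2 first.
  - by mfun.
  - by move=> t _; rewrite lee_fin powR_ge0.
  by rewrite integral_powR_tail ?subr_gt0// -EFinM -EFinD ltry.
apply: fine_gt0; rewrite fin andbT.
apply: (@lt_le_trans _ _ (\int[mu]_(t in `]1%R, 2%R[) (2^-1 * expR (- 2))%:E)%E).
  rewrite (integral_cst _ _ (2^-1 * expR (- 2))%:E)//= lebesgue_measure_itv/= lte_fin.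
  rewrite ltr1n -EFinB lte_fin; apply: mulr_gt0; last lra.
  by rewrite mulr_gt0 ?expR_gt0.
apply: (@le_trans _ _ (\int[mu]_(t in `]1%R, 2%R[) (t `^ (s - 1) * expR (- t))%:E)%E).
  apply: ge0_le_integral => //=; try (exact: mf).
  move=> t; rewrite in_itv/= => /andP[t1 t2]; rewrite lee_fin; apply: ler_pM => //.
  - apply: (@le_trans _ _ (t `^ (- 1))); last by apply: ler_powR; lra.
    by rewrite powR_inv1; [rewrite lef_pV2 ?posrE; lra|lra].
  - by rewrite ler_expR lerN2 ltW.
apply: ge0_subset_integral => //; try (exact: mf).
by move=> t /=; rewrite !in_itv/= andbT => /andP[t1 _]; lra.
Qed.

Lemma frac_lap_const_neq0 (b : R) : 0 < b -> b < 1 -> frac_lap_const (2 * b) != 0.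
Proof.
move=> b0 b1; rewrite gt_eqF// /frac_lap_const divr_gt0//.
  by rewrite !mulr_gt0 ?powR_gt0// Gamma_gt0; lra.
by rewrite mulr_gt0 ?powR_gt0 ?pi_gt0// Gamma_gt0; lra.
Qed.

Variable b : R.
Hypotheses (b0 : 0 < b) (b1 : b < 1).

(** The normalizing constant is nonzero, so it can be divided out. *)
Lemma frac_lap_trunc_diff (f : R -> R) x : is_frac_lap (2 * b) f x 0 ->
  trunc_diff b f x e @[e --> 0^'+] --> (0 : R).
Proof.
move=> h; have c0 := frac_lap_const_neq0 b0 b1.
suff : (frac_lap_const (2 * b))^-1 * frac_lap_trunc (2 * b) f x e @[e --> 0^'+] -->
    (frac_lap_const (2 * b))^-1 * 0.
  rewrite mulr0; apply: cvg_trans; apply: near_eq_cvg; near=> e.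
  by rewrite /frac_lap_trunc mulrA mulVf// mul1r.
by apply: cvgM => //; exact: cvg_cst.
Unshelve. all: by end_near. Qed.

Lemma tail_le1_lty (g : R -> R) (e : R) : 0 < e -> measurable_fun [set: R] g ->
  (forall z, 0 <= g z <= 1) -> (tail b g e < +oo)%E.
Proof.
move=> e0 mg g1; apply: (@le_lt_trans _ _ (tail b (fun=> 1) e)).
  apply: ge0_le_integral => //.
  - by move=> z _; have /andP[h _] := g1 z; rewrite lee_fin mulr_ge0// powR_ge0.
  - exact: measurable_tail.
  - exact: measurable_tail.
  - by move=> z _; have /andP[_ h] := g1 z; rewrite lee_fin ler_wpM2r// powR_ge0.
by rewrite tail_cst// ltry.
Qed.

Definition dquot (f : R -> R) (x z : R) : R := (f (x + z) - f x) / `|z| `^ (1 + 2 * b).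

Variables (p q : R).
Hypothesis pq : p < q.

(** At a maximum the integrand F x - F (x + z) is nonnegative, and for |z| > q - p
the point x + z lies outside (p, q), where F <= 0, so the integral stays above
a positive constant as the truncation shrinks. But F is a combination of three
functions with vanishing fractional Laplacian at x. *)
Lemma interior_max_contra (f g : R -> R) (eta x : R) : 0 < eta -> p < x -> x < q ->
  measurable_fun [set: R] f -> measurable_fun [set: R] g ->
  (forall z, 0 <= f z <= 1) -> (forall z, 0 <= g z <= 1) ->
  (forall y, ~~ (p < y < q) -> f y <= g y) ->
  is_frac_lap (2 * b) f x 0 -> is_frac_lap (2 * b) g x 0 ->
  let F y := f y - g y - eta * barrier b p q y in
  0 < F x -> (forall y, F y <= F x) -> False.
Proof.
move=> eta0 px xq mf mg f1 g1 fg lf lg F Fx Fmax.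
have A0 : 0 < q - x by rewrite subr_gt0.
have C0 : 0 < x - p by rewrite subr_gt0.
pose h := barrier b p q.
have h0 := barrier_ge0 b p q.
have mh := measurable_barrier b p q.
have bal := barrier_balanced b0 b1 px xq.
have lh : is_frac_lap (2 * b) h x 0.
  apply: (balanced_frac_lap b0 b1 A0 C0) => //; exact: barrier_lipschitz.
have tf := frac_lap_trunc_diff lf; have tg := frac_lap_trunc_diff lg; have th := frac_lap_trunc_diff lh.
have f0 z : 0 <= f z by have /andP[] := f1 z.
have g0 z : 0 <= g z by have /andP[] := g1 z.
pose D := q - p; have D0 : 0 < D by rewrite subr_gt0.
(* [K] is the integral of F x * |z|^(-1-2b) over |z| > q - p *)
pose K := 2 * (F x * one_tail b D).
have K0 : 0 < K by rewrite /K /one_tail !mulr_gt0// ?powR_gt0// invr_gt0 mulr_gt0.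
have cT : eta * trunc_diff b h x e + trunc_diff b g x e - trunc_diff b f x e @[e --> 0^'+] --> (0 : R).
  suff : eta * trunc_diff b h x e + trunc_diff b g x e - trunc_diff b f x e @[e --> 0^'+] --> (eta * 0 + 0 - 0 : R).
    by rewrite mulr0 addr0 subr0.
  by apply: cvgB => //; apply: cvgD => //; apply: cvgM => //; exact: cvg_cst.
have bound e : 0 < e -> e < D -> K <= eta * trunc_diff b h x e + trunc_diff b g x e - trunc_diff b f x e.
  move=> e0 eD.
  have If : mu.-integrable (far e) (fun z => (dquot f x z)%:E).
    by apply: integrable_diff_quotient => //; apply: tail_le1_lty => //;
      [exact: measurable_shift|exact: measurable_shiftN].
  have Ig : mu.-integrable (far e) (fun z => (dquot g x z)%:E).
    by apply: integrable_diff_quotient => //; apply: tail_le1_lty => //;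
      [exact: measurable_shift|exact: measurable_shiftN].
  have Ih : mu.-integrable (far e) (fun z => (dquot h x z)%:E).
    have [r l] := balanced_tails_lty A0 C0 mh h0 bal e0.
    exact: (integrable_diff_quotient b0 e0 mh h0 r l).
  have mD := measurable_far e.
  have Ih_eta : mu.-integrable (far e) (fun z => (eta * dquot h x z)%:E).
    by have := integrableZl mD eta Ih; apply: eq_integrable.
  have Is : mu.-integrable (far e) (fun z => (eta * dquot h x z + dquot g x z)%:E).
    by have := integrableD mD Ih_eta Ig; apply: eq_integrable.
  have E : eta * trunc_diff b h x e + trunc_diff b g x e - trunc_diff b f x e =
     \int[mu]_(z in far e) (eta * dquot h x z + dquot g x z - dquot f x z).
    by rewrite RintegralB// RintegralD// RintegralZl.
  have IG : mu.-integrable (far e) (fun z => (eta * dquot h x z + dquot g x z - dquot f x z)%:E).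
    by have := integrableB mD Is If; apply: eq_integrable.
  have GE z : eta * dquot h x z + dquot g x z - dquot f x z =
      (F x - F (x + z)) * weight b z.
    rewrite /dquot /weight /F /h (_ : - 1 - 2 * b = - (1 + 2 * b)); last by ring.
    by rewrite powRN; ring.
  have Gge0 z : (0 <= (eta * dquot h x z + dquot g x z - dquot f x z)%:E)%E.
    by rewrite lee_fin GE mulr_ge0 ?powR_ge0// subr_ge0.
  rewrite E -lee_fin /Rintegral fineK; last exact: integrable_fin_num.
  have <- : (\int[mu]_(z in far D) (F x * weight b z)%:E = K%:E)%E.
    rewrite (@integral_two_tails _ b (fun=> F x) x)//; last by move=> _; exact: ltW.
    by rewrite /rtail /ltail !tail_cst ?(ltW Fx)// -EFinD /K /one_tail; congr EFin; ring.
  have mG : measurable_fun (far e) (fun z => (eta * dquot h x z + dquot g x z - dquot f x z)%:E).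
    by case/integrableP : IG.
  have sub : far D `<=` far e by move=> z; exact: lt_trans.
  apply: (@le_trans _ _ (\int[mu]_(z in far D) (eta * dquot h x z + dquot g x z - dquot f x z)%:E)%E).
    apply: ge0_le_integral => //.
    - exact: measurable_far.
    - by move=> z _; rewrite lee_fin mulr_ge0 ?powR_ge0// ltW.
    - by apply: mfun_EFin; apply: mfun_mul; [exact: measurable_cst|exact: measurable_weight].
    - exact: measurable_funS mG.
    - move=> z; rewrite /far/= lter_normr => zD; rewrite lee_fin GE ler_wpM2r ?powR_ge0//.
      rewrite lerDl oppr_ge0.
      have out : ~~ (p < x + z < q) by apply/negP => /andP[]; move: zD => /orP[]; rewrite /D; lra.
      by rewrite /F barrier_out// mulr0 subr0 subr_le0 fg.
  by apply: ge0_subset_integral => //; exact: measurable_far.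
have : \forall e \near (0 : R)^'+, eta * trunc_diff b h x e + trunc_diff b g x e - trunc_diff b f x e < K.
  by apply: cvgr_lt cT _ K0.
move=> near_lt; near (0 : R)^'+ => e.
have : K <= eta * trunc_diff b h x e + trunc_diff b g x e - trunc_diff b f x e.
  apply: bound; first by near: e; exact: nbhs_right_gt.
  by near: e; exact: nbhs_right_lt.
by rewrite leNgt => /negP; apply; near: e.
Unshelve. all: by end_near. Qed.

End interior_maximum.

Section comparison_principle.
Context {R : realType}.
Variables (b p q : R).
Hypotheses (b0 : 0 < b) (b1 : b < 1) (pq : p < q).

Lemma barrier_blowup (eta : R) : 0 < eta -> exists2 d, 0 < d &
  forall x, p < x -> x < q -> x < p + d \/ q - d < x -> 1 <= eta * barrier b p q x.
Proof.
have pq' := pq; move=> eta0.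
have c0 : b - 1 != 0 by rewrite lt_eqF// subr_lt0.
pose P0 := eta^-1 `^ (b - 1)^-1.
have P00 : 0 < P0 by rewrite powR_gt0 ?invr_gt0.
have PE : P0 `^ (b - 1) = eta^-1 by rewrite powRVK// invr_gt0.
have L0 : 0 < q - p by rewrite subr_gt0.
(* within d of an endpoint, (x - p) (q - x) <= d (q - p) *)
exists (P0 / (q - p)); first by rewrite divr_gt0.
set d := P0 / _; have dE : d * (q - p) = P0 by rewrite /d divfK// gt_eqF.
clearbody d; move=> x px xq xd.
have x1 : 0 < x - p by rewrite subr_gt0.
have x2 : 0 < q - x by rewrite subr_gt0.
have xP : (x - p) * (q - x) <= P0 by rewrite -dE; case: xd => h; nra.
rewrite barrierE// -ler_pdivrMl// mulr1 -PE; clearbody P0.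
rewrite (_ : b - 1 = - (1 - b)); last by ring.
by apply: ler_powRN => //; rewrite ?mulr_gt0// subr_ge0 ltW.
Qed.

(** If f > g somewhere, subtract a multiple of the barrier small enough to keep the
difference positive there. The result is nonpositive near p and q, so it attains
a positive maximum on a compact subinterval. *)
Lemma frac_lap_comparison (f g : R -> R) :
  measurable_fun [set: R] f -> measurable_fun [set: R] g ->
  (forall z, 0 <= f z <= 1) -> (forall z, 0 <= g z <= 1) ->
  (forall y, ~~ (p < y < q) -> f y <= g y) ->
  (forall x, p < x -> x < q -> {for x, continuous f}) ->
  (forall x, p < x -> x < q -> {for x, continuous g}) ->
  (forall x, p < x -> x < q -> is_frac_lap (2 * b) f x 0) ->
  (forall x, p < x -> x < q -> is_frac_lap (2 * b) g x 0) ->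
  forall x, f x <= g x.
Proof.
move=> mf mg f1 g1 fg cf cg lf lg x0; rewrite leNgt; apply/negP => gf.
have [/andP[px0 x0q]|out] := boolP (p < x0 < q); last first.
  by have := fg _ out; rewrite leNgt gf.
pose h := barrier b p q.
have h0 x : 0 <= h x by exact: barrier_ge0.
have m0 : 0 < f x0 - g x0 by rewrite subr_gt0.
have [eta eta0 hx0] : exists2 eta : R, 0 < eta & eta * h x0 < f x0 - g x0.
  exists ((f x0 - g x0) / (1 + h x0)).
    by rewrite divr_gt0// ltr_pwDl.
  have h1 : 0 < 1 + h x0 by rewrite ltr_pwDl.
  by rewrite mulrAC ltr_pdivrMr// ltr_pM2l// ltrDr; exact: ltr01.
pose F y := f y - g y - eta * h y.
have Fx0 : 0 < F x0 by rewrite subr_gt0.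
have fg1 y : f y - g y <= 1.
  by have /andP[_ ?] := f1 y; have /andP[? _] := g1 y; lra.
have [d d0 hd] := barrier_blowup eta0.
have Fout y : ~~ (p < y < q) -> F y <= 0.
  by move=> yout; rewrite /F /h barrier_out// mulr0 subr0 subr_le0 fg.
have Fend y : p < y -> y < q -> y < p + d \/ q - d < y -> F y <= 0.
  by move=> py yq /(hd _ py yq) h1; have := fg1 y; rewrite /F /h; lra.
have pd : p + d <= x0.
  rewrite leNgt; apply/negP => xd; have := Fend _ px0 x0q (or_introl xd).
  by rewrite leNgt Fx0.
have qd : x0 <= q - d.
  rewrite leNgt; apply/negP => xd; have := Fend _ px0 x0q (or_intror xd).
  by rewrite leNgt Fx0.
have in_pq y : y \in `[p + d, q - d] -> p < y /\ y < q.
  by rewrite in_itv/= => /andP[? ?]; split; lra.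
have cF : {within `[p + d, q - d], continuous F}.
  apply: continuous_in_subspaceT => y; rewrite inE/= => /in_pq[y1 y2].
  apply: cvgB; first by apply: cvgB; [exact: cf|exact: cg].
  apply: cvgM; first exact: cvg_cst.
  by apply: locally_lipschitz_continuous; exact: barrier_lipschitz.
have [x1 x1I x1max] := EVT_max (le_trans pd qd) cF.
have [px1 x1q] := in_pq _ x1I.
have Fx1 : 0 < F x1.
  by apply: (lt_le_trans Fx0); apply: x1max; rewrite in_itv/= pd.
apply: (@interior_max_contra _ b b0 b1 p q pq f g eta x1) => //.
- exact: lf.
- exact: lg.
- move=> y; have [/andP[py yq]|yout] := boolP (p < y < q); last first.
    exact: le_trans (Fout _ yout) (ltW Fx1).
  have [yd|yd] := ltP y (p + d); first exact: le_trans (Fend _ py yq (or_introl yd)) (ltW Fx1).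
  have [dy|dy] := ltP (q - d) y; first exact: le_trans (Fend _ py yq (or_intror dy)) (ltW Fx1).
  by apply: x1max; rewrite in_itv/= yd.
Qed.

End comparison_principle.

(** * The slope at the free boundary point *)

Section dominated.
Context {R : realType}.
Notation mu := (@lebesgue_measure R).

(** The one-sided limit is tested on sequences, for which dominated convergence is
available. *)
Lemma dominated_right (D : set (measurableTypeR R)) (f : R -> R -> R) (f0 g : R -> R) (t0 : R) :
  measurable D -> 0 < t0 ->
  (forall t, 0 < t -> t < t0 -> measurable_fun D (fun y => (f t y)%:E)) ->
  measurable_fun D (fun y => (f0 y)%:E) ->
  mu.-integrable D (fun y => (g y)%:E) ->
  (forall t y, 0 < t -> t < t0 -> D y -> `|f t y| <= g y) ->
  (forall y, D y -> f t y @[t --> 0^'+] --> f0 y) ->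
  \int[mu]_(y in D) f t y @[t --> 0^'+] --> \int[mu]_(y in D) f0 y.
Proof.
move=> mD t00 mf mf0 ig fg ff0.
(* the hypotheses hold below [t0] only, and all terms of a sequence are needed *)
pose m (t : R) := Num.min t (t0 / 2).
have m0 t : 0 < t -> 0 < m t < t0.
  by move=> t1; rewrite lt_min t1 divr_gt0//= gt_min; apply/orP; right; lra.
suff : \int[mu]_(y in D) f (m t) y @[t --> 0^'+] --> \int[mu]_(y in D) f0 y.
  apply: cvg_trans; apply: near_eq_cvg; near=> t.
  rewrite /m min_l//; near: t; apply: nbhs_right_le; exact: divr_gt0.
apply/cvg_at_rightP => u [u0 ucv].
have mu0 : m (u n) @[n --> \oo] --> (0 : R).
  apply: (cvg_trans _ ucv); apply: near_eq_cvg; near=> n.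
  rewrite /m min_l//; near: n.
  have t20 : 0 < t0 / 2 by exact: divr_gt0.
  by move/cvgr_lt : ucv => /(_ _ t20); apply: filterS => n /ltW.
have [If _ cI] : [/\ mu.-integrable D (fun y => (f0 y)%:E),
  [sequence \int[mu]_(y in D) `|(f (m (u n)) y)%:E - (f0 y)%:E|]_n @ \oo --> 0 &
  [sequence \int[mu]_(y in D) (f (m (u n)) y)%:E]_n @ \oo --> \int[mu]_(y in D) (f0 y)%:E]%E.
  apply: (@dominated_convergence _ _ _ mu D mD (fun n y => (f (m (u n)) y)%:E)
    (fun y => (f0 y)%:E) (fun y => (g y)%:E)) => //.
  - by move=> n; have /andP[? ?] := m0 _ (u0 n); exact: mf.
  - apply: aeW => y Dy; apply: cvg_EFin; first by apply: nearW.
    rewrite /comp/=.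
    have /cvg_at_rightP := ff0 y Dy; apply; split=> // n.
    by have /andP[] := m0 _ (u0 n).
  - apply: aeW => y n Dy /=; rewrite lee_fin.
    by have /andP[? ?] := m0 _ (u0 n); exact: fg.
apply: fine_cvg.
rewrite /= fineK//; last exact: integrable_fin_num.
Unshelve. all: by end_near. Qed.

End dominated.

Section normal_derivative.
Context {R : realType}.
Notation mu := (@lebesgue_measure R).
Variables (b p q e : R).
Hypotheses (b0 : 0 < b) (b1 : b < 1) (pq : p < q) (qe : q < e).
Notation L := (q - p).
Notation E := (e - q).

(** With w y = y^-b / (t + y), the integrand of B is w up to scaling, that of u (q - t)
is ((L - t) / (L + y))^b w y on (0, E), and this is the difference. *)
Definition defect (t y : R) : R :=
  (1 - ((L - t) / (L + y)) `^ b) * (y `^ (- b) / (t + y)).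

Definition near_defect (t : R) : R := \int[mu]_(y in `]0, E[) defect t y.
Definition far_defect (t : R) : R := \int[mu]_(y in `]E, +oo[) (y `^ (- b) / (t + y)).

Lemma frac_bounds (t y : R) : 0 <= t -> t < L -> 0 < y -> 0 < (L - t) / (L + y) <= 1.
Proof.
have pq' := pq; move=> t0 tL y0.
rewrite divr_gt0 ?ler_pdivrMr ?mul1r/=; lra.
Qed.

(** 1 - r^b <= 1 - r for r in [0, 1], and 1 - r contains the factor t + y. *)
Lemma defect_bounds (t y : R) : 0 <= t -> t < L -> 0 < y ->
  0 <= defect t y <= y `^ (- b) / L.
Proof.
have pq' := pq; move=> t0 tL y0; rewrite /defect.
have /andP[r0 r1] := frac_bounds t0 tL y0.
set r := _ / (L + y) in r0 r1 *.
have h1 : r `^ b <= 1.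
  have := @ge0_ler_powR _ b (ltW b0) r 1; rewrite !nnegrE powR1; apply => //; exact: ltW.
have h2 : r <= r `^ b by apply: ger1_powR; [rewrite r0|exact: ltW].
have ty : 0 < t + y by lra.
rewrite mulr_ge0 ?subr_ge0 ?divr_ge0 ?powR_ge0 ?(ltW ty)//=.
rewrite mulrCA ler_wpM2l ?powR_ge0// ler_pdivrMr//.
have Ly : 0 < L + y by lra.
have rE : 1 - r = (t + y) / (L + y) by rewrite /r; field; rewrite gt_eqF.
apply: (@le_trans _ _ (1 - r)); first by rewrite lerD2l lerN2.
rewrite rE mulrC ler_wpM2r ?(ltW ty)// lef_pV2 ?posrE//; lra.
Qed.

Lemma measurable_defect (D : set R) t : measurable_fun D (fun y => (defect t y)%:E).
Proof. by rewrite /defect; mfun. Qed.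

Lemma integrable_near :
  mu.-integrable `]0, E[ (fun y => (y `^ (- b) / L)%:E).
Proof.
have [pq' qe'] := conj pq qe.
have L0 : 0 < L by rewrite subr_gt0.
apply/integrableP; split; first by mfun.
under eq_integral do rewrite gee0_abs ?lee_fin ?divr_ge0 ?powR_ge0 ?(ltW L0)// mulrC EFinM.
rewrite ge0_integralZl//; last 3 first.
- by mfun.
- by move=> y _; rewrite lee_fin powR_ge0.
- by rewrite lee_fin invr_ge0 ltW.
have -> : (\int[mu]_(y in `]0%R, E[) (y `^ (- b))%:E = ((E `^ (1 - b)) / (1 - b))%:E)%E.
  rewrite -integral_powR_head ?subr_gt0//.
  by apply: eq_integral => y _; congr (_ `^ _)%:E; ring.
by rewrite -EFinM ltry.
Qed.

Lemma integrable_far : mu.-integrable `]E, +oo[ (fun y => (y `^ (- 1 - b))%:E).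
Proof.
have E0 : 0 < E by rewrite subr_gt0.
apply/integrableP; split; first by mfun.
under eq_integral do rewrite gee0_abs ?lee_fin ?powR_ge0//.
by rewrite integral_powR_tail// ltry.
Qed.

Lemma far_le (t y : R) : 0 <= t -> 0 < y -> 0 <= y `^ (- b) / (t + y) <= y `^ (- 1 - b).
Proof.
move=> t0 y0; have ty : 0 < t + y by lra.
rewrite divr_ge0 ?powR_ge0 ?(ltW ty)//= powR_tail// powRN -invfM.
rewrite lef_pV2 ?posrE ?mulr_gt0 ?powR_gt0//.
by rewrite mulrC ler_wpM2l ?powR_ge0// lerDr.
Qed.

Lemma near_defect_cvg : near_defect t @[t --> 0^'+] --> near_defect 0.
Proof.
have [pq' qe'] := conj pq qe.
have L0 : 0 < L by rewrite subr_gt0.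
apply: (@dominated_right R `]0, E[%classic defect (defect 0) (fun y => y `^ (- b) / L) L) => //.
- by move=> t _ _; exact: measurable_defect.
- exact: measurable_defect.
- exact: integrable_near.
- move=> t y t0 tL /=; rewrite in_itv/= => /andP[y0 _].
  by have /andP[d0 d1] := defect_bounds (ltW t0) tL y0; rewrite ger0_norm.
- move=> y /=; rewrite in_itv/= => /andP[y0 _]; apply: cvg_at_right_filter.
  have : {for 0, continuous (fun t => defect t y)}; last exact.
  have n1 : L + y != 0 by rewrite gt_eqF//; lra.
  have n2 : 0 + y != 0 by rewrite gt_eqF//; lra.
  have n3 : 0 < (L - 0) / (L + y) by rewrite divr_gt0//; lra.
  by rewrite /defect; cont.
Qed.

Lemma far_defect_cvg : far_defect t @[t --> 0^'+] --> far_defect 0.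
Proof.
have E0 : 0 < E by rewrite subr_gt0.
apply: (@dominated_right R `]E, +oo[%classic (fun t y => y `^ (- b) / (t + y))
  (fun y => y `^ (- b) / (0 + y)) (fun y => y `^ (- 1 - b)) 1) => //.
- by move=> t _ _; mfun.
- by mfun.
- exact: integrable_far.
- move=> t y t0 _ /=; rewrite in_itv/= andbT => y0.
  by have /andP[d0 d1] := far_le (ltW t0) (lt_trans E0 y0); rewrite ger0_norm.
- move=> y /=; rewrite in_itv/= andbT => y0; apply: cvg_at_right_filter.
  have : {for 0, continuous (fun t => y `^ (- b) / (t + y))}; last exact.
  by cont; rewrite gt_eqF//; lra.
Qed.

(** 1 - u is the missing mass: on (0, e - q) because of the factor (y - p)^-b, and
beyond e - q because the datum stops at e. *)
Lemma usol_defect (t : R) : 0 < t -> t < L ->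
  betaR b * (1 - usol b p q e (q - t)) = t `^ b * (near_defect t + far_defect t).
Proof.
have [pq' qe'] := conj pq qe; move=> t0 tL.
have E0 : 0 < E by rewrite subr_gt0.
have px : p < q - t by lra.
have xq : q - t < q by lra.
have T0 : 0 < t `^ b by rewrite powR_gt0.
have B0 := betaR_gt0 b0 b1.
pose w y := y `^ (- b) / (t + y).
(* B itself as an integral with denominator t + y, split at e - q *)
have wE : (betaR b)%:E = ((t `^ b)%:E * (\int[mu]_(y in `]0%R, E[) (w y)%:E + \int[mu]_(y in `]E, +oo[) (w y)%:E))%E.
  rewrite -ge0_integral_split//.
  - rewrite integral_kernel_scale// betaRE// -!EFinM mulrA -powRD; last by rewrite (gt_eqF t0) implybT.
    by rewrite subrr powRr0 mul1r.
  - by rewrite /w; mfun.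
  - by move=> y; rewrite in_itv/= andbT => y0; rewrite lee_fin divr_ge0 ?powR_ge0//; lra.
pose r y := ((L - t) / (L + y)) `^ b.
have uE : (betaR b * usol b p q e (q - t))%:E =
   ((t `^ b)%:E * \int[mu]_(y in `]0%R, E[) (r y * w y)%:E)%E.
  rewrite usol_in// /usol_inside mulrA mulfV ?gt_eqF// mul1r.
  rewrite EFinM -poisson_int_fin// /poisson_int.
  have := @integral_shift_oo _ (fun y => poisson_density b p q y / (y - (q - t))) q 0 E E0.
  rewrite addr0 addrC subrK => ->; first last.
  - by move=> y; rewrite in_itv/= => /andP[y1 y2]; rewrite divr_ge0 ?powR_ge0//; lra.
  - move=> y; rewrite in_itv/= => /andP[y1 y2]; rewrite /poisson_density; cont.
      by rewrite mulr_gt0//; lra.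
    by rewrite gt_eqF//; lra.
  rewrite -!ge0_integralZl//.
  - apply: eq_integral => y; rewrite inE/= in_itv/= => /andP[y1 y2].
    rewrite -!EFinM; congr EFin; rewrite /poisson_density /r /w.
    have -> : q - t - p = L - t by ring.
    have -> : q - (q - t) = t by ring.
    have -> : q + y - p = L + y by ring.
    have -> : q + y - q = y by ring.
    have -> : q + y - (q - t) = t + y by ring.
    have z1 : 0 <= L - t by lra.
    have z2 : 0 < L + y by lra.
    rewrite (powRM _ z1 (ltW t0)) (powRM _ (ltW z2) (ltW y1)) powR_div ?(ltW z2)//.
    by rewrite [(L + y) `^ (- b)]powRN; ring.
  - by rewrite /r /w; mfun.
  - move=> y /=; rewrite in_itv/= => /andP[y1 y2].
    by rewrite lee_fin mulr_ge0 ?powR_ge0// divr_ge0 ?powR_ge0//; lra.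
  - by rewrite lee_fin ltW.
  - by rewrite /poisson_density; mfun.
  - move=> y /=; rewrite in_itv/= => /andP[y1 y2].
    by rewrite lee_fin divr_ge0 ?powR_ge0//; lra.
  - by rewrite lee_fin powR_ge0.
have sE : (\int[mu]_(y in `]0%R, E[) (w y)%:E = (near_defect t)%:E +
    \int[mu]_(y in `]0%R, E[) (r y * w y)%:E)%E.
  have dpos y : `]0, E[%classic y -> (0 <= (defect t y)%:E)%E.
    rewrite /= in_itv/= => /andP[y1 y2].
    by have /andP[] := defect_bounds (ltW t0) tL y1; rewrite lee_fin.
  rewrite /near_defect /Rintegral fineK; last first.
    apply: integrable_fin_num => //.
    apply: le_integrable integrable_near => //; first exact: measurable_defect.
    move=> y /=; rewrite in_itv/= => /andP[y1 y2]; rewrite lee_fin.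
    have /andP[d0 d1] := defect_bounds (ltW t0) tL y1.
    by rewrite !ger0_norm// divr_ge0 ?powR_ge0//; lra.
  rewrite -ge0_integralD//.
  - by apply: eq_integral => y _; rewrite -EFinD /defect -/(r y) -/(w y); congr EFin; ring.
  - exact: measurable_defect.
  - move=> y /=; rewrite in_itv/= => /andP[y1 y2].
    by rewrite lee_fin mulr_ge0 ?powR_ge0// divr_ge0 ?powR_ge0//; lra.
  - by rewrite /r /w; mfun.
have fE : (\int[mu]_(y in `]E, +oo[) (w y)%:E = (far_defect t)%:E)%E.
  rewrite /far_defect /Rintegral fineK// integrable_fin_num//.
  apply: le_integrable integrable_far => //; first by rewrite /w; mfun.
  move=> y /=; rewrite in_itv/= andbT => y1; rewrite lee_fin.
  have /andP[d0 d1] := far_le (ltW t0) (lt_trans E0 y1).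
  by rewrite !ger0_norm ?powR_ge0.
set I := (\int[mu]_(y in `]0%R, E[) (r y * w y)%:E)%E in uE sE.
have [i Ei] : exists i, I = i%:E.
  exists (fine I); rewrite fineK//.
  move: uE; case: I {sE} => // /eqP; rewrite ?gt0_muley ?gt0_muleNy ?lte_fin//.
move: wE; rewrite sE fE Ei -!EFinD -EFinM => -[wE].
move: uE; rewrite Ei -EFinM => -[uE].
by rewrite mulrBr mulr1 uE wE; ring.
Qed.

Lemma usol_normal_derive :
  is_frac_normal_derive (2 * b) (usol b p q e) q (-1)
    (- ((near_defect 0 + far_defect 0) / betaR b)).
Proof.
have B0 := betaR_gt0 b0 b1.
have L0 : 0 < L by rewrite subr_gt0.
have c : - ((near_defect t + far_defect t) / betaR b) @[t --> 0^'+] -->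
    - ((near_defect 0 + far_defect 0) / betaR b).
  apply: cvgN; apply: cvgM; last exact: cvg_cst.
  by apply: cvgD; [exact: near_defect_cvg|exact: far_defect_cvg].
apply: (cvg_trans _ c); apply: near_eq_cvg; near=> t.
have t0 : 0 < t by near: t; exact: nbhs_right_gt.
have tL : t < L by near: t; exact: nbhs_right_lt.
have := usol_defect t0 tL.
rewrite mulrN1 (@usol_one _ _ p q e q)// (_ : 2 * b / 2 = b); last by field.
have := powR_gt0 b t0; set T := t `^ b => T0 h.
have -> : usol b p q e (q - t) = 1 - (T * (near_defect t + far_defect t)) / betaR b.
  by rewrite -h; field; rewrite gt_eqF.
by field; rewrite !gt_eqF.
Unshelve. all: by end_near. Qed.

Lemma far_defect0 : far_defect 0 = E `^ (- b) / b.
Proof.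
have E0 : 0 < E by rewrite subr_gt0.
rewrite /far_defect /Rintegral.
have -> : (\int[mu]_(y in `]E, +oo[) (y `^ (- b) / (0 + y))%:E =
   \int[mu]_(y in `]E, +oo[) (y `^ (- 1 - b))%:E)%E.
  apply: eq_integral => y; rewrite inE/= in_itv/= andbT => yE.
  have y0 : 0 < y by exact: lt_trans yE.
  by rewrite add0r powR_tail// powRN -invfM mulrC.
by rewrite integral_powR_tail.
Qed.

End normal_derivative.

(** * The profile of the slope *)

(** The mean value theorem, for functions known on the positive half-line only. *)
Lemma has_deriv_mvt {R : realType} (f df : R -> R) (x y : R) :
  (forall z, 0 < z -> has_deriv f z (df z)) -> 0 < x -> x < y ->
  exists z, [/\ x < z, z < y & f y - f x = df z * (y - x)].
Proof.
move=> f' x0 xy.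
have [z||z zx ->] := @MVT R f df x y xy.
- rewrite in_itv/= => /andP[xz _]; apply/has_derivP; apply: f'.
  exact: lt_trans xz.
- apply: continuous_in_subspaceT => z; rewrite inE/= in_itv/= => /andP[xz _].
  by apply: has_deriv_continuous; apply: f'; exact: lt_le_trans xz.
by exists z; move: zx; rewrite in_itv/= => /andP[? ?].
Qed.

Section unimodal.
Context {R : realType}.
Variables (f g w : R -> R).
Hypotheses (f' : forall x, 0 < x -> has_deriv f x (w x * g x))
  (w0 : forall x, 0 < x -> 0 < w x)
  (gc : forall x, 0 < x -> {for x, continuous g})
  (gi : forall x y, 0 < x -> x < y -> g x < g y)
  (gneg : exists2 x, 0 < x & g x < 0) (gpos : exists2 x, 0 < x & 0 < g x)
  (fhead : forall c d, 0 < d -> exists x, [/\ 0 < x, x < d & c < f x])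
  (ftail : forall c d, 0 < d -> exists x, d < x /\ c < f x).

Let ivt (h : R -> R) (x y c : R) : 0 < x -> x < y ->
  (forall z, 0 < z -> {for z, continuous h}) ->
  Num.min (h x) (h y) <= c <= Num.max (h x) (h y) -> exists z, [/\ x <= z, z <= y & h z = c].
Proof.
move=> x0 xy hc hcc.
have [|z zx hz] := @IVT R h x y c (ltW xy) _ hcc.
  apply: continuous_in_subspaceT => z; rewrite inE/= in_itv/= => /andP[xz _].
  by apply: hc; exact: lt_le_trans xz.
by move: zx; rewrite in_itv/= => /andP[? ?]; exists z.
Qed.

Let fc x : 0 < x -> {for x, continuous f}.
Proof. by move=> /f'; exact: has_deriv_continuous. Qed.

Let mvt x y : 0 < x -> x < y -> exists z, [/\ x < z, z < y & f y - f x = w z * g z * (y - x)].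
Proof. exact: (has_deriv_mvt f'). Qed.

(** f decreases up to the zero of g and increases after it. *)
Lemma unimodal : exists2 v0, 0 < v0 &
  (forall v, 0 < v -> v != v0 -> f v0 < f v) /\
  (forall c, f v0 < c -> exists v1 v2, [/\ 0 < v1, v1 < v0, v0 < v2, f v1 = c &
     f v2 = c /\ forall v, 0 < v -> f v = c -> v = v1 \/ v = v2]).
Proof.
have [x x0 gx] := gneg; have [y y0 gy] := gpos.
have xy : x < y.
  rewrite ltNge le_eqVlt; apply/negP => /predU1P[yx|/(gi y0)]; last by lra.
  by move: gx; rewrite -yx; lra.
have [|v0 [v0x v0y gv0]] := @ivt g x y 0 x0 xy gc.
  by rewrite ge_min le_max (ltW gx) (ltW gy) orbT.
have v00 : 0 < v0 by exact: lt_le_trans v0x.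
have dec u v : 0 < u -> u < v -> v <= v0 -> f v < f u.
  move=> u0 uv vv0; have [z [uz zv e]] := mvt u0 uv.
  have z0 : 0 < z by exact: lt_trans uz.
  have gz : g z < 0 by rewrite -gv0; apply: gi => //; exact: lt_le_trans vv0.
  rewrite -subr_lt0 e pmulr_llt0 ?subr_gt0// pmulr_rlt0//; exact: w0.
have inc u v : v0 <= u -> u < v -> f u < f v.
  move=> uv0 uv; have u0 : 0 < u by exact: lt_le_trans uv0.
  have [z [uz zv e]] := mvt u0 uv.
  have z0 : 0 < z by exact: lt_trans uz.
  have gz : 0 < g z by rewrite -gv0; apply: gi => //; exact: le_lt_trans uz.
  by rewrite -subr_gt0 e pmulr_lgt0 ?subr_gt0// pmulr_rgt0//; exact: w0.
exists v0 => //; split.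
  move=> v vp; rewrite neq_lt => /orP[vl|vg]; first exact: dec.
  exact: inc.
move=> c cv0.
have [u1 [u10 u1v cu1]] := fhead c v00.
have [u2 [u2v cu2]] := ftail c v00.
have [|v1 [a1 a2 a3]] := @ivt f u1 v0 c u10 u1v fc.
  by rewrite ge_min le_max (ltW cu1) (ltW cv0) orbT.
have [|v2 [c1 c2 c3]] := @ivt f v0 u2 c v00 u2v fc.
  by rewrite ge_min le_max (ltW cu2) (ltW cv0) orbT.
have v10 : 0 < v1 by exact: lt_le_trans a1.
have v1l : v1 < v0.
  by rewrite lt_neqAle a2 andbT; apply/eqP => k; move: cv0; rewrite -a3 k ltxx.
have v2l : v0 < v2.
  by rewrite lt_neqAle c1 andbT; apply/eqP => k; move: cv0; rewrite -c3 k ltxx.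
exists v1, v2; split=> //; split=> // v vp fv.
have [vv0|vv0] := leP v v0; [left|right].
  apply/eqP; rewrite eq_le !leNgt; apply/andP; split; apply/negP => k.
    by have := dec _ _ v10 k vv0; rewrite fv a3 ltxx.
  by have := dec _ _ vp k a2; rewrite fv a3 ltxx.
apply/eqP; rewrite eq_le !leNgt; apply/andP; split; apply/negP => k.
  by have := inc _ _ c1 k; rewrite fv c3 ltxx.
by have := inc _ _ (ltW vv0) k; rewrite fv c3 ltxx.
Qed.

End unimodal.

Section profile.
Context {R : realType}.
Notation mu := (@lebesgue_measure R).
Variable b : R.
Hypotheses (b0 : 0 < b) (b1 : b < 1).

(** The integrand of [near_defect] at t = 0 after rescaling by q - p. *)
Definition deficit (v : R) : R := (1 - (1 + v) `^ (- b)) * v `^ (- 1 - b).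
Definition deficit_int (v : R) : R := \int[mu]_(s in `]0, v]) deficit s.
(** The slope at q in units of (e - p)^-b / B, as a function of
v = (e - q) / (q - p). *)
Definition profile (v : R) : R := (1 + v) `^ b * (deficit_int v + v `^ (- b) / b).
(** The derivative of [profile] without the positive factor (1 + v)^(b - 1). *)
Definition slope (v : R) : R :=
  b * (deficit_int v + v `^ (- b) / b) - (1 + v) `^ (1 - b) * v `^ (- 1 - b).

(** (1 + v)^-b >= (1 + v)^-1 >= 1 - v, as b < 1. *)
Lemma deficit_bounds v : 0 < v -> 0 < deficit v <= v `^ (- b).
Proof.
have [b0' b1'] := conj b0 b1.
move=> v0; rewrite /deficit.
have h : (1 + v) `^ (- b) < 1.
  by have := @ltr_powRN _ b 1 (1 + v) b0 ltr01; rewrite powR1; apply; lra.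
have h' : (1 + v)^-1 <= (1 + v) `^ (- b).
  rewrite powRN lef_pV2 ?posrE ?powR_gt0; try lra.
  by have := @ler_powR _ (1 + v) _ _ _ (ltW b1); rewrite powRr1; [apply|]; lra.
rewrite mulr_gt0 ?powR_gt0//=; last by lra.
rewrite powR_tail// invfM mulrA [v `^ (- b)]powRN ler_piMl ?invr_ge0 ?powR_ge0//.
rewrite ler_pdivrMr// mul1r.
have : (1 + v)^-1 >= 1 - v.
  rewrite -div1r ler_pdivlMr; last by lra.
  have vv : 0 < v * v by rewrite mulr_gt0.
  by nra.
by lra.
Qed.

Lemma measurable_deficit (D : set R) : measurable_fun D deficit.
Proof. by apply/measurable_EFinP; rewrite /deficit; mfun. Qed.

Lemma integral_powR_head_closed v : 0 < v ->
  (\int[mu]_(s in `]0%R, v]) (s `^ (- b))%:E = (v `^ (1 - b) / (1 - b))%:E)%E.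
Proof.
move=> v0; rewrite -integral_itv_bndo_bndc; last by mfun.
rewrite -integral_powR_head ?subr_gt0//.
by apply: eq_integral => y _; congr (_ `^ _)%:E; ring.
Qed.

Lemma integrable_deficit v : 0 < v -> mu.-integrable `]0, v] (EFin \o deficit).
Proof.
move=> v0.
have h : mu.-integrable `]0, v] (fun s => (s `^ (- b))%:E).
  apply/integrableP; split; first by mfun.
  under eq_integral do rewrite gee0_abs ?lee_fin ?powR_ge0//.
  by rewrite integral_powR_head_closed// ltry.
apply: le_integrable h => //; first by apply/measurable_EFinP; exact: measurable_deficit.
move=> s /=; rewrite in_itv/= => /andP[s0 _].
have /andP[h1 h2] := deficit_bounds s0.
by rewrite lee_fin !ger0_norm ?powR_ge0// ltW.
Qed.

Lemma has_deriv_deficit_int v : 0 < v -> has_deriv deficit_int v (deficit v).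
Proof.
move=> v0.
have v1 : v < v + 1 by rewrite ltrDl.
have [] := @continuous_FTC1 R deficit (BRight 0) v (v + 1) v1.
- by apply: integrable_deficit; rewrite addr_gt0.
- exact: v0.
- have : {for v, continuous (fun s => deficit s)}; last exact.
  by rewrite /deficit; cont; lra.
by rewrite derive1E => d1 d2; split.
Qed.

Lemma deficit_int_mono u v : 0 < u -> u < v -> deficit_int u < deficit_int v.
Proof.
move=> u0 uv; have [z [uz zv e]] := has_deriv_mvt has_deriv_deficit_int u0 uv.
have /andP[z0 _] := deficit_bounds (lt_trans u0 uz).
by rewrite -subr_gt0 e mulr_gt0// subr_gt0.
Qed.

Lemma deficit_int_gt0 v : 0 < v -> 0 < deficit_int v.
Proof.
move=> v0; have v2 : 0 < v / 2 by rewrite divr_gt0.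
apply: (@le_lt_trans _ _ (deficit_int (v / 2))); last by apply: deficit_int_mono => //; lra.
apply: Rintegral_ge0 => s /=; rewrite in_itv/= => /andP[s0 _].
by have /andP[/ltW] := deficit_bounds s0.
Qed.

Lemma deficit_int_le v : 0 < v -> deficit_int v <= v `^ (1 - b) / (1 - b).
Proof.
move=> v0; rewrite -lee_fin -integral_powR_head_closed// /deficit_int /Rintegral fineK; last first.
  by apply: integrable_fin_num => //; exact: integrable_deficit.
apply: ge0_le_integral => //.
- move=> s /=; rewrite in_itv/= => /andP[s0 _].
  by have /andP[/ltW] := deficit_bounds s0.
- by apply/measurable_EFinP; exact: measurable_deficit.
- by mfun.
- move=> s /=; rewrite in_itv/= => /andP[s0 _].
  by have /andP[_] := deficit_bounds s0; rewrite lee_fin.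
Qed.

Lemma has_deriv_deficit_total v : 0 < v ->
  has_deriv (fun v => deficit_int v + v `^ (- b) / b) v (- ((1 + v) `^ (- b) * v `^ (- 1 - b))).
Proof.
move=> v0; apply: has_deriv_eq.
  by apply: has_deriv_add; [exact: has_deriv_deficit_int|deriv].
have -> : - b - 1 = - 1 - b by ring.
by rewrite /deficit; field; rewrite gt_eqF.
Qed.

Lemma has_deriv_profile v : 0 < v ->
  has_deriv profile v ((1 + v) `^ (b - 1) * slope v).
Proof.
move=> v0; have v1 : 0 < 1 + v by lra.
apply: has_deriv_eq.
  by apply: has_deriv_mul; [deriv|exact: has_deriv_deficit_total].
rewrite /slope add0r mulr1.
have e1 : (1 + v) `^ b * (1 + v) `^ (- b) = 1.
  by rewrite -powRD ?subrr ?powRr0// (gt_eqF v1) implybT.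
have e2 : (1 + v) `^ (b - 1) * (1 + v) `^ (1 - b) = 1.
  rewrite -powRD ?(gt_eqF v1) ?implybT//.
  have -> : b - 1 + (1 - b) = 0; [ring|by rewrite powRr0].
move: e1 e2; set P := _ `^ b; set Q := _ `^ (- b); set S := _ `^ (b - 1).
set T := (1 + v) `^ (1 - b); set J := deficit_int v + _; set V := v `^ (- 1 - b).
move=> e1 e2; transitivity (b * S * J - (P * Q) * V); first by ring.
by rewrite e1 -e2; ring.
Qed.

(** The terms of higher order cancel and the derivative is visibly positive. *)
Lemma has_deriv_slope v : 0 < v ->
  has_deriv slope v ((1 + v) `^ (- b) * v `^ (- 2 - b) * (1 + b * (1 + v))).
Proof.
move=> v0; have v1 : 0 < 1 + v by lra.
apply: has_deriv_eq.
  apply: has_deriv_add; first by apply: has_deriv_mul; [deriv|exact: has_deriv_deficit_total].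
  by deriv.
have -> : 1 - b - 1 = - b by ring.
have -> : - 1 - b - 1 = - 2 - b by ring.
have e1 : (1 + v) `^ (1 - b) = (1 + v) `^ (- b) * (1 + v).
  rewrite -[X in _ * X]powRr1 -?powRD ?(ltW v1) ?(gt_eqF v1) ?implybT//.
  by congr (_ `^ _); ring.
have e2 : v `^ (- 1 - b) = v `^ (- 2 - b) * v.
  rewrite -[X in _ * X]powRr1 -?powRD ?(ltW v0) ?(gt_eqF v0) ?implybT//.
  by congr (_ `^ _); ring.
by rewrite e1 e2; ring.
Qed.

Lemma slope_increasing x y : 0 < x -> x < y -> slope x < slope y.
Proof.
have [b0' b1'] := conj b0 b1.
move=> x0 xy; have [z [xz zy e]] := has_deriv_mvt has_deriv_slope x0 xy.
have z0 : 0 < z by exact: lt_trans xz.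
have z1 : 0 < 1 + z by lra.
rewrite -subr_gt0 e; apply: mulr_gt0; last by rewrite subr_gt0.
apply: mulr_gt0; first by rewrite mulr_gt0 ?powR_gt0.
by rewrite addr_gt0// mulr_gt0.
Qed.

(** Near 0, b * deficit_int v is O(v^(1-b)) while the other terms are
(1 - 1/v) v^-b to leading order. *)
Lemma slope_neg : exists2 v, 0 < v & slope v < 0.
Proof.
have [b0' b1'] := conj b0 b1.
pose v := (1 - b) / 2; have v0 : 0 < v by rewrite divr_gt0//; lra.
have v1 : v < 1 / 2 by rewrite /v; lra.
exists v => //.
have h := deficit_int_le v0.
have e1 : v `^ (1 - b) / (1 - b) = v `^ (- b) / 2.
  rewrite powRD ?(gt_eqF v0) ?implybT// powRr1 ?(ltW v0)// /v; field.
  by rewrite gt_eqF//; lra.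
have k : 1 <= (1 + v) `^ (1 - b).
  have := @ler_powR _ (1 + v) _ 0 (1 - b); rewrite powRr0; apply; lra.
have P0 : 0 < v `^ (- b) by rewrite powR_gt0.
have e2 : v `^ (- 1 - b) = v^-1 * v `^ (- b) by rewrite powR_tail// powRN invfM.
have vi : 2 < v^-1 by rewrite -div1r ltr_pdivlMr//; lra.
rewrite e1 in h; rewrite /slope e2.
have -> : b * (deficit_int v + v `^ (- b) / b) = b * deficit_int v + v `^ (- b).
  by field; rewrite gt_eqF.
have h' : b * deficit_int v <= 1 * (v `^ (- b) / 2).
  by apply: ler_pM => //; rewrite ?ltW// deficit_int_gt0.
have h2 : 2 * v `^ (- b) <= (1 + v) `^ (1 - b) * (v^-1 * v `^ (- b)).
  rewrite mulrA ler_wpM2r ?(ltW P0)//; apply: le_trans (ltW vi) _.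
  by rewrite ler_peMl// invr_ge0 ltW.
by lra.
Qed.

(** At infinity deficit_int stays above a positive constant, while the other two terms
cancel up to 1 / v because (1 + v)^(1-b) <= 1 + v. *)
Lemma slope_pos : exists2 v, 0 < v & 0 < slope v.
Proof.
have [b0' b1'] := conj b0 b1.
have c0 := deficit_int_gt0 (@ltr01 R).
set c := deficit_int 1 in c0.
have bc : 0 < b * c by rewrite mulr_gt0.
have i0 : 0 < (b * c)^-1 by rewrite invr_gt0.
pose v := 1 + (b * c)^-1; have v1 : 1 < v by rewrite /v; lra.
have v0 : 0 < v by lra.
have vi : v^-1 < b * c by rewrite -[ltRHS]invrK ltf_pV2 ?posrE// /v; lra.
exists v => //; rewrite /slope.
have h : c < deficit_int v by exact: deficit_int_mono.
have -> : b * (deficit_int v + v `^ (- b) / b) = b * deficit_int v + v `^ (- b).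
  by field; rewrite gt_eqF.
have h' : b * c < b * deficit_int v by rewrite ltr_pM2l.
have P0 : 0 <= v `^ (- b) by rewrite powR_ge0.
have P1 : v `^ (- b) <= 1.
  by have := @ler_powR _ v (ltW v1) (- b) 0; rewrite powRr0; apply; lra.
have e2 : v `^ (- 1 - b) = v^-1 * v `^ (- b) by rewrite powR_tail// powRN invfM.
have k : (1 + v) `^ (1 - b) <= 1 + v.
  by have := @ler_powR _ (1 + v) _ (1 - b) 1; rewrite powRr1; [apply|]; lra.
have h2 : (1 + v) `^ (1 - b) * v `^ (- 1 - b) <= v^-1 + v `^ (- b).
  apply: (@le_trans _ _ ((1 + v) * v `^ (- 1 - b))).
    by rewrite ler_wpM2r ?powR_ge0.
  have -> : (1 + v) * v `^ (- 1 - b) = v^-1 * v `^ (- b) + v `^ (- b).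
    by rewrite e2; field; rewrite gt_eqF.
  by rewrite lerD2r ler_piMr// invr_ge0 ltW.
by lra.
Qed.

Lemma profile_ge u v : 0 < u -> u < v ->
  (1 + v) `^ b * deficit_int u <= profile v.
Proof.
move=> u0 uv; rewrite /profile ler_wpM2l ?powR_ge0//.
have := deficit_int_mono u0 uv.
have : 0 <= v `^ (- b) / b by rewrite divr_ge0 ?powR_ge0 ?ltW.
by lra.
Qed.

Lemma profile_gt0 v : 0 < v -> 0 < profile v.
Proof.
have b0' := b0; move=> v0.
by rewrite mulr_gt0 ?powR_gt0 ?addr_gt0 ?deficit_int_gt0 ?divr_gt0 ?powR_gt0.
Qed.

Lemma profile_head c d : 0 < d -> exists x, [/\ 0 < x, x < d & c < profile x].
Proof.
have [b0' b1'] := conj b0 b1.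
move=> d0; pose C := `|c| + 1; have C0 : 0 < C by rewrite ltr_wpDl.
pose m := C `^ (- b)^-1; have m0 : 0 < m by rewrite powR_gt0.
pose x := Num.min (d / 2) m.
have x0 : 0 < x by rewrite lt_min m0 divr_gt0.
exists x; split => //.
  have : x <= d / 2 by rewrite ge_min lexx.
  by lra.
have h1 : C <= x `^ (- b).
  rewrite -[C](@powRVK _ (- b)) ?oppr_eq0 ?gt_eqF//.
  by apply: ler_powRN => //; [exact: ltW|rewrite ge_min lexx orbT].
have h2 : 1 <= (1 + x) `^ b.
  have := @ler_powR _ (1 + x) _ 0 b; rewrite powRr0; apply; lra.
have h3 : x `^ (- b) <= x `^ (- b) / b.
  by rewrite ler_pdivlMr// ler_piMr ?powR_ge0// ltW.
have h4 := deficit_int_gt0 x0.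
apply: (@lt_le_trans _ _ C); first by rewrite /C; have := ler_norm c; lra.
apply: (@le_trans _ _ (deficit_int x + x `^ (- b) / b)); first by lra.
by rewrite /profile ler_peMl//; lra.
Qed.

Lemma profile_tail c d : 0 < d -> exists x, d < x /\ c < profile x.
Proof.
have [b0' b1'] := conj b0 b1.
move=> d0; have c0 := deficit_int_gt0 (@ltr01 R).
pose C := (`|c| + 1) / deficit_int 1.
have C0 : 0 < C by rewrite divr_gt0// ltr_wpDl.
pose m := C `^ b^-1; have m0 : 0 < m by rewrite powR_gt0.
exists (d + 1 + m); split; first by lra.
have x1 : 1 < d + 1 + m by lra.
apply: lt_le_trans (profile_ge ltr01 x1).
apply: (@lt_le_trans _ _ (C * deficit_int 1)).
  by rewrite /C divfK ?gt_eqF//; have := ler_norm c; lra.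
rewrite ler_wpM2r ?(ltW c0)// -[leLHS](@powRVK _ b) ?gt_eqF//.
by apply: ge0_ler_powR; rewrite ?nnegrE -/m; lra.
Qed.

Lemma profile_unimodal : exists2 v0, 0 < v0 &
  (forall v, 0 < v -> v != v0 -> profile v0 < profile v) /\
  (forall c, profile v0 < c -> exists v1 v2, [/\ 0 < v1, v1 < v0, v0 < v2, profile v1 = c &
     profile v2 = c /\ forall v, 0 < v -> profile v = c -> v = v1 \/ v = v2]).
Proof.
apply: (@unimodal R profile slope (fun v => (1 + v) `^ (b - 1))).
- exact: has_deriv_profile.
- by move=> x x0; rewrite powR_gt0//; lra.
- by move=> x /has_deriv_slope; exact: has_deriv_continuous.
- exact: slope_increasing.
- exact: slope_neg.
- exact: slope_pos.
- exact: profile_head.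
- exact: profile_tail.
Qed.

End profile.

(** * Solutions of the Bernoulli problem *)

Section normal_slope.
Context {R : realType}.
Notation mu := (@lebesgue_measure R).
Variables (b p q e : R).
Hypotheses (b0 : 0 < b) (b1 : b < 1) (pq : p < q) (qe : q < e).
Notation L := (q - p).
Notation E := (e - q).

(** The substitution y = (q - p) s. *)
Lemma near_defect_profile : near_defect b p q e 0 = L `^ (- b) * deficit_int b (E / L).
Proof.
have [[b0' b1'] [pq' qe']] := conj (conj b0 b1) (conj pq qe).
have L0 : 0 < L by rewrite subr_gt0.
have E0 : 0 < E by rewrite subr_gt0.
have v0 : 0 < E / L by rewrite divr_gt0.
have iD := integrable_deficit b0 b1 v0.
have iD' : mu.-integrable `]0, E / L[ (EFin \o deficit b).
  by apply: integrableS iD => //; apply: subset_itvl; rewrite bnd_simp.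
rewrite /deficit_int -Rintegral_itv_bndo_bndc//.
rewrite -RintegralZl// /near_defect /Rintegral; congr fine.
rewrite (@ge0_substitution R `]0, (E / L)[ `]0, E[ (fun s => L * s) (fun=> L)
  (fun y => y / L)).
- apply: eq_integral => s; rewrite inE/= in_itv/= => /andP[s0 _]; congr EFin.
  have s1 : 0 < 1 + s by lra.
  rewrite /defect /deficit subr0 add0r.
  have -> : L / (L + L * s) = (1 + s)^-1 by field; rewrite !gt_eqF//; nra.
  rewrite powR_inv; last exact: ltW.
  rewrite (powRM _ (ltW L0) (ltW s0)) powR_tail// [(1 + s) `^ (- b)]powRN [s `^ (- b)]powRN.
  by field; rewrite !gt_eqF ?powR_gt0.
- exact: exhausts_oo.
- exact: interval_open.
- exact: interval_open.
- by move=> x y _ _ xy; rewrite ltr_pM2l.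
- move=> x; rewrite !in_itv/= => /andP[x0 xE].
  by rewrite mulr_gt0//= mulrC -ltr_pdivlMr.
- move=> y; rewrite !in_itv/= => /andP[y0 yE].
  by rewrite divr_gt0//= ltr_pM2r ?invr_gt0// yE; split=> //; field; rewrite gt_eqF.
- by move=> x _; apply: has_deriv_eq; [deriv|ring].
- by move=> x _; exact: cvg_cst.
- by move=> x _; exact: ltW.
- move=> y; rewrite in_itv/= => /andP[y0 _].
  have : {for y, continuous (fun y => defect b p q 0 y)}; last exact.
  have n1 : L + y != 0 by rewrite gt_eqF//; lra.
  have n2 : 0 + y != 0 by rewrite gt_eqF//; lra.
  have n3 : 0 < (L - 0) / (L + y) by rewrite divr_gt0//; lra.
  by rewrite /defect; cont.
- move=> y; rewrite in_itv/= => /andP[y0 _].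
  by have /andP[] := defect_bounds b0 b1 pq (lexx 0) L0 y0.
Qed.

(** 1 + (e - q) / (q - p) = (e - p) / (q - p) trades the factor (q - p)^-b for
(e - p)^-b, which is the same for all q. *)
Lemma normal_slope : near_defect b p q e 0 + far_defect b q e 0 =
  (e - p) `^ (- b) * profile b (E / L).
Proof.
have [[b0' b1'] [pq' qe']] := conj (conj b0 b1) (conj pq qe).
have L0 : 0 < L by rewrite subr_gt0.
have E0 : 0 < E by rewrite subr_gt0.
have W0 : 0 < e - p by lra.
rewrite near_defect_profile far_defect0// /profile.
have -> : 1 + E / L = (e - p) / L by field; rewrite gt_eqF.
rewrite !powRN !powR_div ?(ltW W0) ?(ltW L0) ?(ltW E0)//.
by field; rewrite !gt_eqF ?powR_gt0.
Qed.

End normal_slope.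

Section usol_continuous.
Context {R : realType}.
Variables (b p q e : R).
Hypotheses (b0 : 0 < b) (b1 : b < 1) (pq : p < q) (qe : q < e).

(** On the left 1 - u is t^b times a convergent quantity by [usol_normal_derive]; on
the right u is constant. *)
Lemma usol_continuous_free : {for q, continuous (usol b p q e)}.
Proof.
have [[b0' b1'] [pq' qe']] := conj (conj b0 b1) (conj pq qe).
rewrite /prop_for /continuous_at (usol_one b p (lexx q) qe).
have /cvgrPdist_lt c : usol b p q e (q - t) @[t --> 0^'+] --> (1 : R).
  have h := cvgM (powR_cvg0 b0 : t `^ b @[t --> 0^'+] --> (0 : R))
    (usol_normal_derive b0 b1 pq qe).
  have h1 : (1 : R) @[t --> (0 : R)^'+] --> (1 : R) by exact: cvg_cst.
  have {h h1} := cvgD (h _) h1; rewrite mul0r add0r => h.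
  apply: (cvg_trans _ (h _ _)); apply: near_eq_cvg; near=> t.
  have t0 : 0 < t by near: t; exact: nbhs_right_gt.
  transitivity (t `^ b * ((usol b p q e (q + t * -1) - usol b p q e q) / t `^ (2 * b / 2)) + 1) => //.
  rewrite mulrN1 (usol_one b p (lexx q) qe) (_ : 2 * b / 2 = b); last by field.
  by field; rewrite gt_eqF ?powR_gt0.
apply/cvgrPdist_lt => eps eps0.
have /nbhs_ballP[d /= d0 cd] : \forall t \near (0 : R), 0 < t -> `|1 - usol b p q e (q - t)| < eps.
  exact: c.
near=> y.
have [yq|qy] := ltP y q; last first.
  rewrite usol_one ?subrr ?normr0//.
  by near: y; exact: lt_nbhsl.
have -> : y = q - (q - y) by ring.
apply: cd; last by rewrite subr_gt0.
rewrite /ball/= sub0r normrN.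
by near: y; exact: cvgr_dist_lt.
Unshelve. all: by end_near. Qed.

Lemma usol_continuous x : p < x -> x < e -> {for x, continuous (usol b p q e)}.
Proof.
move=> px xe; have [xq|qx|->] := ltgtP x q; last exact: usol_continuous_free.
  exact: locally_lipschitz_continuous (usol_lipschitz e b0 b1 pq px xq).
rewrite /prop_for /continuous_at (usol_one b p (ltW qx) xe).
have h : (1 : R) @[y --> x] --> (1 : R) by exact: cvg_cst.
apply: (cvg_trans _ h); apply: near_eq_cvg; near=> y.
rewrite usol_one//; near: y; last exact: lt_nbhsl.
by apply: filterS (lt_nbhsr qx) => z /ltW.
Unshelve. all: by end_near. Qed.

End usol_continuous.

Lemma closure_itv_oo (R : realType) (a e : R) : a < e ->
  closure `]a, e[%classic a.
Proof.
move=> ae B Ba.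
have /filter_ex[y [h1 h2]] : \forall y \near a^'+, B y /\ `]a, e[%classic y.
  near=> y; split.
    by near: y; apply: cvg_within.
  rewrite /= in_itv/=; apply/andP; split; near: y.
    exact: nbhs_right_gt.
  exact: nbhs_right_lt.
by exists y.
Unshelve. all: by end_near. Qed.

Section classification.
Context {R : realType}.
Variables (b x0 r : R).
Hypotheses (b0 : 0 < b) (b1 : b < 1) (r0 : 0 < r).
Notation p := (x0 - r).
Notation e := (x0 + r).

Definition usol_lambda (v : R) : R := (2 * r) `^ (- b) * profile b v / betaR b.
(** The q with (e - q) / (q - p) = v. *)
Definition free_point (v : R) : R := p + 2 * r / (1 + v).
Definition usol_pair (v : R) : (R -> R) * set R :=
  (usol b p (free_point v) e, `]free_point v, e[%classic).

Lemma free_point_bounds v : 0 < v -> p < free_point v < e.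
Proof.
have r0' := r0; move=> v0; rewrite /free_point ltrDl divr_gt0//=; try lra.
have : 2 * r / (1 + v) < 2 * r by rewrite ltr_pdivrMr; nra.
by lra.
Qed.

Lemma free_point_ratio v : 0 < v -> (e - free_point v) / (free_point v - p) = v.
Proof. by have r0' := r0; move=> v0; rewrite /free_point; field; rewrite !gt_eqF//; lra. Qed.

Lemma free_point_surj q : p < q -> q < e -> exists2 v, 0 < v & q = free_point v.
Proof.
have r0' := r0; move=> pq qe; exists ((e - q) / (q - p)); first by rewrite divr_gt0; lra.
by rewrite /free_point; field; rewrite !gt_eqF; lra.
Qed.

Lemma usol_pair_inj v w : 0 < v -> 0 < w -> usol_pair v = usol_pair w -> v = w.
Proof.
move=> v0 w0 [_ K].
suff h : free_point v = free_point w by rewrite -(free_point_ratio v0) h free_point_ratio.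
have /andP[_ ve] := free_point_bounds v0; have /andP[_ we] := free_point_bounds w0.
(* the free boundary point is recovered as the infimum of K *)
rewrite -[LHS](@inf_itv _ (BLeft e) false) ?bnd_simp// K inf_itv// bnd_simp.
Qed.

Lemma usol_slope v : 0 < v ->
  is_frac_normal_derive (2 * b) (usol b p (free_point v) e) (free_point v) (-1) (- usol_lambda v).
Proof.
move=> v0; have /andP[pq qe] := free_point_bounds v0.
have := usol_normal_derive b0 b1 pq qe.
rewrite normal_slope// free_point_ratio//.
by have -> : e - p = 2 * r by ring.
Qed.

Lemma usol_harmonic q x : p < q -> q < e -> p < x -> x < q ->
  is_frac_lap (2 * b) (usol b p q e) x 0.
Proof.
move=> pq qe px xq.
have bal := usol_balanced b0 b1 pq qe px xq.
apply: (balanced_frac_lap b0 b1 _ _ _ _ bal); rewrite ?subr_gt0//.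
- exact: measurable_usol.
- by move=> z; have /andP[] := usol_bounds b0 b1 pq qe z.
- exact: usol_lipschitz.
Qed.

(** Every v > 0 gives a solution, for the parameter [usol_lambda]. *)
Lemma usol_solution v : 0 < v ->
  bernoulli_solution (2 * b) x0 r (usol_lambda v) (usol_pair v).
Proof.
move=> v0; have /andP[pq qe] := free_point_bounds v0.
have mem x : `[free_point v, e]%classic x -> free_point v <= x <= e by rewrite /= in_itv.
split.
- exact: usol_bounds.
- exact: measurable_usol.
- move=> x; rewrite inE /sym_itv/= in_itv/= => /andP[px xe].
  exact: usol_continuous.
- exists (free_point v); split; split => //.
  + move=> x; rewrite /sym_itv/= !in_itv/= => /andP[h ->]; rewrite andbT.
    exact: lt_trans h.
  + move=> x []; rewrite /sym_itv/= in_itv/= => /andP[px xe] xK.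
    apply: usol_harmonic => //.
    have [//|qx] := ltP x (free_point v); exfalso; apply: xK.
    move: qx; rewrite le_eqVlt => /predU1P[<-|qx].
      exact: closure_itv_oo.
    by apply: subset_closure; rewrite /= in_itv/= qx xe.
  + move=> x [/itv_closure /mem /andP[h1 h2] /eqP xe].
    by rewrite usol_one// lt_neqAle xe.
  + move=> x; rewrite /sym_itv/= in_itv/= => /negP; rewrite negb_and -!leNgt.
    by move=> /orP[h|h]; [rewrite usol_left|rewrite usol_right].
  + exact: usol_slope.
Qed.

(** K cannot start at p, where u would have to be both 1 and 0. Outside (p, a) the
boundary conditions make u equal to the Poisson solution, and inside the
comparison principle applies in both directions. Uniqueness of the one-sided
limit then gives lambda. *)
Lemma solution_usol lambda uK : bernoulli_solution (2 * b) x0 r lambda uK ->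
  exists v, [/\ 0 < v, uK = usol_pair v & lambda = usol_lambda v].
Proof.
have r0' := r0; case: uK => u K [ub um uc [a [[ae KE KD] [lapu u1 u0 der]]]].
rewrite {}KE in KD lapu u1 *.
have pe : p < e by lra.
have ap : p <= a.
  rewrite leNgt; apply/negP => ap.
  have : `]a, e[%classic p by rewrite /= in_itv/= ap pe.
  by move=> /KD; rewrite /sym_itv/= in_itv/= ltxx.
have aK := closure_itv_oo ae.
have pa : p < a.
  rewrite lt_neqAle ap andbT; apply/eqP => pa.
  have : u a = 1 by apply: u1; split => // ae'; move: ae; rewrite -ae' ltxx.
  rewrite u0; last by rewrite -pa /sym_itv/= in_itv/= ltxx.
  by move=> /eqP; rewrite eq_sym oner_eq0.
have [v v0 aE] := free_point_surj pa ae.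
exists v; rewrite /usol_pair -aE.
have uE : u = usol b p a e.
  have out y : ~~ (p < y < a) -> u y = usol b p a e y.
    rewrite negb_and -!leNgt => /orP[yp|ay].
      rewrite usol_left// u0// /sym_itv/= in_itv/= => /andP[py _].
      by move: yp; rewrite leNgt py.
    have [ye|ey] := ltP y e; last first.
      rewrite usol_right// u0// /sym_itv/= in_itv/= => /andP[_ ye].
      by move: ey; rewrite leNgt ye.
    rewrite usol_one// u1//; split; last by move=> /= ye'; move: ye; rewrite ye' ltxx.
    move: ay; rewrite le_eqVlt => /predU1P[<-//|ay].
    by apply: subset_closure; rewrite /= in_itv/= ay ye.
  have uc' x : p < x -> x < a -> {for x, continuous u}.
    move=> px xa; apply: uc; rewrite inE /sym_itv/= in_itv/= px.
    exact: lt_trans ae.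
  have sc x : p < x -> x < a -> {for x, continuous (usol b p a e)}.
    move=> px xa; apply: usol_continuous => //.
    exact: lt_trans ae.
  have ul x : p < x -> x < a -> is_frac_lap (2 * b) u x 0.
    move=> px xa; apply: lapu; split.
      by rewrite /sym_itv/= in_itv/= px (lt_trans xa).
    by move=> /itv_closure; rewrite /= in_itv/= leNgt xa.
  have sl x : p < x -> x < a -> is_frac_lap (2 * b) (usol b p a e) x 0.
    by move=> px xa; apply: usol_harmonic.
  have sb := usol_bounds b0 b1 pa ae.
  have sm := measurable_usol e b0 b1 pa.
  apply/funext => x; apply/eqP; rewrite eq_le; apply/andP; split.
    by apply: (frac_lap_comparison b0 b1 pa um sm) => // y /out ->.
  by apply: (frac_lap_comparison b0 b1 pa sm um) => // y /out ->.
split => //; first by rewrite uE.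
apply: oppr_inj; apply: (cvg_unique _ der) => //.
by have := usol_slope v0; rewrite -aE -uE.
Qed.

End classification.

Local Open Scope card_scope.

Lemma card_set2 (T : Type) (x y : T) : x <> y -> [set x; y] #= `I_2.
Proof.
move=> xy; apply/card_set_bijP; exists (fun z => if `[< z = x >] then 0%N else 1%N).
have xE : `[< x = x >] = true by apply/asboolP.
have yE : `[< y = x >] = false by apply/asboolP => /esym.
split.
- by move=> _ [] ->; rewrite ?xE ?yE.
- by move=> u v; rewrite !inE => -[] -> [] ->; rewrite ?xE ?yE.
- move=> [|[|//]] _; first by exists x; [left|rewrite xE].
  by exists y; [right|rewrite yE].
Qed.

Section counting.
Context {R : realType}.
Variables (b x0 r v0 : R).
Hypotheses (b0 : 0 < b) (b1 : b < 1) (r0 : 0 < r) (v00 : 0 < v0).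
Hypothesis min : forall v, 0 < v -> v != v0 -> profile b v0 < profile b v.
Hypothesis two : forall c, profile b v0 < c -> exists v1 v2,
  [/\ 0 < v1, v1 < v0, v0 < v2, profile b v1 = c &
     profile b v2 = c /\ forall v, 0 < v -> profile b v = c -> v = v1 \/ v = v2].

Let scale_gt0 : 0 < (2 * r) `^ (- b) / betaR b.
Proof. by rewrite divr_gt0 ?powR_gt0 ?mulr_gt0// betaR_gt0. Qed.

Let usol_lambdaE v : usol_lambda b r v = (2 * r) `^ (- b) / betaR b * profile b v.
Proof. by rewrite /usol_lambda mulrAC. Qed.

Let lambda_inj v w : usol_lambda b r v = usol_lambda b r w -> profile b v = profile b w.
Proof. by rewrite !usol_lambdaE => /mulfI; apply; rewrite gt_eqF. Qed.

Lemma solutions_below lambda : lambda < usol_lambda b r v0 ->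
  bernoulli_solutions (2 * b) x0 r lambda = set0.
Proof.
move=> lt; apply/seteqP; split=> // s /(solution_usol b0 b1 r0)[v [vp _ lE]].
move: lt; rewrite lE !usol_lambdaE ltr_pM2l// => lt.
have [vv|/(min vp)] := eqVneq v v0; first by move: lt; rewrite vv ltxx.
by move=> /(lt_trans lt); rewrite ltxx.
Qed.

Lemma solutions_at : bernoulli_solutions (2 * b) x0 r (usol_lambda b r v0) #= `I_1.
Proof.
have -> : bernoulli_solutions (2 * b) x0 r (usol_lambda b r v0) = [set usol_pair b x0 r v0].
  apply/seteqP; split => [s /(solution_usol b0 b1 r0)[v [vp -> /lambda_inj lE]]|_ ->].
    have [->//|/(min vp)] := eqVneq v v0.
    by rewrite lE ltxx.
  exact: usol_solution.
exact: card_set1.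
Qed.

Lemma solutions_above lambda : usol_lambda b r v0 < lambda ->
  bernoulli_solutions (2 * b) x0 r lambda #= `I_2.
Proof.
have c0 := scale_gt0; have cE := usol_lambdaE.
set c := (2 * r) `^ (- b) / betaR b in c0 cE.
rewrite cE mulrC -ltr_pdivlMr// => /two[v1 [v2 [v10 v1v v2v e1 [e2 un]]]].
have lE v : profile b v = lambda / c -> usol_lambda b r v = lambda.
  by move=> pE; rewrite cE pE mulrC divfK// gt_eqF.
have v20 : 0 < v2 by exact: lt_trans v2v.
have -> : bernoulli_solutions (2 * b) x0 r lambda =
    [set usol_pair b x0 r v1; usol_pair b x0 r v2].
  apply/seteqP; split => [s /(solution_usol b0 b1 r0)[v [vp -> lv]]|_ []->].
  - have [->|->] : v = v1 \/ v = v2; [|by left|by right].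
    by apply: un => //; rewrite lv cE [c * _]mulrC mulfK// gt_eqF.
  - by rewrite -(lE _ e1); exact: usol_solution.
  - by rewrite -(lE _ e2); exact: usol_solution.
apply: card_set2 => /(usol_pair_inj r0 v10 v20) v12.
by have := lt_trans v1v v2v; rewrite v12 ltxx.
Qed.

End counting.

Theorem theorem1p3 (R : realType) :
  exists mu : R -> set R -> R,
  forall alpha x0 r : R, 0 < alpha < 2 -> 0 < r ->
    let D := sym_itv x0 r in
    [/\ 0 < mu alpha D,
        forall lambda : R, 0 < lambda ->
          [/\ (mu alpha D < lambda ->
                 bernoulli_solutions alpha x0 r lambda #= `I_2),
              (lambda = mu alpha D ->
                 bernoulli_solutions alpha x0 r lambda #= `I_1) &
              (lambda < mu alpha D ->
                 bernoulli_solutions alpha x0 r lambda = set0)] &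
        mu alpha D = r `^ (- (alpha / 2)) * mu alpha `](-1), 1[%classic].
Proof.
pose good (b v0 : R) := 0 < b -> b < 1 -> [/\ 0 < v0,
  (forall v, 0 < v -> v != v0 -> profile b v0 < profile b v) &
  (forall c, profile b v0 < c -> exists v1 v2, [/\ 0 < v1, v1 < v0, v0 < v2, profile b v1 = c &
     profile b v2 = c /\ forall v, 0 < v -> profile b v = c -> v = v1 \/ v = v2])].
have [vmin vminP] : {vmin : R -> R & forall b, good b (vmin b)}.
  apply: (@choice _ _ good) => b.
  have [b0|] := ltP 0 b; last by move=> h; exists 0 => /lt_le_trans/(_ h); rewrite ltxx.
  have [b1|] := ltP b 1; last by move=> h; exists 0 => _ /lt_le_trans/(_ h); rewrite ltxx.
  by have [v0 v00 [h1 h2]] := profile_unimodal b0 b1; exists v0 => _ _; split.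
exists (fun alpha D => usol_lambda (alpha / 2) ((sup D - inf D) / 2) (vmin (alpha / 2))).
move=> alpha x0 r /andP[a0 a2] r0 D.
pose b := alpha / 2.
have b0 : 0 < b by rewrite divr_gt0.
have b1 : b < 1 by rewrite ltr_pdivrMr ?mul1r.
have alphaE : alpha = 2 * b by rewrite /b; field.
have [v00 h1 h2] := vminP b b0 b1.
have rE : (sup D - inf D) / 2 = r.
  by rewrite /D /sym_itv sup_itv ?inf_itv ?bnd_simp; [field|lra|lra].
have oneE : (sup `](-1), 1[%classic - inf `](-1), 1[%classic) / 2 = 1 :> R.
  by rewrite sup_itv ?inf_itv ?bnd_simp; [field|lra|lra].
rewrite rE oneE -/b; split.
- rewrite /usol_lambda divr_gt0 ?betaR_gt0//; apply: mulr_gt0; last exact: profile_gt0.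
  by rewrite powR_gt0// mulr_gt0.
- move=> lambda _; split.
  + by rewrite alphaE; exact: solutions_above.
  + by move=> ->; rewrite alphaE; exact: solutions_at.
  + by rewrite alphaE; exact: solutions_below.
- rewrite /usol_lambda mulr1 powRM//; last exact: ltW.
  by rewrite !mulrA [r `^ _ * _]mulrC.
Qed.
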